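(* Let $q$ be a prime power, a power of the prime $p$. In the polar unital $\mathbb{U}_{\mathrm{Fig}(q^6)}$ of order $q^3$ of the Figueroa plane $\mathrm{Fig}(q^6)$, there is a subunital $\mathbb{H}$ isomorphic to the hermitian unital of order $q$ such that every point of $\mathbb{H}$ is the center of a group of order $q$ consisting of translations of $\mathbb{U}_{\mathrm{Fig}(q^6)}$. In particular, the point set of $\mathbb{H}$ is contained in $\Omega_p$. Moreover, if $G$ is the group generated by all elations of $\mathrm{Fig}(q^6)$ that leave $\mathbb{U}_{\mathrm{Fig}(q^6)}$ invariant, then $G$ is isomorphic to the commutator group of $\mathrm{PSU}_3(\mathbb{F}_{q^2}|\mathbb{F}_q)$ and acts two-transitively on the point set of $\mathbb{H}$.
   Context: For a prime power $r$, the Figueroa plane $\mathrm{Fig}(r^3)$ is Figueroa's projective plane of order $r^3$; it contains a pappian (desarguesian) subplane $\mathbb{D}$ of order $r$, and all automorphisms of $\mathbb{D}$ extend to automorphisms of $\mathrm{Fig}(r^3)$. For $r=q^2$ the plane $\mathrm{Fig}(q^6)$ admits a polarity $\pi$ (extending a unitary polarity of $\mathbb{D}$) whose absolute points, with blocks induced by lines meeting the absolute point set in more than one point, form a unital $\mathbb{U}_{\mathrm{Fig}(q^6)}$ of order $q^3$; $\mathbb{H}$ denotes its intersection with $\mathbb{D}$. A unital of order $m$ is a $2$-$(m^3+1,m+1,1)$ design; a translation with center $c$ is an automorphism fixing $c$ and every block through $c$; $\Omega_p$ is the set of points that are centers of translations of order $p$. The hermitian unital of order $q$ consists of the absolute points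 of a unitary polarity of the desarguesian plane over $\mathbb{F}_{q^2}$ with blocks induced by secant lines. An elation of a projective plane is a collineation fixing all points of a line (axis) and all lines through a point (center) on that axis.
   Formalization: Two-transitivity of G on the point set of H is claimed only for q > 2: for q = 2 the commutator group of PSU_3 has order 18, while a two-transitive group on the 9 points of H has order divisible by 72; all other claims are for every prime power q. *)

(* Defs.v *)
From mathcomp Require Import all_boot all_order all_algebra.
From mathcomp Require Import all_fingroup all_solvable.

Set Implicit Arguments.
Unset Strict Implicit.
Unset Printing Implicit Defensive.

Import GRing.Theory.
Local Open Scope ring_scope.

(* Incidence structures on a finite type T are given by a set of points
   X : {set T} and a set of blocks B : {set {set T}}, a block being identified
   with the set of points on it.  For projective planes X is all of T. *)
Section IncidenceStructures.

Variable T : finType.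
Implicit Types (X S : {set T}) (B : {set {set T}}) (s : {perm T}).

Definition induced_blocks B S : {set {set T}} :=
  [set b :&: S | b in B & (1 < #|b :&: S|)%N].

Definition is_design2 (v k : nat) X B : Prop :=
  [/\ #|X| = v,
      forall b, b \in B -> b \subset X /\ #|b| = k
    & forall x y, x \in X -> y \in X -> x != y ->
        #|[set b in B | (x \in b) && (y \in b)]| = 1%N].

Definition is_unital (m : nat) X B : Prop := is_design2 (m ^ 3 + 1) (m + 1) X B.

Definition is_subunital (m : nat) X B S : Prop :=
  S \subset X /\ is_unital m S (induced_blocks B S).

(* An automorphism of (X, B) is a permutation of T that moves only points of X;
   by finiteness, mapping blocks to blocks makes it bijective on blocks. *)
Definition is_automorphism X B s : bool :=
  perm_on X s && [forall b in B, s @: b \in B].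

Definition is_translation X B (c : T) s : bool :=
  [&& is_automorphism X B s, s c == c
    & [forall b in B, (c \in b) ==> (s @: b == b)]].

Definition Omega (p : nat) X B : {set T} :=
  [set c in X | [exists s, is_translation X B c s && (#[s]%g == p)]].

(* The identity counts as an elation. *)
Definition is_elation B s : bool :=
  is_automorphism [set: T] B s &&
  [exists a in B, exists c in a,
     [forall x in a, s x == x] &&
     [forall b in B, (c \in b) ==> (s @: b == b)]].

End IncidenceStructures.

Definition isomorphic_structures (T T' : finType)
    (X : {set T}) (B : {set {set T}}) (X' : {set T'}) (B' : {set {set T'}}) :
    Prop :=
  exists f : T -> T',
    [/\ {in X &, injective f}, f @: X = X'
      & [set f @: (b : {set T}) | b in B] = B'].

(* Subspaces of the row space K^3 are represented by square matrices in the
   canonical form produced by <<_>>%MS, so that equality of subspaces is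
   equality of matrices; points and lines are those of rank 1 and 2. *)
Section DesarguesianPlane.

Variable K : finFieldType.

Definition point : finType := {A : 'M[K]_3 | (<<A>>%MS == A) && (\rank A == 1%N)}.
Definition line : finType := {A : 'M[K]_3 | (<<A>>%MS == A) && (\rank A == 2%N)}.

Definition desarguesian_lines : {set {set point}} :=
  [set [set x : point | (val x <= val l)%MS] | l : line].

(* Image of a subspace under the collineation induced by x |-> x ^+ n (a field
   automorphism when n is a power of the characteristic). *)
Definition frob (n : nat) (A : 'M[K]_3) : 'M[K]_3 :=
  <<map_mx (fun x : K => x ^+ n) A>>%MS.

Definition is_hermitian_form (s : nat) (M : 'M[K]_3) : Prop :=
  (map_mx (fun x : K => x ^+ s) M)^T = M /\ M \in unitmx.

(* The orthogonal space of A for the form (y, a) |-> y M (a ^+ s)^T; for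
   #|K| = s ^ 2 and M hermitian this is the unitary polarity given by M. *)
Definition perp (s : nat) (M A : 'M[K]_3) : 'M[K]_3 :=
  <<kermx (M *m (map_mx (fun x : K => x ^+ s) A)^T)>>%MS.

Definition hermitian_points (s : nat) (M : 'M[K]_3) : {set point} :=
  [set x : point | (val x <= perp s M (val x))%MS].

Definition hermitian_blocks (s : nat) (M : 'M[K]_3) : {set {set point}} :=
  induced_blocks desarguesian_lines (hermitian_points s M).

Definition SU3 (s : nat) (M : 'M[K]_3) : {set {'GL_3[K]}} :=
  [set g : {'GL_3[K]} |
     (GLval g *m M *m (map_mx (fun x : K => x ^+ s) (GLval g))^T == M)
     && (\det (GLval g) == 1)].

(* The image of SU_3 in PGL_3 = GL_3 / Z(GL_3). *)
Definition PSU3 (s : nat) (M : 'M[K]_3) : {set coset_of 'Z('GL_3[K])%g} :=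
  (SU3 s M / 'Z('GL_3[K]))%g.

End DesarguesianPlane.

(* Grundhoefer's description of the Figueroa plane of order r ^ 3, where
   #|K| = r ^ 3 and alpha = frob r is the planar collineation of order 3 of
   PG(2, K) whose fixed elements form the subplane D of order r.  The points and
   lines are those of PG(2, K); incidence is changed only between points and
   lines whose alpha-orbit is a triangle (type III). *)
Section FigueroaPlane.

Variables (K : finFieldType) (r : nat).
Implicit Types A : 'M[K]_3.

Definition triangle_point A : bool :=
  \rank (A + frob r A + frob r (frob r A))%MS == 3%N.

Definition triangle_line A : bool :=
  \rank (A :&: frob r A :&: frob r (frob r A))%MS == 0%N.

Definition mu_point A : 'M[K]_3 := (frob r A + frob r (frob r A))%MS.
Definition mu_line A : 'M[K]_3 := (frob r A :&: frob r (frob r A))%MS.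

Definition fig_incident (x l : 'M[K]_3) : bool :=
  if triangle_point x && triangle_line l then (mu_line l <= mu_point x)%MS
  else (x <= l)%MS.

Definition fig_lines : {set {set point K}} :=
  [set [set x : point K | fig_incident (val x) (val l)] | l : line K].

Definition subplane_points : {set point K} :=
  [set x : point K | frob r (val x) == val x].

(* For #|K| = q ^ 6, r = q ^ 2 and a hermitian M with entries in the subfield of
   order r, perp (q ^ 3) M commutes with alpha, hence also preserves Figueroa
   incidence; it extends the unitary polarity of D given by M, because
   x ^+ (q ^ 3) = x ^+ q on the subfield. *)
Definition fig_absolute_points (s : nat) (M : 'M[K]_3) : {set point K} :=
  [set x : point K | fig_incident (val x) (perp s M (val x))].

End FigueroaPlane.

Section PolarUnital.

Variables (K : finFieldType) (q : nat) (M : 'M[K]_3).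

Definition U_points : {set point K} := fig_absolute_points (q ^ 2) (q ^ 3) M.

Definition U_blocks : {set {set point K}} :=
  induced_blocks (fig_lines K (q ^ 2)) U_points.

Definition H_points : {set point K} := U_points :&: subplane_points K (q ^ 2).

Definition H_blocks : {set {set point K}} := induced_blocks U_blocks H_points.

Definition U_elation_group : {set {perm point K}} :=
  <<[set s : {perm point K} |
       is_elation (fig_lines K (q ^ 2)) s && (s @: U_points == U_points)]>>%g.

End PolarUnital.

(* Main.v *)
Require Import Defs.
From HB Require Import structures.
From mathcomp Require Import all_boot all_order all_algebra.
From mathcomp Require Import all_fingroup all_solvable.
From mathcomp Require Import ring zify finfield.

Set Implicit Arguments.
Unset Strict Implicit.
Unset Printing Implicit Defensive.

Import GRing.Theory.
Local Open Scope ring_scope.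

(* After a change of coordinates over the subfield F of order q^2 the polarity is
   given by the antidiagonal hermitian form h, and Figueroa incidence becomes a
   symmetric relation I on points: h(x, y) = 0, except that for two points of
   type III it is h(star x, star y) = 0, where star x is the cross product of the
   two Frobenius images of x.  This depends only on the values of h on Frobenius
   images, so unitary matrices over F act.  There are as many absolute points as on
   the hermitian curve, because star is a bijection on type III points, and a
   variance count makes them a unital.

   The transvections of SU_3 give the translations.  Conversely an elation that
   preserves the unital commutes with the polarity, hence has an absolute centre
   and its polar as axis.  For a centre in the subplane it is a transvection; for
   the other two types of centre one compares the ordinary and the Figueroa points
   on image lines of type III.  The counting for type III centres needs q > 2, and
   q = 2 is settled by a computation in the field of order 64.

   Transvections are commutators of unipotent elements, and by transitivity of the
   group N they generate on isotropic points (on pairs of them when q > 2), SU_3 is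
   the product of N and a subgroup that is abelian modulo N, so N = [SU_3, SU_3]. *)

(** * Vectors in three dimensions *)

(** An elation is only given as a permutation, so its linearity has to be extracted from incidence.
    On the points and lines that are not of type III the incidence is hermitian, and the auxiliary
    lines below are chosen there. Such choices are linear algebra over the fixed field of [fr],
    because [W (a, b, c)] vanishes exactly when a, b, c are dependent over it. The contradiction for
    type II centres is that a type III line has at most two type III points on which both incidences
    agree. For a type III centre c the elation acts on stars like a transvection, with a parameter
    that may depend on the point. Joining points through an auxiliary one makes the parameter
    constant on most of a type II line with type III image, where a polynomial of degree r^2, with r
    = q^2, then has too many roots. The count contradicts r^3 + 1 <= 7 r^2 + 5 r + 8, which fails
    from r = 8 on but holds for r = 4. Two-transitivity is limited to q > 2 for a good reason: for q
    = 2 the commutator group has order 18, while nine points have 72 ordered pairs. *)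

Section Vec.

Variable K : fieldType.

Definition vec := (K * K * K)%type.
Definition vec0 : vec := (0, 0, 0).
Definition dot (u v : vec) : K := u.1.1 * v.1.1 + u.1.2 * v.1.2 + u.2 * v.2.
Definition cross (u v : vec) : vec :=
  (u.1.2 * v.2 - u.2 * v.1.2, u.2 * v.1.1 - u.1.1 * v.2,
   u.1.1 * v.1.2 - u.1.2 * v.1.1).
Definition det3 (u v w : vec) : K := dot u (cross v w).
Definition vsc (k : K) (v : vec) : vec := (k * v.1.1, k * v.1.2, k * v.2).
Definition vadd (u v : vec) : vec := (u.1.1 + v.1.1, u.1.2 + v.1.2, u.2 + v.2).
Definition par (u v : vec) : bool := cross u v == vec0.

Lemma vecE (a b c a' b' c' : K) : a = a' -> b = b' -> c = c' ->
  (a, b, c) = (a', b', c') :> vec.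
Proof. by move=> -> -> ->. Qed.

Ltac vr := rewrite /par /det3 /dot /cross /vsc /vadd /vec0 /=; try apply: vecE;
  rewrite /=; ring.

Lemma vsc_eq0 k u : (vsc k u == vec0) = (k == 0) || (u == vec0).
Proof.
case: u => [[a b] c]; rewrite /vsc /vec0 /= !xpair_eqE !mulf_eq0.
by case: (k == 0).
Qed.

Lemma vsc0 u : vsc 0 u = vec0. Proof. by vr. Qed.
Lemma vsc1 u : vsc 1 u = u. Proof. by case: u => [[a b] c]; vr. Qed.
Lemma vscA k l u : vsc k (vsc l u) = vsc (k * l) u. Proof. by vr. Qed.
Lemma vadd0 u : vadd u vec0 = u. Proof. by case: u => [[a b] c]; vr. Qed.

Lemma dotC u v : dot u v = dot v u. Proof. by vr. Qed.
Lemma dotZl k u v : dot (vsc k u) v = k * dot u v. Proof. by vr. Qed.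
Lemma dotZr k u v : dot u (vsc k v) = k * dot u v. Proof. by vr. Qed.
Lemma dotDl u v w : dot (vadd u v) w = dot u w + dot v w. Proof. by vr. Qed.
Lemma dotDr u v w : dot w (vadd u v) = dot w u + dot w v. Proof. by vr. Qed.
Lemma dot0 u : dot u vec0 = 0. Proof. by vr. Qed.
Lemma crossC u v : cross u v = vsc (-1) (cross v u). Proof. by vr. Qed.
Lemma crossZl k u v : cross (vsc k u) v = vsc k (cross u v). Proof. by vr. Qed.
Lemma crossZr k u v : cross u (vsc k v) = vsc k (cross u v). Proof. by vr. Qed.
Lemma crossuu u : cross u u = vec0. Proof. by vr. Qed.
Lemma dot_crossl u v : dot u (cross u v) = 0. Proof. by vr. Qed.
Lemma dot_crossr u v : dot v (cross u v) = 0. Proof. by vr. Qed.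
Lemma crossA u v w :
  cross (cross u v) w = vadd (vsc (dot u w) v) (vsc (- dot v w) u).
Proof. by vr. Qed.
Lemma det3C u v w : det3 u v w = det3 v w u. Proof. by vr. Qed.
Lemma det3N u v w : det3 u v w = - det3 v u w. Proof. by vr. Qed.
Lemma det3Z k l m u v w :
  det3 (vsc k u) (vsc l v) (vsc m w) = k * l * m * det3 u v w.
Proof. by vr. Qed.

(** Cramer's rule for the dual basis: up to the determinant, the three cross products are dual to
    [u], [v], [w]. *)
Lemma det3_dual u v w x : vsc (det3 u v w) x =
  vadd (vadd (vsc (dot x u) (cross v w)) (vsc (dot x v) (cross w u)))
    (vsc (dot x w) (cross u v)).
Proof. by vr. Qed.

Lemma det3_basis u v w y : vsc (det3 u v w) y =
  vadd (vadd (vsc (det3 y v w) u) (vsc (det3 u y w) v)) (vsc (det3 u v y) w).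
Proof. by vr. Qed.

Lemma det3_mul u1 u2 u3 x1 x2 x3 : det3 u1 u2 u3 * det3 x1 x2 x3 =
  det3 (dot u1 x1, dot u1 x2, dot u1 x3) (dot u2 x1, dot u2 x2, dot u2 x3)
       (dot u3 x1, dot u3 x2, dot u3 x3).
Proof. by vr. Qed.

Lemma det3_cross u v w : det3 (cross v w) (cross w u) (cross u v) = det3 u v w ^+ 2.
Proof. by vr. Qed.

Lemma dot_cross2 u v w x :
  dot (cross u v) (cross w x) = dot u w * dot v x - dot u x * dot v w.
Proof. by vr. Qed.

(* Desargues: the triangles x and y are perspective from a line iff they are
   perspective from a point. *)
Lemma desargues x y z u v w :
  det3 (cross (cross y z) (cross v w)) (cross (cross z x) (cross w u))
       (cross (cross x y) (cross u v)) =
  det3 x y z * det3 u v w * det3 (cross x u) (cross y v) (cross z w).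
Proof. by vr. Qed.

Lemma par_sym u v : par u v = par v u.
Proof. by rewrite /par crossC vsc_eq0 oppr_eq0 oner_eq0. Qed.

Lemma parZl k u v : k != 0 -> par (vsc k u) v = par u v.
Proof. by move=> k0; rewrite /par crossZl vsc_eq0 (negPf k0). Qed.

Lemma parZr k u v : k != 0 -> par u (vsc k v) = par u v.
Proof. by move=> k0; rewrite /par crossZr vsc_eq0 (negPf k0). Qed.

Lemma par_ex u v : v != vec0 -> par u v -> exists k, u = vsc k v.
Proof.
case: u v => [[a b] c] [[x y] z]; rewrite /vec0 !xpair_eqE !negb_and => nz.
move/eqP; rewrite /cross /vec0 /= => -[] /subr0_eq e1 /subr0_eq e2 /subr0_eq e3.
have aux (p q s t : K) : t != 0 -> p * t = s * q -> p = s / t * q.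
  by move=> t0 e; rewrite mulrAC -e mulfK.
case/orP: nz => [/orP[nz|nz]|nz].
- exists (a / x); rewrite /vsc /=; apply: vecE; first by rewrite divfK.
    by apply: aux => //; rewrite -e3.
  by apply: aux.
- exists (b / y); rewrite /vsc /=; apply: vecE; last by apply: aux => //; rewrite e1.
    by apply: aux => //.
  by rewrite divfK.
- exists (c / z); rewrite /vsc /=; apply: vecE; last by rewrite divfK.
    by apply: aux => //; rewrite -e2.
  by apply: aux.
Qed.

Lemma par_exn u v : u != vec0 -> v != vec0 -> par u v ->
  exists2 k, k != 0 & u = vsc k v.
Proof.
move=> u0 v0 /(par_ex v0)[k e]; exists k => //.
by apply: contraNneq u0 => k0; rewrite e k0 vsc0.
Qed.

Lemma par_vsc k u : par (vsc k u) u.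
Proof. by rewrite /par crossZl crossuu /vsc /= !mulr0. Qed.

Lemma paruu u : par u u. Proof. by rewrite /par crossuu. Qed.

Lemma par_orth u v w : dot w u = 0 -> dot w v = 0 -> par (cross u v) w.
Proof.
move=> e1 e2; rewrite /par crossA !(dotC _ w) e1 e2; apply/eqP.
by rewrite /vsc /vadd /vec0 /=; apply: vecE; ring.
Qed.

Lemma par_trans v u w : v != vec0 -> par u v -> par v w -> par u w.
Proof.
move=> v0 /(par_ex v0)[k ->]; rewrite /par crossZl => /eqP ->.
by rewrite vsc_eq0 eqxx orbT.
Qed.

Lemma par_dot u v w : u != vec0 -> v != vec0 -> par u v ->
  (dot w u == 0) = (dot w v == 0).
Proof.
by move=> u0 v0 /(par_exn u0 v0)[k k0 ->]; rewrite dotZr mulf_eq0 (negPf k0).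
Qed.

Lemma det3_orth u v w x : det3 u v w != 0 ->
  dot x u = 0 -> dot x v = 0 -> dot x w = 0 -> x = vec0.
Proof.
move=> d0 e1 e2 e3; apply/eqP; have: vsc (det3 u v w) x == vec0.
  rewrite det3_dual e1 e2 e3 !vsc0; apply/eqP; vr.
by rewrite vsc_eq0 (negPf d0).
Qed.

Lemma det3_orth0 u v w x : x != vec0 ->
  dot x u = 0 -> dot x v = 0 -> dot x w = 0 -> det3 u v w = 0.
Proof.
move=> x0 e1 e2 e3; apply: contraNeq x0 => d0.
by apply/eqP; apply: (det3_orth d0).
Qed.

Lemma orth2_ex w : w != vec0 -> exists u v,
  [/\ dot u w = 0, dot v w = 0 & ~~ par u v].
Proof.
case: w => [[a b] c]; rewrite /vec0 !xpair_eqE !negb_and.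
case/orP=> [/orP[nz|nz]|nz].
- exists (- b, a, 0), (- c, 0, a); split; try vr.
  apply/eqP; case=> /= e _ _; have: a * a = 0 by rewrite -{}e; ring.
  by apply/eqP; rewrite mulf_eq0 negb_or nz.
- exists (b, - a, 0), (0, - c, b); split; try vr.
  apply/eqP; case=> /= _ e _; have: b * b = 0 by apply: oppr_inj; rewrite oppr0 -{}e; ring.
  by apply/eqP; rewrite mulf_eq0 negb_or nz.
- exists (c, 0, - a), (0, c, - b); split; try vr.
  apply/eqP; case=> /= _ _ e; have: c * c = 0 by rewrite -{}e; ring.
  by apply/eqP; rewrite mulf_eq0 negb_or nz.
Qed.

Lemma span2 u v w : ~~ par u v -> dot w u = 0 -> dot w v = 0 -> w != vec0 ->
  forall x, dot w x = 0 -> exists a b, x = vadd (vsc a u) (vsc b v).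
Proof.
move=> nuv e1 e2 w0 x ex.
have [k k0 wE] := par_exn nuv w0 (par_orth e1 e2).
(* [i] is a coordinate vector outside the plane orthogonal to [w], so that [u], [v], [i] form a
   basis. *)
have [i [k0' _]] : exists i : vec, dot i w != 0 /\ True.
  case: (w) w0 => [[a b] c]; rewrite /vec0 !xpair_eqE !negb_and.
  case/orP=> [/orP[nz|nz]|nz]; [exists (1,0,0)|exists (0,1,0)|exists (0,0,1)];
  by split=> //; rewrite /dot /= !mul0r ?mul1r ?addr0 ?add0r.
have nd : det3 u v i != 0 by rewrite -det3C /det3 wE dotZr mulf_neq0.
exists (det3 x v i / det3 u v i), (det3 u x i / det3 u v i).
have ed : det3 u v x = 0 by rewrite -det3C /det3 wE dotZr dotC ex mulr0.
have := det3_basis u v i x; rewrite ed vsc0 vadd0 => e.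
transitivity (vsc (det3 u v i)^-1 (vsc (det3 u v i) x)); last by rewrite e; vr.
by rewrite vscA mulVf // vsc1.
Qed.

End Vec.

Ltac vr := rewrite /par /det3 /dot /cross /vsc /vadd /vec0 /=; try apply: vecE;
  rewrite /=; ring.

(** * Figueroa incidence of vectors *)

Module FigueroaVectors.

Section FigVec.

Variables (K : fieldType) (fr cj : {rmorphism K -> K}).
Hypothesis fr3 : forall x, fr (fr (fr x)) = x.
Hypothesis cj2 : forall x, cj (cj x) = x.
Hypothesis cjfr : forall x, cj (fr x) = fr (cj x).

Local Notation vec := (vec K).
Implicit Types u v w x y : vec.

Definition frv u : vec := (fr u.1.1, fr u.1.2, fr u.2).
(** The covector of the polar line of [u]; the coordinates are reversed because the Gram matrix is
    antidiagonal. *)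
Definition sharp u : vec := (cj u.2, cj u.1.2, cj u.1.1).
Definition hf u v : K := dot u (sharp v).
Definition star u : vec := cross (frv u) (frv (frv u)).
(** Nonzero exactly when the three Frobenius conjugates of [u] form a triangle. *)
Definition W u : K := det3 u (frv u) (frv (frv u)).
Definition III u : bool := W u != 0.
(** A line is represented by its pole [v]. Its image under mu is the meet of the two conjugates of
    the covector [sharp v], that is [star (sharp v)], which is [sharp (star v)] up to sign; the line
    mu of the point [u] has covector [star u]. This yields the condition on the stars. *)
Definition Iv u v : bool :=
  if III u && III v then hf (star u) (star v) == 0 else hf u v == 0.

Lemma frv3 u : frv (frv (frv u)) = u.
Proof. by case: u => [[a b] c]; rewrite /frv /= !fr3. Qed.

Lemma frv_cross u v : frv (cross u v) = cross (frv u) (frv v).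
Proof. by rewrite /frv /cross /=; apply: vecE; rewrite rmorphB !rmorphM. Qed.

Lemma frvZ k u : frv (vsc k u) = vsc (fr k) (frv u).
Proof. by rewrite /frv /vsc /= !rmorphM. Qed.

Lemma frvD u v : frv (vadd u v) = vadd (frv u) (frv v).
Proof. by rewrite /frv /vadd /= !rmorphD. Qed.

Lemma fr_dot u v : fr (dot u v) = dot (frv u) (frv v).
Proof. by rewrite /dot /= !rmorphD !rmorphM. Qed.

Lemma fr_det3 u v w : fr (det3 u v w) = det3 (frv u) (frv v) (frv w).
Proof. by rewrite /det3 fr_dot frv_cross. Qed.

Lemma frv_eq0 u : (frv u == vec0 K) = (u == vec0 K).
Proof. by case: u => [[a b] c]; rewrite /frv /vec0 /= !xpair_eqE !fmorph_eq0. Qed.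

Lemma frv_par u v : par (frv u) (frv v) = par u v.
Proof. by rewrite /par -frv_cross frv_eq0. Qed.

Lemma sharp_cross u v : cross (sharp u) (sharp v) = vsc (-1) (sharp (cross u v)).
Proof.
by rewrite /sharp /cross /vsc /=; apply: vecE; rewrite !rmorphB !rmorphM; ring.
Qed.

Lemma sharpZ k u : sharp (vsc k u) = vsc (cj k) (sharp u).
Proof. by rewrite /sharp /vsc /= !rmorphM. Qed.

Lemma sharpD u v : sharp (vadd u v) = vadd (sharp u) (sharp v).
Proof. by rewrite /sharp /vadd /= !rmorphD. Qed.

Lemma sharpK u : sharp (sharp u) = u.
Proof. by case: u => [[a b] c]; rewrite /sharp /= !cj2. Qed.

Lemma sharp_eq0 u : (sharp u == vec0 K) = (u == vec0 K).
Proof.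
case: u => [[a b] c]; rewrite /sharp /vec0 /= !xpair_eqE !fmorph_eq0.
by case: (a == 0); case: (b == 0); case: (c == 0).
Qed.

Lemma sharp_par u v : par (sharp u) (sharp v) = par u v.
Proof. by rewrite /par sharp_cross vsc_eq0 oppr_eq0 oner_eq0 sharp_eq0. Qed.

Lemma sharp_frv u : sharp (frv u) = frv (sharp u).
Proof. by rewrite /sharp /frv /= !cjfr. Qed.

Lemma hfZl k u v : hf (vsc k u) v = k * hf u v.
Proof. exact: dotZl. Qed.

Lemma hfZr k u v : hf u (vsc k v) = cj k * hf u v.
Proof. by rewrite /hf sharpZ dotZr. Qed.

Lemma hfDl u v w : hf (vadd u v) w = hf u w + hf v w.
Proof. exact: dotDl. Qed.

Lemma hfDr u v w : hf w (vadd u v) = hf w u + hf w v.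
Proof. by rewrite /hf sharpD dotDr. Qed.

Lemma hfC u v : hf v u = cj (hf u v).
Proof.
by rewrite /hf /dot /sharp /= !rmorphD !rmorphM !cj2; ring.
Qed.

Lemma hf_sym u v : (hf u v == 0) = (hf v u == 0).
Proof. by rewrite (hfC v u) fmorph_eq0. Qed.

Lemma fr_W u : fr (W u) = W u.
Proof. by rewrite /W fr_det3 frv3 -det3C. Qed.

Lemma WZ k u : W (vsc k u) = k * fr k * fr (fr k) * W u.
Proof. by rewrite /W !frvZ det3Z. Qed.

Lemma starZ k u : star (vsc k u) = vsc (fr k * fr (fr k)) (star u).
Proof. by rewrite /star !frvZ crossZl crossZr vscA. Qed.

Lemma frv_star u : frv (star u) = cross (frv (frv u)) u.
Proof. by rewrite /star frv_cross frv3. Qed.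

Lemma frv2_star u : frv (frv (star u)) = cross u (frv u).
Proof. by rewrite frv_star frv_cross frv3. Qed.

(** [star u] is the side opposite to [u] in the triangle of conjugates; its conjugates are the other
    two sides, and these meet in the vertex [u]. *)
Lemma star_star u : star (star u) = vsc (W u) u.
Proof. by rewrite {1}/star frv2_star frv_star /W; vr. Qed.

Lemma W_star u : W (star u) = W u ^+ 2.
Proof. by rewrite {1}/W frv2_star frv_star det3_cross. Qed.

Lemma III_star u : III (star u) = III u.
Proof. by rewrite /III W_star expf_eq0. Qed.

Lemma IIIZ k u : k != 0 -> III (vsc k u) = III u.
Proof.
by move=> k0; rewrite /III WZ !mulf_eq0 !fmorph_eq0 (negPf k0).
Qed.

Lemma III_par u v : u != vec0 K -> v != vec0 K -> par u v -> III u = III v.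
Proof. by move=> u0 v0 /(par_exn u0 v0)[k k0 ->]; rewrite IIIZ. Qed.

Lemma III_neq0 u : III u -> u != vec0 K.
Proof. by apply: contraTneq => ->; rewrite /III /W /det3 /dot /= !mul0r !addr0 eqxx. Qed.

Lemma star_par u v : par u v -> u != vec0 K -> v != vec0 K -> par (star u) (star v).
Proof. by move=> p u0 v0; have [k _ ->] := par_exn u0 v0 p; rewrite starZ par_vsc. Qed.

Lemma W_sharp u : W (sharp u) = - cj (W u).
Proof.
rewrite /W -!sharp_frv /det3 sharp_cross dotZr mulN1r; congr (- _).
by rewrite /dot /sharp /= !rmorphD !rmorphM; ring.
Qed.

Lemma III_sharp u : III (sharp u) = III u.
Proof. by rewrite /III W_sharp oppr_eq0 fmorph_eq0. Qed.

Lemma star_sharp u : star (sharp u) = vsc (-1) (sharp (star u)).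
Proof. by rewrite /star -!sharp_frv sharp_cross. Qed.

Lemma hf_star u v : hf (star u) (star v) =
  - (hf (frv u) (frv v) * hf (frv (frv u)) (frv (frv v))
     - hf (frv u) (frv (frv v)) * hf (frv (frv u)) (frv v)).
Proof.
by rewrite /hf /star -[sharp (cross _ _)]vsc1 -[1]opprK -mulrN1 -mulN1r mulr1
   -vscA -sharp_cross dotZr dot_cross2 mulN1r.
Qed.

(** The Gram determinant of the conjugates is the product of [W u] and its conjugate up to sign. So
    the type of a vector is visible to the form alone, and isometries over the fixed field preserve
    it. *)
Lemma III_gram u : III u =
  (det3 (hf u u, hf u (frv u), hf u (frv (frv u)))
        (hf (frv u) u, hf (frv u) (frv u), hf (frv u) (frv (frv u)))
        (hf (frv (frv u)) u, hf (frv (frv u)) (frv u),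
          hf (frv (frv u)) (frv (frv u))) != 0).
Proof.
rewrite /hf -det3_mul -/(W u) sharp_frv (sharp_frv (frv u)) sharp_frv.
by rewrite -/(W (sharp u)) W_sharp mulrN oppr_eq0 mulf_eq0 fmorph_eq0 orbb.
Qed.

Lemma IvZl k u v : k != 0 -> Iv (vsc k u) v = Iv u v.
Proof.
move=> k0; rewrite /Iv IIIZ // starZ !hfZl !mulf_eq0 !fmorph_eq0 (negPf k0) //=.
Qed.

Lemma Iv_sym u v : Iv u v = Iv v u.
Proof. by rewrite /Iv andbC (hf_sym u v) (hf_sym (star u)). Qed.

Lemma Iv_par u v w : u != vec0 K -> v != vec0 K -> par u v -> Iv u w = Iv v w.
Proof. by move=> u0 v0 /(par_exn u0 v0)[k k0 ->]; rewrite IvZl. Qed.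

(* The type I and II points: a fixed vector of the semilinear map is, up to a
   scalar, a vector with coordinates in the fixed field. *)
Lemma fixed_vec u : u != vec0 K -> par u (frv u) ->
  exists d, [/\ d != vec0 K, frv d = d & par u d].
Proof.
move=> u0 p; have [k k0 e] : exists2 k, k != 0 & frv u = vsc k u.
  by apply: par_exn; rewrite ?frv_eq0 // par_sym.
have key l : l != 0 -> fr l = k * l ->
    exists d, [/\ d != vec0 K, frv d = d & par u d].
  move=> l0 el; exists (vsc l^-1 u); split; first by rewrite vsc_eq0 invr_eq0 (negPf l0).
    by rewrite frvZ e vscA fmorphV el invfM mulrAC mulVf // mul1r.
  by rewrite par_sym par_vsc.
case: u u0 e {p} key => [[a b] c]; rewrite /frv /vsc /vec0 !xpair_eqE !negb_and /=.
by case/orP=> [/orP[nz|nz]|nz] [ea eb ec] key; [apply: (key a)|apply: (key b)|apply: (key c)].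
Qed.

(** The conjugates of [u] are collinear. If [u] is not a fixed point, the line through [u] and its
    image is fixed; if it is, any line to another fixed point will do. *)
Lemma nonIII_fixed_orth u : ~~ III u ->
  exists d, [/\ d != vec0 K, frv d = d & dot d u = 0].
Proof.
rewrite /III negbK => /eqP w0.
have [->|u0] := eqVneq u (vec0 K).
  exists (1, 0, 0); split; first by rewrite xpair_eqE /= xpair_eqE oner_eq0.
    by rewrite /frv /= rmorph0 rmorph1.
  by rewrite dot0.
have [p|np] := boolP (par u (frv u)); last first.
  have e0 : cross u (frv u) != vec0 K by [].
  have [] := @fixed_vec (cross u (frv u)) e0.
    by rewrite frv_cross; apply: par_orth; rewrite dotC ?dot_crossl.
  move=> d [d0 fd pd]; exists d; split=> //.
  by apply/eqP; rewrite dotC -(par_dot u _ _ pd) ?dot_crossl.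
have [d [d0 fd pd]] := fixed_vec u0 p.
have nz : exists e : vec, [/\ frv e = e & cross d e != vec0 K].
  have h (e : vec) : frv e = e -> cross d e != vec0 K ->
     exists e, [/\ frv e = e & cross d e != vec0 K] by exists e.
  case: (d) d0 => [[a b] c]; rewrite /vec0 !xpair_eqE !negb_and => /orP[/orP[nz|nz]|nz].
  - exists (0, 1, 0); split; first by rewrite /frv /= rmorph0 rmorph1.
    by rewrite /cross /vec0 /= !xpair_eqE !mulr0 !mulr1 !subr0 (negPf nz) !andbF.
  - exists (0, 0, 1); split; first by rewrite /frv /= rmorph0 rmorph1.
    by rewrite /cross /vec0 /= !xpair_eqE !mulr0 !mulr1 !subr0 (negPf nz).
  - exists (1, 0, 0); split; first by rewrite /frv /= rmorph0 rmorph1.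
    by rewrite /cross /vec0 /= !xpair_eqE !mulr0 !mulr1 !subr0 (negPf nz) !andbF.
have [e [fe ne]] := nz; exists (cross d e); split=> //; first by rewrite frv_cross fd fe.
by apply/eqP; rewrite (par_dot _ u0 d0 pd) dotC dot_crossl.
Qed.

Lemma fixed_orth_nonIII d u : d != vec0 K -> frv d = d -> dot d u = 0 -> ~~ III u.
Proof.
move=> d0 fd e; rewrite /III negbK; apply/eqP; apply: (det3_orth0 d0) => //.
  by rewrite -fd -fr_dot e rmorph0.
by rewrite -fd -fr_dot -fd -fr_dot e !rmorph0.
Qed.

Lemma fixed_nonIII d : frv d = d -> ~~ III d.
Proof.
by move=> fd; rewrite /III negbK /W !fd /det3 dot_crossl.
Qed.

Lemma III_fixed_dot u d : III u -> d != vec0 K -> frv d = d -> dot d u != 0.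
Proof. by move=> h d0 fd; apply: contraL h => /eqP; apply: fixed_orth_nonIII. Qed.

Lemma III_npar_frv u : III u -> ~~ par u (frv u).
Proof.
move=> h; apply/negP => p; have [d [d0 fd pd]] := fixed_vec (III_neq0 h) p.
by move: (III_par (III_neq0 h) d0 pd); rewrite h (negPf (fixed_nonIII fd)).
Qed.

(** Desargues for the two triangles of conjugates: the meets of corresponding sides are collinear
    exactly when the joins of corresponding vertices are concurrent. Hence for type III points the
    ordinary join and the join of the stars are of type III together. *)
Lemma W_cross_star x y : W (cross (star x) (star y)) = W x * W y * W (cross x y).
Proof.
rewrite {1}/W (frv_cross (star x)) (frv_cross (frv (star x))) !frv2_star !frv_star.
by rewrite desargues /W !frv_cross.
Qed.

Let orthpar x y u v : u != vec0 K -> hf x u = 0 -> hf x v = 0 -> hf y u = 0 ->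
  hf y v = 0 -> ~~ par x y -> par u v.
Proof.
move=> u0 e1 e2 e3 e4 nxy; rewrite -sharp_par.
have p1 : par (sharp u) (cross x y) by rewrite par_sym par_orth // dotC.
by apply: par_trans nxy p1 _; apply: par_orth; rewrite dotC.
Qed.

(** The line of [v] is the ordinary join of [x] and [y], while the line of [star u] is the join of
    their stars; [W_cross_star] forbids that these have different types. *)
Lemma lines_meet_21 x y u v : III x -> III y -> III u -> ~~ III v -> v != vec0 K ->
  ~~ par x y -> Iv x u -> Iv y u -> Iv x v -> Iv y v -> False.
Proof.
move=> Ix Iy Iu Iv' v0 nxy; rewrite /Iv Ix Iy Iu (negPf Iv') /=.
move=> /eqP e1 /eqP e2 /eqP e3 /eqP e4.
have pv : par (cross x y) (sharp v) by apply: par_orth; rewrite dotC.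
have IC : ~~ III (cross x y) by rewrite (III_par _ _ pv) ?sharp_eq0 // III_sharp.
have nst : ~~ par (star x) (star y).
  apply: contra nxy => p; have := star_par p (III_neq0 _) (III_neq0 _).
  rewrite !III_star !star_star => /(_ Ix Iy).
  by rewrite parZl // parZr.
have pu : par (cross (star x) (star y)) (sharp (star u)).
  by apply: par_orth; rewrite dotC.
have IS : III (cross (star x) (star y)).
  have su : sharp (star u) != vec0 K by rewrite sharp_eq0 III_neq0 // III_star.
  by rewrite (III_par _ su pu) // III_sharp III_star.
move: IS IC; rewrite /III W_cross_star negbK => /negP IS /eqP e; apply: IS.
by rewrite e mulr0.
Qed.

Lemma hf_orth_par x y u v : u != vec0 K -> v != vec0 K -> ~~ par x y ->
  hf x u = 0 -> hf x v = 0 -> hf y u = 0 -> hf y v = 0 -> par u v.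
Proof. by move=> *; apply: (@orthpar x y). Qed.

(** Primes stand for Frobenius images. It is applied with [a], [b], [c] the unscaled coordinates of
    a point in the triangle of another point [x], and [w1], [w2], [w3] the values of a covector on
    that triangle. The determinants are then multiples of [W] for the point and for the covector. *)
Let scalar_identity (a b c a' b' c' a'' b'' c'' w1 w2 w3 w1' w2' w3' w1'' w2'' w3'' : K) :
  a * w1 + b * w2 + c * w3 = 0 -> a' * w1' + b' * w2' + c' * w3' = 0 ->
  a'' * w1'' + b'' * w2'' + c'' * w3'' = 0 ->
  w1' * w1'' = w2' * w3'' -> w1'' * w1 = w2'' * w3 -> w1 * w1' = w2 * w3' ->
  b * b' * b'' = c * c' * c'' ->
  w1 * w1' * w1'' * det3 (a, b, c) (c', a', b') (b'', c'', a'') =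
  - (b * b' * b'') * det3 (w1, w2, w3) (w3', w1', w2') (w2'', w3'', w1'').
Proof.
move=> e1 e2 e3 f1 f2 f3 n.
have {}e1 : a * w1 = - (b * w2 + c * w3) by apply/eqP; rewrite -addr_eq0 addrA e1.
have {}e2 : a' * w1' = - (b' * w2' + c' * w3').
  by apply/eqP; rewrite -addr_eq0 addrA e2.
have {}e3 : a'' * w1'' = - (b'' * w2'' + c'' * w3'').
  by apply/eqP; rewrite -addr_eq0 addrA e3.
transitivity ((a * w1) * (a' * w1') * (a'' * w1'')
   + w1 * w1' * w1'' * (b * b' * b'' + c * c' * c'')
   - (a * w1) * b' * c'' * (w1' * w1'') - (a' * w1') * b'' * c * (w1'' * w1)
   - (a'' * w1'') * b * c' * (w1 * w1')).
  by rewrite /det3 /dot /cross /=; ring.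
transitivity (- (b * b' * b'') * (w2 * w2' * w2'') - (c * c' * c'') * (w3 * w3' * w3'')
   + w1 * w1' * w1'' * (b * b' * b'' + c * c' * c'')).
  by rewrite e1 e2 e3 f1 f2 f3; ring.
rewrite -n.
transitivity (- (b * b' * b'') * (w1 * (w1' * w1'' - w2' * w3'')
   + (w2 * w2' * w2'' - w1'' * (w2 * w3')) + (w3 * w3' * w3'' - w1' * (w2'' * w3)))).
  by rewrite -f1 -f2 -f3; ring.
by rewrite /det3 /dot /cross /=; ring.
Qed.

(** Expand [y] in the triangle of [x]. Ordinary incidence of [y] with the line of [u] gives the
    linear relations e1 to e3, Figueroa incidence of [x] with it the products f1 to f3, and [n] says
    that the join of [x] and [y] is not of type III. Since [W y] is zero, [scalar_identity] makes
    the coordinates b and c vanish, so [y] would be a multiple of [x]. *)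
Lemma lines_meet_11 x y u v : III x -> III u -> ~~ III y -> ~~ III v ->
  y != vec0 K -> v != vec0 K ->
  Iv x u -> Iv y u -> Iv x v -> Iv y v -> False.
Proof.
move=> Ix Iu Iy Iv' y0 v0; rewrite /Iv Ix Iu (negPf Iy) (negPf Iv') /=.
move=> /eqP hxu /eqP hyu /eqP hxv /eqP hyv.
have x0 := III_neq0 Ix.
have nxy : ~~ par x y by apply: contra Iy => p; rewrite -(III_par x0 y0 p).
set w := sharp u; have Iw : III w by rewrite III_sharp.
have [x1 E1] : {x1 | frv x = x1} by exists (frv x).
have [x2 E2] : {x2 | frv x1 = x2} by exists (frv x1).
have E3 : frv x2 = x by rewrite -E2 -E1 frv3.
have [y1 F1] : {y1 | frv y = y1} by exists (frv y).
have [y2 F2] : {y2 | frv y1 = y2} by exists (frv y1).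
have [v1 G1] : {v1 | frv w = v1} by exists (frv w).
have [v2 G2] : {v2 | frv v1 = v2} by exists (frv v1).
have Wx : W x = det3 x x1 x2 by rewrite /W E1 E2.
pose a := det3 y x1 x2; pose b := det3 x y x2; pose c := det3 x x1 y.
pose w1 := dot w x; pose w2 := dot w x1; pose w3 := dot w x2.
have e1 : a * w1 + b * w2 + c * w3 = 0.
  have := congr1 (dot w) (det3_basis x x1 x2 y).
  by rewrite !dotDr !dotZr dotC -/(hf y u) hyu mulr0 -/a -/b -/c => <-.
have push (p1 p2 p3 q1 q2 q3 : K) : p1 * q1 + p2 * q2 + p3 * q3 = 0 ->
    fr p1 * fr q1 + fr p2 * fr q2 + fr p3 * fr q3 = 0.
  by move=> e; rewrite -!rmorphM -!rmorphD e rmorph0.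
have e2 := push _ _ _ _ _ _ e1; have e3 := push _ _ _ _ _ _ e2.
have a1E : fr a = det3 y1 x2 x by rewrite /a fr_det3 F1 E2 E3.
have a2E : fr (fr a) = det3 y2 x x1 by rewrite a1E fr_det3 F2 E3 E1.
have b1E : fr b = det3 x1 y1 x by rewrite /b fr_det3 F1 E1 E3.
have b2E : fr (fr b) = det3 x2 y2 x1 by rewrite b1E fr_det3 F2 E2 E1.
have c1E : fr c = det3 x1 x2 y1 by rewrite /c fr_det3 F1 E1 E2.
have c2E : fr (fr c) = det3 x2 x y2 by rewrite c1E fr_det3 F2 E3 E2.
have p1E : fr w1 = dot v1 x1 by rewrite /w1 fr_dot G1 E1.
have p2E : fr (fr w1) = dot v2 x2 by rewrite p1E fr_dot G2 E2.
have q1E : fr w2 = dot v1 x2 by rewrite /w2 fr_dot G1 E2.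
have q2E : fr (fr w2) = dot v2 x by rewrite q1E fr_dot G2 E3.
have r1E : fr w3 = dot v1 x by rewrite /w3 fr_dot G1 E3.
have r2E : fr (fr w3) = dot v2 x1 by rewrite r1E fr_dot G2 E1.
have f1 : fr w1 * fr (fr w1) = fr w2 * fr (fr w3).
  move: hxu; rewrite /hf -[sharp (star u)]vsc1 -[1]opprK -mulN1r -vscA -star_sharp.
  rewrite dotZr mulN1r => /eqP; rewrite oppr_eq0 dot_cross2 subr_eq0 => /eqP.
  by rewrite p2E p1E q1E r2E -/w E1 E2 G1 G2 ![dot _ v1]dotC ![dot _ v2]dotC mulrC => ->; rewrite mulrC.
have f2 := congr1 fr f1; rewrite !rmorphM !fr3 in f2.
have f3 := congr1 fr f2; rewrite !rmorphM !fr3 in f3.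
have n : b * fr b * fr (fr b) = c * fr c * fr (fr c).
  have pv : par (cross x y) (sharp v) by apply: par_orth; rewrite dotC.
  have : ~~ III (cross x y) by rewrite (III_par _ _ pv) ?sharp_eq0 // III_sharp.
  rewrite /III negbK => /eqP z; apply/eqP; rewrite -subr_eq0; apply/eqP.
  transitivity (W (cross x y) * W x); last by rewrite z mul0r.
  rewrite Wx /W frv_cross E1 F1 frv_cross E2 F2 det3_mul b2E b1E c2E c1E /b /c.
  have q1 (p q r : vec) : dot (cross p q) r = det3 p q r by vr.
  have q2 (p q : vec) : det3 p q p = 0 by vr.
  have q3 (p q : vec) : det3 p q q = 0 by vr.
  rewrite !q1 !q2 (det3N x1 y1) (det3C y1 x1) (det3C x y x1) (det3N y x1 x).
  rewrite (det3C x1 y x) (det3C y x x1) (det3N x2 y2 x) (det3C y2 x2 x).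
  rewrite (det3N x1 x2 y1) (det3C x2 x1 y1) (det3C x1 y1 x2) (det3N y1 x2 x1).
  by rewrite /det3 /dot /cross /=; ring.
have dy : det3 (a, b, c) (fr c, fr a, fr b) (fr (fr b), fr (fr c), fr (fr a)) = 0.
  have z : W y = 0 by apply/eqP; rewrite /III negbK in Iy.
  have := det3_mul y y1 y2 (cross x1 x2) (cross x2 x) (cross x x1).
  have -> : det3 y y1 y2 = 0 by rewrite -z /W F1 F2.
  rewrite mul0r => ->.
  have gd p q r : dot p (cross q r) = det3 p q r by [].
  rewrite !gd a2E a1E b2E b1E c2E c1E /a /b /c.
  by congr (det3 (_, _, _) (_, _, _) (_, _, _)); rewrite // det3C // det3C.
have := scalar_identity e1 e2 e3 f1 f2 f3 n.
rewrite dy mulr0 => /esym/eqP.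
have dw : det3 (w1, w2, w3) (fr w3, fr w1, fr w2) (fr (fr w2), fr (fr w3), fr (fr w1)) != 0.
  rewrite p2E p1E q2E q1E r2E r1E -det3_mul -Wx.
  have -> : det3 w v1 v2 = W w by rewrite /W G1 G2.
  by rewrite mulf_neq0.
rewrite mulf_eq0 (negPf dw) orbF oppr_eq0 !mulf_eq0 !fmorph_eq0 !orbb => /eqP b0.
have c0 : c = 0.
  move/eqP: n; rewrite b0 !mul0r eq_sym !mulf_eq0 !fmorph_eq0 !orbb.
  by move/eqP.
have := det3_basis x x1 x2 y; rewrite -/a -/b -/c b0 c0 !vsc0 !vadd0 => e.
move/negP: nxy; apply; rewrite par_sym.
rewrite -(@parZl _ (det3 x x1 x2)); last by rewrite -Wx.
by rewrite e par_vsc.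
Qed.

End FigVec.

End FigueroaVectors.
Import FigueroaVectors.

(** * Polarity planes *)

Section PolarityPlane.

Variables (T : finType) (I : rel T) (n : nat).
Hypothesis I_sym : symmetric I.
Hypothesis n_gt1 : (1 < n)%N.
Hypothesis cardT : #|T| = (n ^ 2 + n + 1)%N.
Hypothesis card_pol : forall y, #|[set x | I x y]| = n.+1.
Hypothesis I_uniq : forall x y a b, x != y ->
  I x a -> I y a -> I x b -> I y b -> a = b.

Definition pol y : {set T} := [set x | I x y].
Definition polar_lines : {set {set T}} := [set pol y | y : T].
Definition abs_points : {set T} := [set x | I x x].

Lemma in_pol x y : (x \in pol y) = I x y. Proof. by rewrite inE. Qed.

Lemma pol_line y : pol y \in polar_lines. Proof. by apply/imsetP; exists y. Qed.

Lemma pol_inj : injective pol.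
Proof.
move=> a b e; have : (1 < #|pol a|)%N by rewrite card_pol ltnW.
case/card_gt1P=> x [y [xa ya nxy]].
have := xa; rewrite e => xb; have := ya; rewrite e => yb.
by apply: (I_uniq nxy); rewrite -in_pol.
Qed.

Lemma joins_le1 x y : x != y -> (#|[set a | I x a && I y a]| <= 1)%N.
Proof.
move=> nxy; apply/card_le1P => a; rewrite inE => /andP[xa ya] b.
rewrite [in RHS]inE; apply/idP/eqP => [|->]; last by rewrite inE xa.
by rewrite inE => /andP[xb yb]; apply: (I_uniq nxy).
Qed.

Lemma sum_joins x : (\sum_(y | y != x) #|[set a | I x a && I y a]| = n ^ 2 + n)%N.
Proof.
transitivity (\sum_(y | y != x) \sum_(a | I x a && I y a) 1)%N.
  by apply: eq_bigr => y _; rewrite sum1dep_card.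
rewrite (exchange_big_dep (fun a => I x a)) /=; last by move=> y a _ /andP[].
rewrite (eq_bigr (fun _ => n)); last first.
  move=> a xa; have := cardsD1 x (pol a).
  rewrite card_pol in_pol xa => -[->]; rewrite -sum1_card.
  by rewrite add0n; apply: eq_bigl => y; rewrite !inE.
rewrite sum_nat_const (eq_card (B := pol x)); last by move=> a; rewrite !inE I_sym.
by rewrite card_pol mulSn addnC mulnn.
Qed.

(** The n + 1 lines through [x] carry n(n + 1) further incidences, and there are n(n + 1) other
    points. As none is counted twice, none is missed. *)
Lemma joins_eq1 x y : x != y -> #|[set a | I x a && I y a]| = 1%N.
Proof.
move=> nxy; apply/eqP; rewrite eqn_leq joins_le1 // lt0n; apply/eqP => e0.
have := sum_joins x; rewrite (bigD1 y) /=; last by rewrite eq_sym.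
rewrite e0 add0n => e.
have : (\sum_(z | (z != x) && (z != y)) #|[set a | I x a && I z a]|
        <= \sum_(z | (z != x) && (z != y)) 1)%N.
  by apply: leq_sum => z /andP[nz _]; apply: joins_le1; rewrite eq_sym.
rewrite e sum1dep_card.
have -> : [set z | (z != x) && (z != y)] = ~: [set x; y].
  by apply/setP => z; rewrite !inE negb_or.
have := cardsC [set x; y]; rewrite cards2 nxy cardT => /esym e2.
rewrite -(leq_add2l 2) -e2; apply/negP; rewrite -ltnNge.
by rewrite addnC ltn_add2l.
Qed.

(** The pole of the joining line. By [joins_eq1] the default is never reached for distinct
    points. *)
Definition jn x y : T := odflt x [pick a | I x a && I y a].

Lemma jnP x y : x != y -> I x (jn x y) && I y (jn x y).
Proof.
move=> nxy; rewrite /jn; case: pickP => [a //|none].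
by have := joins_eq1 nxy; rewrite (eq_card0 (A := _)) // => a; rewrite inE none.
Qed.

Lemma jn_eq x y a : x != y -> I x a -> I y a -> jn x y = a.
Proof. by move=> nxy; have /andP[h1 h2] := jnP nxy; apply: (I_uniq nxy). Qed.

(** Otherwise [x] and [y] would both lie on the polar of [x] and on the polar of [y], two different
    lines. *)
Lemma abs_pol1 x y : I x x -> I y y -> I y x -> y = x.
Proof.
move=> xx yy yx; apply/eqP; apply: contraT => nyx.
by move/eqP: (nyx) => []; apply: (I_uniq nyx); rewrite // I_sym.
Qed.

Lemma card_abs_pol_abs x : I x x -> #|pol x :&: abs_points| = 1%N.
Proof.
move=> xx; apply/eqP/cards1P; exists x; apply/setP => y; rewrite !inE.
apply/andP/eqP => [[yx yy]|->//]; exact: abs_pol1.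
Qed.

(** * The unital of absolute points *)

Section Unital.

Variable m : nat.
Hypothesis m_gt1 : (1 < m)%N.
Hypothesis n_def : n = (m ^ 2)%N.
Hypothesis card_abs : #|abs_points| = (m ^ 3 + 1)%N.

Lemma sum_abs_pol : (\sum_y #|pol y :&: abs_points| = (m ^ 3 + 1) * (m ^ 2 + 1))%N.
Proof.
transitivity (\sum_y \sum_(x | I x y && (x \in abs_points)) 1)%N.
  by apply: eq_bigr => y _; rewrite sum1dep_card; apply: eq_card => x; rewrite !inE.
rewrite (exchange_big_dep (fun x => x \in abs_points)) /=; last by move=> ? ? _ /andP[].
rewrite (eq_bigr (fun _ => n.+1)) ?sum_nat_const ?card_abs ?n_def ?addn1 //.
move=> x xa; rewrite -n_def -(card_pol x) -sum1_card.
by apply: eq_bigl => y; rewrite xa andbT inE I_sym.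
Qed.

Lemma sum_sqr_abs_pol :
  (\sum_y #|pol y :&: abs_points| ^ 2 = (m ^ 3 + 1) * (m ^ 3 + m ^ 2 + 1))%N.
Proof.
transitivity (\sum_y \sum_(x in abs_points | I x y)
                \sum_(z in abs_points | I z y) 1)%N.
  apply: eq_bigr => y _; rewrite [RHS]sum_nat_const -mulnn.
  congr (_ * _)%N; last rewrite sum1dep_card.
    by apply: eq_card => x; rewrite [in RHS]unfold_in !inE andbC.
  by apply: eq_card => x; rewrite !inE andbC.
rewrite (exchange_big_dep (fun x => x \in abs_points)) /=; last by move=> ? ? _ /andP[].
transitivity (\sum_(x in abs_points) (m ^ 3 + m ^ 2 + 1))%N; last first.
  by rewrite sum_nat_const card_abs.
apply: eq_bigr => x xa.
rewrite (exchange_big_dep (fun x => x \in abs_points)) /=; last by move=> ? ? _ /andP[].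
rewrite (bigD1 x) //=.
have -> : (\sum_(y | [&& (x \in abs_points) && I x y, x \in abs_points & I x y]) 1
            = m ^ 2 + 1)%N.
  rewrite addn1 -n_def -(card_pol x) -sum1_card.
  by apply: eq_bigl => y; rewrite xa inE I_sym andbb.
rewrite (eq_bigr (fun _ => 1%N)); last first.
  move=> z /andP[za nzx]; rewrite sum1dep_card -(joins_eq1 (x := x) (y := z)) 1?eq_sym //.
  by apply: eq_card => y; rewrite !inE -!(in_set (fun x => I x x)) xa za.
rewrite sum1dep_card.
have := cardsD1 x abs_points; rewrite card_abs xa addn1 => -[e].
rewrite (_ : [set _ | _] = abs_points :\ x); last first.
  by apply/setP => z; rewrite !inE andbC.
by rewrite e add0n addnC addnA.
Qed.

(** Counting incident pairs and triples gives the first two moments of the number of absolute points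
    on a non-tangent line. They match a constant: the squared deviation from m + 1 sums to zero. *)
Lemma card_abs_pol_nabs y : ~~ I y y -> #|pol y :&: abs_points| = m.+1.
Proof.
pose a y : int := #|pol y :&: abs_points|%:Z.
have s1 : \sum_(y | ~~ I y y) a y = ((m ^ 3 + 1) * m ^ 2)%N%:Z.
  have := sum_abs_pol; rewrite (bigID (fun y => I y y)) /=.
  rewrite (eq_bigr (fun _ => 1%N)); last by move=> x xx; rewrite card_abs_pol_abs.
  rewrite sum1dep_card -/abs_points card_abs mulnDr muln1 addnC => /addIn <-.
  by rewrite -natz natr_sum; apply: eq_bigr => x _; rewrite natz.
have s2 : \sum_(y | ~~ I y y) a y ^+ 2 = ((m ^ 3 + 1) * (m ^ 3 + m ^ 2))%N%:Z.
  have := sum_sqr_abs_pol; rewrite (bigID (fun y => I y y)) /=.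
  rewrite (eq_bigr (fun _ => 1%N)); last by move=> x xx; rewrite card_abs_pol_abs.
  rewrite sum1dep_card -/abs_points card_abs mulnDr muln1 addnC => /addIn <-.
  by rewrite -natz natr_sum; apply: eq_bigr => x _; rewrite natrX natz.
have s0 : \sum_(y | ~~ I y y) (1 : int) = (m ^ 4 + m ^ 2)%:Z - (m ^ 3)%:Z.
  rewrite sumr_const -[#|_|]/(#|[pred y | ~~ I y y]|).
  have := cardsC abs_points; rewrite cardT card_abs n_def -expnM => e.
  rewrite (eq_card (B := ~: abs_points)); last by move=> z; rewrite !inE.
  apply/eqP; rewrite eq_sym subr_eq natz -PoszD eqz_nat -(eqn_add2r 1) -e.
  by rewrite addnC addnA.
(* With t = m^2 - m + 1 one has m^3 + 1 = (m + 1) t, and there are m^2 t non-absolute points. The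
   three terms are 1, -2 and 1 times (m + 1)^2 m^2 t. *)
have vz : \sum_(y | ~~ I y y) (a y - (m.+1)%:Z) ^+ 2 = 0.
  transitivity (\sum_(y | ~~ I y y) a y ^+ 2 - (m.+1)%:Z *+ 2 * \sum_(y | ~~ I y y) a y
     + (m.+1)%:Z ^+ 2 * \sum_(y | ~~ I y y) (1 : int)).
    rewrite !mulr_sumr -sumrB -big_split; apply: eq_bigr => z _ /=; ring.
  rewrite s0 s1 s2 -!natz !natrM !natrD !natrX; ring.
move=> ny; have /eqP : (a y - (m.+1)%:Z) ^+ 2 = 0.
  apply: (Num.Theory.psumr_eq0P _ vz) => // z _; exact: Num.Theory.sqr_ge0.
by rewrite expf_eq0 /= subr_eq0 => /eqP[].
Qed.

Lemma polar_unital : is_unital m abs_points (induced_blocks polar_lines abs_points).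
Proof.
split=> [|b|x y xa ya nxy]; first by rewrite card_abs.
  case/imsetP=> l; rewrite inE => /andP[/imsetP[y _ ->] c] ->.
  split; first exact: subsetIr.
  rewrite addn1; apply: card_abs_pol_nabs; apply/negP => yy.
  by move: c; rewrite card_abs_pol_abs.
rewrite -(joins_eq1 nxy); apply/eqP; rewrite eqn_leq joins_eq1 //.
have /andP[xj yj] := jnP nxy; apply/andP; split.
  apply/card_le1P => b; rewrite !inE => /andP[/imsetP[l]].
  rewrite inE => /andP[/imsetP[a _ ->] _] -> /andP[]; rewrite !inE.
  move=> /andP[xa' _] /andP[ya' _] b'.
  rewrite inE; apply/idP/eqP => [/andP[/imsetP[l']]|->].
    rewrite inE => /andP[/imsetP[a' _ ->] _] -> /andP[]; rewrite !inE.
    move=> /andP[xa2 _] /andP[ya2 _].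
    by rewrite (I_uniq nxy xa' ya' xa2 ya2).
  rewrite inE in xa; rewrite inE in ya.
  rewrite !inE xa' ya' xa ya !andbT; apply/imsetP; exists (pol a) => //.
  rewrite inE imset_f //=; apply/card_gt1P; exists x, y.
  by rewrite !inE xa' ya' xa ya.
rewrite card_gt0; apply/set0Pn; exists (pol (jn x y) :&: abs_points).
rewrite inE in xa; rewrite inE in ya; rewrite !inE xj yj xa ya !andbT.
apply/imsetP; exists (pol (jn x y)) => //; rewrite inE imset_f //=.
by apply/card_gt1P; exists x, y; rewrite !inE xj yj xa ya.
Qed.

End Unital.

Definition I_aut (s : {perm T}) : Prop := forall x y, I (s x) (s y) = I x y.
(** The axis is the polar of [c]. The poles of the lines through [c] lie on it, so these lines are
    fixed as well. *)
Definition pol_elation (s : {perm T}) c : Prop :=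
  I_aut s /\ forall x, I x c -> s x = x.

Lemma aut_pol s y : I_aut s -> s @: pol y = pol (s y).
Proof.
move=> sI; apply/setP => x; rewrite -[x](permKV s) mem_imset; last exact: perm_inj.
by rewrite !in_pol sI.
Qed.

Lemma aut_abs s : I_aut s -> s @: abs_points = abs_points.
Proof.
move=> sI; apply/setP => x; rewrite -[x](permKV s) mem_imset; last exact: perm_inj.
by rewrite !inE sI.
Qed.

Lemma aut_automorphism s : I_aut s -> is_automorphism [set: T] polar_lines s.
Proof.
move=> sI; apply/andP; split; first by apply/subsetP => x; rewrite inE.
by apply/forall_inP => b /imsetP[y _ ->]; rewrite aut_pol // imset_f.
Qed.

Lemma off_two_lines a b : exists x, ~~ I x a && ~~ I x b.
Proof.
have : (#|pol a :|: pol b| < #|T|)%N.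
  apply: leq_ltn_trans (leq_card_setU _ _) _; rewrite !card_pol cardT.
  have := leq_mul n_gt1 (leqnn n); rewrite -mulnn; move: n_gt1; clear; lia.
rewrite -(cardsC (pol a :|: pol b)) -[X in (X < _)%N]addn0 ltn_add2l.
by case/card_gt0P=> x; rewrite !inE negb_or; exists x.
Qed.

(** A point [x] off the line from a fixed point [w] to [c] is the meet of two fixed lines: its join
    with [c], and its join with [w], which is also the join of [w] with a point of the axis. *)
Lemma elation_fix_eq1 s c z : I c c -> pol_elation s c -> ~~ I z c -> s z = z ->
  s = 1%g.
Proof.
move=> cc [sI fc] nz sz.
have key w x : ~~ I w c -> s w = w -> w != c -> ~~ I x (jn w c) -> s x = x.
  move=> nw sw nwc nx; have [xc|nxc] := boolP (I x c); first exact: fc.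
  have nxw : x != w by apply: contra nx => /eqP ->; case/andP: (jnP nwc).
  have nxc' : x != c by apply: contraNneq nxc => ->.
  have /andP[xa wa] := jnP nxw; have /andP[xk ck] := jnP nxc'.
  set a := jn x w in xa wa; set k := jn x c in xk ck.
  have nac : a != c by apply: contraNneq nw => <-.
  have /andP[ab cb] := jnP nac; set b := jn a c in ab cb.
  have sb : s b = b by apply: fc; rewrite I_sym.
  have nwb : w != b by apply: contraNneq nw => ->; rewrite I_sym.
  have sa : s a = a.
    apply: (I_uniq nwb) => //; last by rewrite I_sym.
      by rewrite -{1}sw sI.
    by rewrite -{1}sb sI I_sym.
  have sk : s k = k by apply: fc; rewrite I_sym.
  have nak : a != k.
    apply: contraNneq nx => e; rewrite (jn_eq nwc wa) // e //.
  apply: (I_uniq nak); rewrite I_sym //; first by rewrite -[X in I _ X]sa sI.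
  by rewrite -[X in I _ X]sk sI.
have nzc : z != c by apply: contraNneq nz => ->.
(* A second fixed point, off the line from [z] to [c], takes care of the points on that line. *)
have [z' /andP[nz' nz2]] := off_two_lines c (jn z c).
have sz' : s z' = z' by apply: (key z).
have nzc' : z' != c by apply: contraNneq nz' => ->.
apply/permP => x; rewrite perm1.
have [xz|] := boolP (I x (jn z c)); last exact: key.
have [xc|nxc] := boolP (I x c); first exact: fc.
apply: (key z') => //; apply/negP => xz'; have nxc' : x != c by apply: contraNneq nxc => ->.
have /andP[_ c1] := jnP nzc; have /andP[z1 c2] := jnP nzc'.
by move: nz2; rewrite (I_uniq nxc' xz c1 xz' c2) z1.
Qed.

(** * Elations that preserve the unital *)

Section UnitalElations.

Variable m : nat.
Hypothesis m_gt1 : (1 < m)%N.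
Hypothesis n_def : n = (m ^ 2)%N.
Hypothesis card_abs : #|abs_points| = (m ^ 3 + 1)%N.

(* The polar of an absolute point is the tangent there, and the polar of any
   other point is determined by the tangents through it; so the collineations
   preserving the unital commute with the polarity. *)
Lemma automorphism_I_aut s : is_automorphism [set: T] polar_lines s ->
  s @: abs_points = abs_points -> I_aut s.
Proof.
case/andP=> _ /forall_inP sl sa.
have sE x : (s x \in abs_points) = (x \in abs_points).
  by rewrite -{1}sa mem_imset //; apply: perm_inj.
have im y : exists y', s @: pol y = pol y'.
  by have /imsetP[y' _ e] := sl _ (pol_line y); exists y'.
have sim x y y' : s @: pol y = pol y' -> I (s x) y' = I x y.
  by move=> e; rewrite -in_pol -e mem_imset ?in_pol //; apply: perm_inj.
have tan y y' : I y y -> s @: pol y = pol y' -> y' = s y.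
  move=> yy e; have c1 : #|pol y' :&: abs_points| = 1%N.
    rewrite -e -{1}sa -imsetI; last by move=> ? ? _ _; apply: perm_inj.
    by rewrite card_imset ?card_abs_pol_abs //; apply: perm_inj.
  have y'y' : I y' y'.
    by apply: contraT => /(card_abs_pol_nabs n_def card_abs); rewrite c1 => -[m0]; move: m_gt1; rewrite -m0.
  apply/esym; apply: abs_pol1 => //; last by rewrite (sim _ _ _ e).
  by have := sE y; rewrite !inE yy.
move=> x y; have [y' e] := im y; rewrite -(sim _ _ _ e); congr (I _ _).
have [yy|nyy] := boolP (I y y); first by rewrite (tan _ _ yy e).
have : (1 < #|pol y :&: abs_points|)%N by rewrite (card_abs_pol_nabs n_def card_abs) // ltnW.
case/card_gt1P=> x1 [x2 []]; rewrite !inE => /andP[x1y a1] /andP[x2y a2] nx.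
have nsx : s x1 != s x2 by rewrite (inj_eq perm_inj).
have h z : I z z -> I z y -> I (s z) (s y).
  move=> zz zy; have [z' ez] := im z; have ez' := tan _ _ zz ez.
  by rewrite I_sym -ez' (sim _ _ _ ez) I_sym.
by apply: (I_uniq nsx); rewrite ?h // (sim _ _ _ e).
Qed.

(** Let [b] be the pole of the axis. Commuting with the polarity, [s] also fixes every line through
    [b] and every point on the polar of [c]. If [b] and [c] differ, each point off their join is the
    meet of two fixed lines and [s] is trivial; if they agree, the centre lies on its own polar. *)
Lemma unital_elation s : is_elation polar_lines s -> s @: abs_points = abs_points ->
  s = 1%g \/ exists2 c, I c c & pol_elation s c.
Proof.
case/andP=> sA /exists_inP[_ /imsetP[b _ ->]] /exists_inP[c]; rewrite in_pol => cb.
case/andP=> /forall_inP fb /forall_inP fl sa; have sI := automorphism_I_aut sA sa.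
have sb x : I x b -> s x = x by rewrite -in_pol => /fb/eqP.
have sc y : I c y -> s y = y.
  move=> cy; apply: pol_inj; rewrite -aut_pol //; apply/eqP.
  by have := fl _ (pol_line y); rewrite in_pol cy.
have [ebc|nbc] := eqVneq b c; first by subst b; right; exists c.
left; have key x : ~~ I x (jn b c) -> s x = x.
  move=> nx; have nxb : x != b by apply: contraNneq nx => ->; case/andP: (jnP nbc).
  have nxc : x != c by apply: contraNneq nx => ->; case/andP: (jnP nbc).
  have /andP[x1 b1] := jnP nxb; have /andP[x2 c2] := jnP nxc.
  have e1 : s (jn x b) = jn x b by apply: sb; rewrite I_sym.
  have e2 : s (jn x c) = jn x c by apply: sc.
  have n12 : jn x b != jn x c.
    by apply: contraNneq nx => e; rewrite (jn_eq nbc b1) // e.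
  apply: (I_uniq n12); rewrite I_sym //; first by rewrite -[X in I _ X]e1 sI.
  by rewrite -[X in I _ X]e2 sI.
apply/permP => x; rewrite perm1.
have gen y : y != jn b c -> s y = y.
  move=> ny; have : (1 < #|pol y :\: pol (jn b c)|)%N.
    have := cardsID (pol (jn b c)) (pol y); rewrite card_pol => e.
    rewrite -(ltn_add2l #|pol y :&: pol (jn b c)|) e addn1 ltnS.
    apply: leq_trans _ n_gt1; rewrite ltnS; apply: leq_trans (joins_le1 ny).
    by apply/subset_leq_card/subsetP => z; rewrite !inE ![I z _]I_sym.
  case/card_gt1P=> x1 [x2 []]; rewrite !inE => /andP[n1 y1] /andP[n2 y2] nx.
  apply: (I_uniq nx) => //; last by rewrite -{1}(key x2 n2) sI.
  by rewrite -{1}(key x1 n1) sI.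
have [ex|] := eqVneq x (jn b c); last exact: gen.
apply/eqP; apply: contraT => nsx; have e := gen (s x).
by rewrite -ex in e; move/eqP: (nsx) => []; apply: (@perm_inj _ s); apply: e.
Qed.

End UnitalElations.

End PolarityPlane.

(** * Projective coordinates *)

Module ProjectiveCoordinates.

Section Projective.

Variables (K : finFieldType) (T : finType) (v : T -> vec K) (x0 : T).
Hypothesis v_neq0 : forall x, v x != vec0 K.
Hypothesis v_surj : forall u : vec K, u != vec0 K -> exists x, par (v x) u.
Hypothesis v_inj : forall x y, par (v x) (v y) -> x = y.

Definition pt (u : vec K) : T := odflt x0 [pick x | par (v x) u].

Lemma ptP u : u != vec0 K -> par (v (pt u)) u.
Proof.
move=> u0; rewrite /pt; case: pickP => [x //|none].
by have [x px] := v_surj u0; rewrite none in px.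
Qed.

Lemma pt_eq u x : u != vec0 K -> (pt u == x) = par u (v x).
Proof.
move=> u0; have pu := ptP u0; apply/eqP/idP => [<-|p]; first by rewrite par_sym.
exact: v_inj (par_trans u0 pu p).
Qed.

Lemma pt_v x : pt (v x) = x.
Proof. by apply/eqP; rewrite pt_eq // paruu. Qed.

Lemma pt_inj u w : u != vec0 K -> w != vec0 K -> (pt u == pt w) = par u w.
Proof.
move=> u0 w0; rewrite pt_eq //; apply/idP/idP => p.
  exact: par_trans (v_neq0 _) p (ptP w0).
have q : par w (v (pt w)) by rewrite par_sym; apply: ptP.
exact: par_trans w0 p q.
Qed.

Lemma v_pt u : u != vec0 K -> exists2 k, k != 0 & v (pt u) = vsc k u.
Proof. by move=> u0; apply: par_exn => //; apply: ptP. Qed.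

Lemma v_eq_par x y : (x == y) = par (v x) (v y).
Proof. by apply/eqP/idP => [->|/v_inj //]; apply: paruu. Qed.

Lemma card_points : #|T| = (#|K| ^ 2 + #|K| + 1)%N.
Proof.
pose f (z : K * K + option K) : T := match z with
  | inl ab => pt (1, ab.1, ab.2) | inr (Some a) => pt (0, 1, a)
  | inr None => pt (0, 0, 1) end.
have n1 a b : (1, a, b) != vec0 K by rewrite !xpair_eqE oner_eq0.
have n2 a : (0, 1, a) != vec0 K by rewrite !xpair_eqE oner_eq0 andbF.
have n3 : (0, 0, 1) != vec0 K by rewrite !xpair_eqE oner_eq0 andbF.
have fi : injective f.
  move=> [[a b]|[a|]] [[c d]|[c|]] //= /eqP; rewrite pt_inj // => /eqP[] /=;
  rewrite ?mulr1 ?mul1r ?mulr0 ?mul0r ?subr0 ?sub0r ?subrr => e1 e2 e3;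
  try by [move/eqP: e3; rewrite ?oppr_eq0 oner_eq0 | move/eqP: e2; rewrite ?oppr_eq0 oner_eq0
         | move/eqP: e1; rewrite ?oppr_eq0 oner_eq0].
    by rewrite (subr0_eq e2) (subr0_eq e3).
  by rewrite (subr0_eq e1).
have fs : f @: setT = setT.
  apply/setP => x; rewrite inE; apply/imsetP.
  have := v_neq0 x; case E: (v x) => [[a b] c] nz.
  have hx u k : u != vec0 K -> v x = vsc k u -> x = pt u.
    by move=> u0 e; apply/eqP; rewrite eq_sym pt_eq // e par_sym par_vsc.
  have [a0|an] := eqVneq a 0; last first.
    exists (inl (b / a, c / a)) => //; apply: (hx _ a) => //.
    by rewrite E /vsc /= mulr1 ![a * _]mulrC !divfK.
  have [b0|bn] := eqVneq b 0; last first.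
    exists (inr (Some (c / b))) => //; apply: (hx _ b) => //.
    by rewrite E /vsc /= mulr1 a0 mulr0 ![b * _]mulrC !divfK.
  exists (inr None) => //; apply: (hx _ c) => //.
  by rewrite E /vsc /= mulr1 a0 b0 mulr0.
rewrite -cardsT -fs card_imset // cardsT card_sum card_prod card_option.
by rewrite addnS addn1 mulnn.
Qed.

Section Line.

Variables (w u1 u2 : vec K).
Hypotheses (w0 : w != vec0 K) (n12 : ~~ par u1 u2).
Hypotheses (e1 : dot w u1 = 0) (e2 : dot w u2 = 0).

Definition line_pt (t : option K) : T :=
  if t is Some t then pt (vadd u1 (vsc t u2)) else pt u2.

Lemma line_u2 : u2 != vec0 K.
Proof. by apply: contraNneq n12 => ->; rewrite /par; apply/eqP; vr. Qed.

Lemma line_u12 t : vadd u1 (vsc t u2) != vec0 K.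
Proof.
apply: contraNneq n12 => e; rewrite /par.
have -> : cross u1 u2 = cross (vadd u1 (vsc t u2)) u2 by vr.
by rewrite e; apply/eqP; vr.
Qed.

Lemma line_pt_inj : injective line_pt.
Proof.
have c1 t : cross (vadd u1 (vsc t u2)) u2 = cross u1 u2 by vr.
have c2 s t : cross (vadd u1 (vsc s u2)) (vadd u1 (vsc t u2)) = vsc (t - s) (cross u1 u2).
  by vr.
move=> [s|] [t|] //= /eqP; rewrite pt_inj ?line_u2 ?line_u12 //.
- by rewrite /par c2 vsc_eq0 -/(par u1 u2) (negPf n12) orbF subr_eq0 => /eqP ->.
- by rewrite /par c1 -/(par u1 u2) (negPf n12).
- by rewrite par_sym /par c1 -/(par u1 u2) (negPf n12).
Qed.

Lemma line_ptP x : dot w (v x) = 0 -> exists t, x = line_pt t.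
Proof.
move=> ex; have [a [b e]] := span2 n12 e1 e2 w0 ex.
have [a0|an] := eqVneq a 0.
  exists None; apply/eqP; rewrite eq_sym pt_eq ?line_u2 // e a0 vsc0.
  have -> : vadd (vec0 K) (vsc b u2) = vsc b u2 by vr.
  by rewrite par_sym par_vsc.
exists (Some (b / a)); apply/eqP; rewrite eq_sym pt_eq ?line_u12 //.
have -> : v x = vsc a (vadd u1 (vsc (b / a) u2)).
  by rewrite e; move: an; clear; rewrite /vadd /vsc /= => an; apply: vecE;
     rewrite mulrDr !mulrA [a * b]mulrC mulfK.
by rewrite par_sym par_vsc.
Qed.

Lemma line_pt_dot t : dot w (v (line_pt t)) = 0.
Proof.
case: t => [t|] /=.
  have [k _ ->] := v_pt (line_u12 t).
  by rewrite dotZr dotDr e1 dotZr e2 mulr0 addr0 mulr0.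
by have [k _ ->] := v_pt line_u2; rewrite dotZr e2 mulr0.
Qed.

Lemma line_imset : [set x | dot w (v x) == 0] = line_pt @: setT.
Proof.
apply/setP => x; rewrite inE; apply/eqP/imsetP => [/line_ptP[t ->]|[t _ ->]].
  by exists t.
exact: line_pt_dot.
Qed.

End Line.

Lemma card_line w : w != vec0 K -> #|[set x | dot w (v x) == 0]| = #|K|.+1.
Proof.
move=> w0; have [u1 [u2 []]] := orth2_ex w0; rewrite !(dotC _ w) => e1 e2 n12.
rewrite (line_imset w0 n12 e1 e2) card_imset; last exact: line_pt_inj.
by rewrite cardsT card_option.
Qed.

Section Figueroa.

Variables fr cj : {rmorphism K -> K}.
Hypothesis fr3 : forall x, fr (fr (fr x)) = x.
Hypothesis cj2 : forall x, cj (cj x) = x.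
Hypothesis cjfr : forall x, cj (fr x) = fr (cj x).

Local Notation III := (III fr).
Local Notation star := (star fr).
Local Notation sharp := (sharp cj).
Local Notation hf := (hf cj).
Local Notation frv := (frv fr).

Definition tIII x := III (v x).
Definition inD x := par (v x) (frv (v x)).
Definition I x y := Iv fr cj (v x) (v y).
Definition Dpts := [set x | inD x].

Lemma I_symm : symmetric I. Proof. by move=> x y; apply: Iv_sym. Qed.

Lemma inD_nonIII x : inD x -> ~~ tIII x.
Proof.
move=> Dx; have [d [d0 fd pd]] := fixed_vec (v_neq0 x) Dx.
by rewrite /tIII (III_par fr (v_neq0 x) d0 pd) fixed_nonIII.
Qed.

Lemma inD_pt d : d != vec0 K -> frv d = d -> inD (pt d).
Proof. by move=> d0 fd; have [k k0 e] := v_pt d0; rewrite /inD e frvZ fd parZl // parZr ?fmorph_eq0 // paruu. Qed.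

(** Cases by the four types. If all four are III, [star] reduces to the hermitian form; if no pair
    of type III points is involved, the form applies directly. Exactly three of type III is excluded
    by [lines_meet_21], and one point together with one pole by [lines_meet_11]. *)
Lemma I_unique x y a b : x != y -> I x a -> I y a -> I x b -> I y b -> a = b.
Proof.
move=> nxy xa ya xb yb; apply: contraTeq isT => nab; exfalso.
have nxy' : ~~ par (v x) (v y) by rewrite -v_eq_par.
have nab' : ~~ par (v a) (v b) by rewrite -v_eq_par.
have ord x' : I x' a -> I x' b -> ~~ (III (v x') && III (v a)) ->
   ~~ (III (v x') && III (v b)) -> hf (v x') (v a) = 0 /\ hf (v x') (v b) = 0.
  by rewrite /I /Iv => h1 h2 /negPf n1 /negPf n2; move: h1 h2; rewrite n1 n2 => /eqP ? /eqP.
have fin : ~~ (III (v x) && III (v a)) -> ~~ (III (v x) && III (v b)) ->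
    ~~ (III (v y) && III (v a)) -> ~~ (III (v y) && III (v b)) -> False.
  move=> h1 h2 h3 h4; have [q1 q2] := ord x xa xb h1 h2; have [q3 q4] := ord y ya yb h3 h4.
  by move/negP: nab'; apply; apply: (hf_orth_par _ _ nxy' q1 q2 q3 q4).
case Ix: (III (v x)); case Iy: (III (v y)); case Ia: (III (v a)); case Ib: (III (v b));
  try by apply: fin; rewrite ?Ix ?Iy ?Ia ?Ib.
- move: xa ya xb yb; rewrite /I /Iv Ix Iy Ia Ib /= => /eqP h1 /eqP h2 /eqP h3 /eqP h4.
  have nst p q : III (v p) -> III (v q) -> ~~ par (v p) (v q) -> ~~ par (star (v p)) (star (v q)).
    move=> Ip Iq; apply: contra => ps.
    have := star_par fr ps; rewrite !star_star // => /(_ (III_neq0 (fr := fr) _)).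
    rewrite III_star // => /(_ Ip (III_neq0 (fr := fr) _)); rewrite III_star //.
    by move/(_ Iq); rewrite parZl // parZr.
  move/negP: (nst a b Ia Ib nab'); apply.
  by apply: (hf_orth_par _ _ (nst x y Ix Iy nxy') h1 h3 h2 h4) => //; rewrite (III_neq0 (fr := fr)) // III_star.
- exact: (lines_meet_21 fr3 cjfr Ix Iy Ia (negbT Ib) (v_neq0 b) nxy').
- exact: (lines_meet_21 fr3 cjfr Ix Iy Ib (negbT Ia) (v_neq0 a) nxy').
- by apply: (lines_meet_21 fr3 cjfr Ia Ib Ix (negbT Iy) (v_neq0 y) nab');
    rewrite Iv_sym.
- exact: (lines_meet_11 fr3 cjfr Ix Ia (negbT Iy) (negbT Ib)).
- exact: (lines_meet_11 fr3 cjfr Ix Ib (negbT Iy) (negbT Ia)).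
- by apply: (lines_meet_21 fr3 cjfr Ia Ib Iy (negbT Ix) (v_neq0 x) nab');
    rewrite Iv_sym.
- exact: (lines_meet_11 fr3 cjfr Iy Ia (negbT Ix) (negbT Ib)).
- exact: (lines_meet_11 fr3 cjfr Iy Ib (negbT Ix) (negbT Ia)).
Qed.

(** A point that is not of type III lies on a line of the subplane, so these points are the meets of
    the line [w] with the subplane lines, whose covectors are taken from [Dpts]. Two subplane lines
    cannot give the same meet, since it would be a subplane point on a type III line. *)
Lemma card_nonIII_orth w : III w ->
  #|[set x | ~~ tIII x && (dot w (v x) == 0)]| = #|Dpts|.
Proof.
move=> Iw; have w0 := III_neq0 Iw.
have cr d : inD d -> cross (v d) w != vec0 K.
  move=> Dd; apply/negP => p; move: Iw.
  rewrite (III_par fr w0 (v_neq0 d)) 1?par_sym //; apply/negP; exact: inD_nonIII.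
pose g d := pt (cross (v d) w).
rewrite (_ : [set x | _] = g @: Dpts); last first.
  apply/setP => x; rewrite !inE; apply/andP/imsetP => [[nx /eqP ex]|[d]].
    have [d [d0 fd ed]] := nonIII_fixed_orth nx.
    exists (pt d); first by rewrite inE inD_pt.
    apply/eqP; rewrite eq_sym pt_eq; last by rewrite cr // inD_pt.
    apply: par_orth; last by rewrite dotC.
    by apply/eqP; rewrite (par_dot _ _ d0 (ptP d0)) // dotC ed.
  rewrite inE => Dd ->; have c0 := cr d Dd; have [k k0 e] := v_pt c0.
  rewrite /tIII e IIIZ // dotZr dot_crossr mulr0; split=> //.
  have [d' [d0 fd pd]] := fixed_vec (v_neq0 d) Dd.
  apply: (fixed_orth_nonIII d0 fd).
  by apply/eqP; rewrite dotC -(par_dot _ (v_neq0 d) d0 pd) dotC dot_crossl.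
apply: card_in_imset => d1 d2; rewrite !inE => D1 D2 /eqP.
rewrite pt_inj ?cr // => p; apply: contraTeq isT => nd.
have [e1 [d10 fd1 pd1]] := fixed_vec (v_neq0 d1) D1.
have [e2 [d20 fd2 pd2]] := fixed_vec (v_neq0 d2) D2.
have n12 : cross e1 e2 != vec0 K.
  apply: contra nd => q; rewrite v_eq_par; apply: par_trans d10 pd1 _.
  by apply: par_trans d20 q _; rewrite par_sym.
have fz : frv (cross e1 e2) = cross e1 e2 by rewrite frv_cross fd1 fd2.
have := III_fixed_dot Iw n12 fz; case/negP.
set z := cross (v d1) w in p.
have q : par (cross e1 e2) z.
  apply: par_orth; apply/eqP.
    by rewrite -(par_dot _ (v_neq0 d1) d10 pd1) dotC dot_crossl.
  rewrite -(par_dot _ (v_neq0 d2) d20 pd2) dotC.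
  by rewrite (par_dot _ _ _ p) ?cr // dot_crossl.
by rewrite dotC (par_dot _ n12 _ q) ?cr // dot_crossr.
Qed.

Lemma card_III_orth w : III w ->
  #|[set x | tIII x && (dot w (v x) == 0)]| = (#|K|.+1 - #|Dpts|)%N.
Proof.
move=> Iw; rewrite -(card_line (III_neq0 Iw)) -(card_nonIII_orth Iw).
rewrite -(cardsID [set x | tIII x] [set x | dot w (v x) == 0]).
rewrite [X in (_ + X)%N](_ : _ = #|[set x | ~~ tIII x && (dot w (v x) == 0)]|).
  by rewrite addnK; apply: eq_card => x; rewrite !inE andbC.
by apply: eq_card => x; rewrite !inE.
Qed.

Lemma D_le_line w : III w -> (#|Dpts| <= #|K|.+1)%N.
Proof.
move=> Iw; rewrite -(card_line (III_neq0 Iw)) -(card_nonIII_orth Iw).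
by apply/subset_leq_card/subsetP => x; rewrite !inE => /andP[].
Qed.

Definition st x := pt (star (v x)).

Lemma star_neq0 x : tIII x -> star (v x) != vec0 K.
Proof. by move=> Ix; rewrite (III_neq0 (fr := fr)) // III_star. Qed.

Lemma st_III x : tIII x -> tIII (st x).
Proof.
by move=> Ix; have [k k0 e] := v_pt (star_neq0 Ix); rewrite /tIII e IIIZ // III_star.
Qed.

Lemma st_st x : tIII x -> st (st x) = x.
Proof.
move=> Ix; have [k k0 e] := v_pt (star_neq0 Ix).
apply/eqP; rewrite pt_eq ?star_neq0 ?st_III // e starZ star_star // vscA.
by rewrite par_vsc.
Qed.

Lemma card_st (P : pred (vec K)) :
  (forall k u, k != 0 -> P (vsc k u) = P u) ->
  #|[set x | tIII x && P (star (v x))]| = #|[set x | tIII x && P (v x)]|.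
Proof.
move=> PZ; rewrite -(card_in_imset (f := st)).
  apply: eq_card => x; rewrite [in RHS]inE; apply/imsetP/andP => [[y]|[Ix Px]].
    rewrite inE => /andP[Iy Py] ->; split; first exact: st_III.
    by have [k k0 e] := v_pt (star_neq0 Iy); rewrite e PZ.
  exists (st x); last by rewrite st_st.
  rewrite inE st_III //; have [k k0 e] := v_pt (star_neq0 Ix).
  by rewrite e starZ star_star // vscA PZ // !mulf_neq0 ?fmorph_eq0.
move=> x y; rewrite !inE => /andP[Ix _] /andP[Iy _] e.
by rewrite -(st_st Ix) e st_st.
Qed.

(** For [y] of type III only the type III points change: [star] carries them onto the type III
    points of another ordinary type III line, and all such lines have equally many. *)
Lemma card_polI y : #|[set x | I x y]| = #|K|.+1.
Proof.
case Iy: (tIII y); last first.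
  rewrite -(card_line (w := sharp (v y))) ?sharp_eq0 //; apply: eq_card => x.
  by rewrite !inE /I /Iv (_ : III (v y) = false) // andbF /hf dotC.
have Is : III (sharp (v y)) by rewrite III_sharp.
rewrite -(cardsID [set x | tIII x]).
rewrite [X in (_ + X)%N](_ : _ = #|Dpts|); last first.
  rewrite -(card_nonIII_orth Is); apply: eq_card => x; rewrite !inE.
  by rewrite /tIII /I /Iv /hf (dotC (sharp (v y))); case: (III (v x)).
rewrite [X in (X + _)%N](_ : _ = (#|K|.+1 - #|Dpts|)%N).
  by rewrite subnK // (D_le_line Is).
have Iss : III (sharp (star (v y))) by rewrite III_sharp // III_star.
rewrite -(card_III_orth Iss) -(card_st (P := fun u => dot (sharp (star (v y))) u == 0)).
  apply: eq_card => x; rewrite !inE andbC /I /Iv /tIII in Iy *.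
  by rewrite Iy; case: (III (v x)) => //=; rewrite /hf dotC.
by move=> k u k0; rewrite dotZr mulf_eq0 (negPf k0).
Qed.

Lemma card_abs_herm : #|[set x | I x x]| = #|[set x | hf (v x) (v x) == 0]|.
Proof.
rewrite -(cardsID [set x | tIII x]) -[RHS](cardsID [set x | tIII x]).
congr (_ + _)%N; last first.
  by apply: eq_card => x; rewrite !inE /I /Iv /tIII; case: (III (v x)).
rewrite [RHS](_ : _ = #|[set x | tIII x && (hf (v x) (v x) == 0)]|); last first.
  by apply: eq_card => x; rewrite !inE andbC.
rewrite -(card_st (P := fun u => hf u u == 0)).
  by apply: eq_card => x; rewrite !inE /I /Iv /tIII andbb andbC; case: (III (v x)).
by move=> k u k0; rewrite hfZl hfZr !mulf_eq0 fmorph_eq0 (negPf k0).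
Qed.

End Figueroa.

End Projective.

End ProjectiveCoordinates.
Import ProjectiveCoordinates.

(** * Elations with centre of type I or II *)

Section Elations.

Variables (K : finFieldType) (T : finType) (v : T -> vec K) (x0 : T).
Hypothesis v_neq0 : forall x, v x != vec0 K.
Hypothesis v_surj : forall u : vec K, u != vec0 K -> exists x, par (v x) u.
Hypothesis v_inj : forall x y, par (v x) (v y) -> x = y.
Variables fr cj : {rmorphism K -> K}.
Hypothesis fr3 : forall x, fr (fr (fr x)) = x.
Hypothesis cj2 : forall x, cj (cj x) = x.
Hypothesis cjfr : forall x, cj (fr x) = fr (cj x).

Local Notation III := (III fr).
Local Notation star := (star fr).
Local Notation sharp := (sharp cj).
Local Notation hf := (hf cj).
Local Notation frv := (frv fr).
Local Notation W := (W fr).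
Local Notation Iv := (Iv fr cj).
Local Notation pt := (pt v x0).
Local Notation tIII := (tIII v fr).
Local Notation inD := (inD v fr).
Local Notation I := (I v fr cj).
Local Notation Dpts := (Dpts v fr).

Let ptv x : pt (v x) = x. Proof. exact: pt_v. Qed.

Let vpt u : u != vec0 K -> exists2 k, k != 0 & v (pt u) = vsc k u.
Proof. exact: v_pt. Qed.

Let ptP' u : u != vec0 K -> par (v (pt u)) u.
Proof. exact: ptP. Qed.

Lemma I_pt u w : u != vec0 K -> w != vec0 K -> I (pt u) (pt w) = Iv u w.
Proof.
move=> u0 w0; rewrite /ProjectiveCoordinates.I (Iv_par _ _ _ (v_neq0 _) u0); last exact: ptP.
rewrite (Iv_sym fr cj2) (Iv_par _ _ _ (v_neq0 _) w0); last exact: ptP.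
exact: Iv_sym.
Qed.

Lemma tIII_pt u : u != vec0 K -> tIII (pt u) = III u.
Proof. by move=> u0; apply: III_par => //; apply: ptP. Qed.

Lemma Iv_ordl u w : ~~ III u -> Iv u w = (hf u w == 0).
Proof. by move=> /negPf h; rewrite /FigueroaVectors.Iv h. Qed.

Lemma Iv_ordr u w : ~~ III w -> Iv u w = (hf u w == 0).
Proof. by move=> /negPf h; rewrite /FigueroaVectors.Iv h andbF. Qed.

(** This and the following facts say that [W (a, b, c)] is the Moore determinant of its entries:
    alternating, and linear in each entry over the fixed field of [fr]. *)
Lemma W_0l (b c : K) : W (0, b, c) = 0.
Proof. by rewrite /FigueroaVectors.W /det3 /dot /cross /= !rmorph0; ring. Qed.
Lemma W_0m (a c : K) : W (a, 0, c) = 0.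
Proof. by rewrite /FigueroaVectors.W /det3 /dot /cross /= !rmorph0; ring. Qed.
Lemma W_0r (a b : K) : W (a, b, 0) = 0.
Proof. by rewrite /FigueroaVectors.W /det3 /dot /cross /= !rmorph0; ring. Qed.

Lemma W_C (a b c : K) : W (a, b, c) = W (b, c, a).
Proof. by rewrite /FigueroaVectors.W /det3 /dot /cross /=; ring. Qed.
Lemma W_N (a b c : K) : W (a, b, c) = - W (b, a, c).
Proof. by rewrite /FigueroaVectors.W /det3 /dot /cross /=; ring. Qed.
Lemma W_D (a b c d : K) : W (a, b, c + d) = W (a, b, c) + W (a, b, d).
Proof. by rewrite /FigueroaVectors.W /det3 /dot /cross /= !rmorphD; ring. Qed.
Lemma W_F (f a b c : K) : fr f = f -> W (a, b, f * c) = f * W (a, b, c).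
Proof. by move=> ef; rewrite /FigueroaVectors.W /det3 /dot /cross /= !rmorphM !ef; ring. Qed.
Lemma W_bb (a b : K) : W (a, b, b) = 0.
Proof. by rewrite /FigueroaVectors.W /det3 /dot /cross /=; ring. Qed.
Lemma W_aa (a b : K) : W (a, b, a) = 0.
Proof. by rewrite /FigueroaVectors.W /det3 /dot /cross /=; ring. Qed.
Lemma W_K (k a b c : K) : W (k * a, k * b, k * c) = k * fr k * fr (fr k) * W (a, b, c).
Proof. by rewrite -(WZ fr k (a, b, c)). Qed.

(** A Vandermonde determinant in the three conjugates of [a], which are distinct because [fr] has
    order 3. *)
Lemma W_vander (a : K) : fr a != a -> W (1, a, a ^+ 2) != 0.
Proof.
move=> na; have -> : W (1, a, a ^+ 2) = (fr a - a) * (fr (fr a) - a) * (fr (fr a) - fr a).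
  by rewrite /FigueroaVectors.W /det3 /dot /cross /= !rmorphXn !rmorph1; ring.
rewrite !mulf_neq0 ?subr_eq0 ?(inj_eq (fmorph_inj fr)) //.
by apply: contra na => /eqP e; rewrite -{2}(fr3 a) e.
Qed.

Lemma W_basis (a g : K) : fr a != a -> W (1, a, g) = 0 ->
  exists A B, [/\ fr A = A, fr B = B & g = A + B * a].
Proof.
move=> na /eqP w0; have := @nonIII_fixed_orth _ fr (1, a, g); rewrite /FigueroaVectors.III w0.
case=> // -[[d1 d2] d3] [d0 [f1 f2 f3] /eqP]; rewrite /dot /= mulr1 => /eqP e.
have d3n : d3 != 0.
  apply/eqP => d30; rewrite d30 mul0r addr0 in e.
  have d2n : d2 != 0.
    by apply: contraNneq d0 => d20; move: e; rewrite d20 mul0r addr0 d30 => ->.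
  case/negP: na; have -> : a = - d1 / d2.
    apply: (mulfI d2n); rewrite mulrCA mulfV // mulr1; apply/eqP.
    by rewrite -addr_eq0 addrC e.
  by rewrite fmorph_div rmorphN f1 f2.
exists (- d1 / d3), (- d2 / d3); rewrite !fmorph_div !rmorphN f1 f2 f3; split=> //.
have {}e : d3 * g = - (d1 + d2 * a) by apply/eqP; rewrite -addr_eq0 addrC e.
by apply: (mulfI d3n); rewrite e; field.
Qed.

(** The span of 1 and [a] over the fixed field is not stable under an element that is not fixed:
    writing g = A + B a, the product g a contains B a^2, which lies outside the span unless B is
    zero. *)
Lemma W_stable (a g : K) : fr a != a -> fr g != g ->
  W (1, a, g) = 0 -> W (1, a, g * a) = 0 -> False.
Proof.
move=> na ng /(W_basis na)[A [B [fA fB eg]]] /eqP.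
have -> : g * a = A * a + B * a ^+ 2 by rewrite eg; ring.
rewrite W_D (W_F _ _ _ fA) (W_F _ _ _ fB) W_bb mulr0 add0r mulf_eq0 (negPf (W_vander na)) orbF => /eqP B0.
by case/negP: ng; rewrite eg B0 mul0r addr0 fA.
Qed.

(** When [w] lies on the line [l] in the ordinary sense, the form on the stars reduces to a product
    of conjugates of the values on [w] of the two conjugates of [l]. So [w] is one of the two meets
    of [l] with its conjugates. *)
Lemma exceptional_le2 x : tIII x ->
  (#|[set w | [&& tIII w, hf (v w) (v x) == 0%R & I w x]]| <= 2)%N.
Proof.
move=> Ix; set l := sharp (v x).
have Il : III l by rewrite III_sharp.
have n1 : cross l (frv l) != vec0 K by apply: III_npar_frv.
have n2 : cross l (frv (frv l)) != vec0 K.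
  by apply: contra (III_npar_frv Il) => p; rewrite -(frv_par fr) -(frv_par fr) frv3 // par_sym.
apply: leq_trans (_ : #|[set pt (cross l (frv l)); pt (cross l (frv (frv l)))]| <= _)%N;
  last by rewrite cards2; case: (_ != _).
apply/subset_leq_card/subsetP => w; rewrite !inE => /and3P[Iw /eqP e].
rewrite /ProjectiveCoordinates.tIII in Iw Ix; rewrite /ProjectiveCoordinates.I /FigueroaVectors.Iv Iw Ix /= /FigueroaVectors.hf -[sharp (star _)]vsc1 -[1]opprK -mulN1r -vscA.
rewrite -star_sharp // dotZr mulN1r oppr_eq0 -/l {1 2}/FigueroaVectors.star dot_cross2.
have -> : dot (frv (v w)) (frv l) = 0 by rewrite -fr_dot [dot _ _]e rmorph0.
rewrite mul0r sub0r oppr_eq0 mulf_eq0.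
have -> : dot (frv (v w)) (frv (frv l)) = fr (dot (v w) (frv l)) by rewrite fr_dot.
have -> : dot (frv (frv (v w))) (frv l) = fr (fr (dot (v w) (frv (frv l)))).
  by rewrite !fr_dot frv3.
rewrite !fmorph_eq0 !(eq_sym w) !pt_eq //.
case/orP=> /eqP e'; apply/orP; [left|right]; exact: par_orth.
Qed.

(** * Centre in the subplane *)

Section TypeI.

Variables (s : {perm T}) (c : T).
Hypothesis sE : pol_elation I s c.
Hypothesis c_e1 : par (v c) (1, 0, 0).
Hypothesis manyIII : (2 < #|K|.+1 - #|Dpts|)%N.

Let sI : I_aut I s := proj1 sE.

Let aff (x y : K) : vec K := (x, y, 1).
Let aff0 x y : aff x y != vec0 K.
Proof. by rewrite !xpair_eqE oner_eq0 andbF. Qed.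

Let e10 : (1, 0, 0) != vec0 K. Proof. by rewrite !xpair_eqE oner_eq0. Qed.

Let cE x : I x c = ((v x).2 == 0).
Proof.
have -> : c = pt (1, 0, 0) by apply/eqP; rewrite eq_sym pt_eq // par_sym.
rewrite -{1}[x]ptv I_pt // Iv_ordr; last by rewrite /FigueroaVectors.III W_0r eqxx.
by rewrite /FigueroaVectors.hf /dot /= !rmorph0 !mulr0 !add0r rmorph1 mulr1.
Qed.

(** The line joining the point to the centre is the polar of [k], which lies on the axis; so it is
    fixed, and it is determined by [y]. *)
Let s_aff x y : exists x', s (pt (aff x y)) = pt (aff x' y).
Proof.
pose k : vec K := (- cj y, 1, 0).
have k0 : k != vec0 K by rewrite !xpair_eqE oner_eq0 andbF.
have nk : ~~ III k by rewrite /FigueroaVectors.III W_0r eqxx.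
have sk : s (pt k) = pt k.
  by apply: (proj2 sE); rewrite cE; have [l _ ->] := vpt k0; rewrite /vsc /= mulr0.
have := sI (pt (aff x y)) (pt k); rewrite sk [X in _ = X]I_pt // Iv_ordr //.
have -> : hf (aff x y) k = 0 by rewrite /FigueroaVectors.hf /dot /= rmorph1 rmorph0 rmorphN cj2; ring.
rewrite eqxx.
set z := s _; have nz : (v z).2 != 0.
  rewrite -cE -(proj2 sE c); last by rewrite cE; have [l _ ->] := par_exn (v_neq0 c) e10 c_e1; rewrite /vsc /= mulr0.
  by rewrite sI cE; have [l l0 ->] := vpt (aff0 x y); rewrite /vsc /= mulr1.
rewrite -{1}[z]ptv I_pt // Iv_ordr // => /eqP e.
exists ((v z).1.1 / (v z).2); apply/eqP; rewrite eq_sym pt_eq //.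
have -> : aff ((v z).1.1 / (v z).2) y = vsc (v z).2^-1 (v z).
  move: e nz; case: (v z) => [[a b] d]; rewrite /FigueroaVectors.hf /dot /vsc /aff /= rmorph1 rmorph0 rmorphN cj2.
  rewrite mulr0 mulr1 add0r mulrN => /eqP; rewrite subr_eq0 => /eqP -> d0.
  by rewrite mulrC mulKf // mulVf.
by rewrite par_vsc.
Qed.

Lemma typeI_linear : exists lam, [/\ fr lam = lam, cj lam = - lam &
  forall x, par (v (s x)) ((v x).1.1 + lam * (v x).2, (v x).1.2, (v x).2)].
Proof.
(* For [y] in the fixed field the point lies on a subplane line, so its incidences are hermitian
   whatever the type of the other point. *)
have hI x y x1 y1 : fr y = y -> I (pt (aff x y)) (pt (aff x1 y1)) =
    (x + y * cj y1 + cj x1 == 0).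
  move=> fy; rewrite I_pt // Iv_ordl.
    by rewrite /FigueroaVectors.hf /dot /= rmorph1 mulr1 mul1r.
  apply: (@fixed_orth_nonIII _ fr (0, 1, - y)).
  - by rewrite !xpair_eqE oner_eq0 andbF.
  - by rewrite /FigueroaVectors.frv /= rmorph0 rmorph1 rmorphN fy.
  - by rewrite /dot /=; ring.
have [f fP] : exists f : K -> K -> K, forall x y, s (pt (aff x y)) = pt (aff (f x y) y).
  pose f x y := odflt 0 [pick x' | s (pt (aff x y)) == pt (aff x' y)].
  exists f => x y; rewrite /f; case: pickP => [x' /eqP //|none].
  by have [x' e] := s_aff x y; have := none x'; rewrite e eqxx.
have fI x y x1 y1 : fr y = y -> x + y * cj y1 + cj x1 = 0 ->
    f x y + y * cj y1 + cj (f x1 y1) = 0.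
  by move=> fy /eqP; rewrite -hI // -sI !fP hI // => /eqP.
(* Incidence with a point whose second coordinate is 0 shows that the shift does not depend on [y];
   below, second coordinate 1 shows that it does not depend on [x] either. *)
have g0 x y : f x y = - cj (f (- cj x) 0).
  have := fI (- cj x) 0 x y (rmorph0 fr); rewrite !mul0r !addr0 addNr => /(_ erefl) /eqP.
  by rewrite addr_eq0 => /eqP ->; rewrite rmorphN cj2 opprK.
pose g x := f x 0; have fg x y : f x y = g x by rewrite /g g0 [RHS]g0.
pose lam := g 0; have gE x : g x = x - cj lam.
  have := fI x 1 0 (- cj x) (rmorph1 fr); rewrite rmorphN cj2 mul1r subrr add0r rmorph0.
  move=> /(_ erefl) /eqP; rewrite !fg -/lam -addrA addr_eq0 opprD opprK => /eqP ->.
  by rewrite addrC.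
have clam : cj lam = - lam by rewrite {2}/lam gE sub0r opprK.
have sP x y : s (pt (aff x y)) = pt (aff (x + lam) y) by rewrite fP fg gE clam opprK.
have sv x : par (v (s x)) ((v x).1.1 + lam * (v x).2, (v x).1.2, (v x).2).
  have [z0|zn] := eqVneq (v x).2 0.
    rewrite (proj2 sE) ?cE ?z0 // mulr0 addr0.
    by rewrite -[X in (_, _, X)]z0 -!surjective_pairing paruu.
  have xE : x = pt (aff ((v x).1.1 / (v x).2) ((v x).1.2 / (v x).2)).
    apply/eqP; rewrite eq_sym pt_eq //.
    have -> : aff ((v x).1.1 / (v x).2) ((v x).1.2 / (v x).2) = vsc (v x).2^-1 (v x).
      by rewrite /vsc /aff mulVf // ![(v x).2^-1 * _]mulrC.
    by rewrite par_vsc.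
  rewrite {1}xE sP; apply: par_trans (ptP' (aff0 _ _)) _ => //.
  have -> : aff ((v x).1.1 / (v x).2 + lam) ((v x).1.2 / (v x).2) =
     vsc (v x).2^-1 ((v x).1.1 + lam * (v x).2, (v x).1.2, (v x).2).
    rewrite /vsc /aff /= mulVf // ![(v x).2^-1 * _]mulrC; congr (_, _, _).
    by rewrite mulrDl mulfK.
  by rewrite par_vsc.
exists lam; split=> //; apply/eqP; apply: contraT => nlam.
(* If [lam] were not fixed, (0, y, 1) would not be of type III while its image (lam, lam^2, 1) is,
   by Vandermonde. As [s] is linear, every type III point ordinarily on the image polar would also
   be incident with it in the plane, more than the two exceptions allowed. *)
pose y := lam ^+ 2.
have Iw : III (aff lam y) by rewrite /FigueroaVectors.III W_C W_C W_vander.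
have z0 : ~~ III (aff 0 y) by rewrite /FigueroaVectors.III W_0l eqxx.
have Isz : tIII (pt (aff lam y)) by rewrite tIII_pt.
have := leq_trans manyIII (_ : _ <= 2)%N; rewrite ltnn => -> //.
have Is : III (sharp (v (pt (aff lam y)))) by rewrite III_sharp.
have <- : #|[set x | tIII x && (dot (sharp (v (pt (aff lam y)))) (v x) == 0)]|
    = (#|K|.+1 - #|Dpts|)%N by apply: card_III_orth.
apply: leq_trans (exceptional_le2 Isz).
apply/subset_leq_card/subsetP => w; rewrite !inE => /andP[Iw'].
rewrite dotC -/(FigueroaVectors.hf cj _ _) => hw; rewrite Iw' hw /=.
have e : pt (aff lam y) = s (pt (aff 0 y)) by rewrite sP add0r.
rewrite e -(permKV s w) sI; set w1 := (s^-1)%g w.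
rewrite -[w1]ptv I_pt // Iv_ordr //.
move: hw; rewrite -(permKV s w) -/w1.
have [k k0 ek] := vpt (aff0 lam y).
have h1 : (v w1).1.1 + lam * (v w1).2 = 0 -> ((v w1).1.1 + lam * (v w1).2, (v w1).1.2, (v w1).2) = vec0 K -> False.
  move=> _ [e1 e2 e3]; have := v_neq0 w1; rewrite [v w1]surjective_pairing [(v w1).1]surjective_pairing.
  by move: e1; rewrite e2 e3 mulr0 addr0 => ->; rewrite eqxx.
have nz : ((v w1).1.1 + lam * (v w1).2, (v w1).1.2, (v w1).2) != vec0 K.
  by apply/eqP => z; apply: h1 (z); case: z.
have [l l0 el] := par_exn (v_neq0 _) nz (sv w1).
rewrite el ek hfZl hfZr !mulf_eq0 fmorph_eq0 (negPf k0) (negPf l0) /=.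
suff -> : hf ((v w1).1.1 + lam * (v w1).2, (v w1).1.2, (v w1).2) (aff lam y) = hf (v w1) (aff 0 y) by [].
by rewrite /FigueroaVectors.hf /dot /= rmorph1 rmorph0 clam; ring.
Qed.

End TypeI.

Lemma elation_fix (s : {perm T}) c z : (1 < #|K|)%N -> I c c -> pol_elation I s c ->
  ~~ I z c -> s z = z -> s = 1%g.
Proof.
move=> n1; apply: (elation_fix_eq1 (n := #|K|)) => //.
- exact: I_symm.
- exact: (card_points x0).
- exact: (card_polI x0).
- exact: I_unique.
Qed.

Lemma hf_sharp u w : hf u (sharp w) = dot u w.
Proof. by rewrite /FigueroaVectors.hf sharpK. Qed.

(** * Centre of type II *)

Section TypeII.

Variables (s : {perm T}) (c : T) (gam : K).
Hypothesis K_gt1 : (1 < #|K|)%N.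
Hypothesis sE : pol_elation I s c.
Hypothesis cg : par (v c) (gam, 0, 1).
Hypothesis cgam : cj gam = - gam.
Hypothesis ngam : fr gam != gam.
Hypothesis F3 : exists f g, [/\ fr f = f, fr g = g, f != 0, g != 0 &
  [&& f != 1, g != 1 & f != g]].
Hypothesis s_neq1 : s != 1%g.

Let sI : I_aut I s := proj1 sE.
(** Coordinates adapted to the centre: [Mv] runs through the points other than c of the subplane
    line through c, [Rv] is the pole of that line, [Av] runs through the points other than c of the
    axis, and [pv b u] is b times [Mv u] plus [Rv]. *)
Let Mv (u : K) : vec K := (1 + gam * u, 0, u).
Let pv (b u : K) : vec K := (b * (1 + gam * u), 1, b * u).
Let Av (z : K) : vec K := (gam * z, 1, z).
Let Rv : vec K := (0, 1, 0).

Let R0 : Rv != vec0 K. Proof. by rewrite !xpair_eqE oner_eq0 andbF. Qed.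
Let p0 b u : pv b u != vec0 K. Proof. by rewrite !xpair_eqE oner_eq0 andbF. Qed.
Let A0 z : Av z != vec0 K. Proof. by rewrite !xpair_eqE oner_eq0 andbF. Qed.
Let c0 : (gam, 0, 1) != vec0 K. Proof. by rewrite !xpair_eqE oner_eq0 andbF. Qed.
Let M0 u : Mv u != vec0 K.
Proof.
apply/eqP => -[e1 e2]; move: e1; rewrite e2 mulr0 addr0.
by apply/eqP; rewrite oner_eq0.
Qed.

Let nM u : ~~ III (Mv u). Proof. by rewrite /FigueroaVectors.III W_0m eqxx. Qed.
Let nR : ~~ III Rv. Proof. by rewrite /FigueroaVectors.III W_0l eqxx. Qed.

(** Lines are handled by covectors: [pt (sharp L)] is the pole of the line [L], and outside type III
    incidence is ordinary. *)
Let I_cov x L : L != vec0 K -> ~~ III L -> I x (pt (sharp L)) = (dot (v x) L == 0).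
Proof.
move=> L0 nL; rewrite -{1}[x]ptv I_pt ?sharp_eq0 // Iv_ordr ?III_sharp //.
by rewrite hf_sharp.
Qed.

Let dot_pt u L : u != vec0 K -> (dot (v (pt u)) L == 0) = (dot u L == 0).
Proof.
move=> u0; have [k k0 ->] := vpt u0.
by rewrite dotZl mulf_eq0 (negPf k0).
Qed.

Let cE x : I x c = ((v x).1.1 == gam * (v x).2).
Proof.
have -> : c = pt (gam, 0, 1) by apply/eqP; rewrite eq_sym pt_eq // par_sym.
rewrite -{1}[x]ptv I_pt // Iv_ordr; last by rewrite /FigueroaVectors.III W_0m eqxx.
by rewrite /FigueroaVectors.hf /dot /= rmorph0 rmorph1 cgam mulr0 mulr1 addr0 mulrN subr_eq0 mulrC.
Qed.

Let cc : I c c.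
Proof. by rewrite cE; have [k _ ->] := par_exn (v_neq0 c) c0 cg; rewrite /vsc /= mulr1 mulrC. Qed.

Let sc : s c = c. Proof. exact: (proj2 sE). Qed.

Let saxis z : s (pt (Av z)) = pt (Av z).
Proof.
apply: (proj2 sE); rewrite cE; have [k _ ->] := vpt (A0 z).
by rewrite /vsc /= mulrCA.
Qed.

Let sR : s (pt Rv) = pt Rv.
Proof.
apply: (proj2 sE); rewrite cE; have [k _ ->] := vpt R0.
by rewrite /vsc /= !mulr0.
Qed.

Let RE x : I x (pt Rv) = ((v x).1.2 == 0).
Proof.
rewrite -{1}[x]ptv I_pt // Iv_ordr //.
by rewrite /FigueroaVectors.hf /dot /= rmorph0 rmorph1 !mulr0 mulr1 addr0 add0r.
Qed.

Let offaxis u : u != vec0 K -> u.1.1 != gam * u.2 ->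
  (v (s (pt u))).1.1 != gam * (v (s (pt u))).2.
Proof.
move=> u0; rewrite -cE -{1}sc sI cE; have [k k0 ->] := vpt u0.
by rewrite /vsc /= mulrCA (inj_eq (mulfI k0)).
Qed.

Let tau_ex : exists tau : K -> K, forall u, s (pt (Mv u)) = pt (Mv (tau u)).
Proof.
have h u : exists t, s (pt (Mv u)) == pt (Mv t).
  have := RE (s (pt (Mv u))); rewrite -{1}sR sI RE.
  have [k k0 ->] := vpt (M0 u); rewrite /vsc /= mulr0 eqxx => /esym/eqP z2.
  have := @offaxis (Mv u) (M0 u); rewrite /= -subr_eq0 addrK oner_eq0 => /(_ isT).
  set z := s _ in z2 *; rewrite -subr_eq0; set k' := _ - _ => nk.
  exists ((v z).2 / k'); rewrite eq_sym pt_eq //.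
  have -> : Mv ((v z).2 / k') = vsc k'^-1 (v z).
    rewrite /vsc /Mv z2 mulr0 [k'^-1 * (v z).2]mulrC; congr (_, _, _).
    by rewrite -[in LHS](mulVf nk) mulrCA -[gam * _]mulrC mulrCA -mulrDr [(v z).2 * gam]mulrC subrK.
  by rewrite par_vsc.
pose tau u := odflt 0 [pick t | s (pt (Mv u)) == pt (Mv t)].
exists tau => u; rewrite /tau; case: pickP => [t /eqP //|none].
by have [t] := h u; rewrite none.
Qed.

Lemma typeII_false : False.
Proof.
have [tau tauP] := tau_ex.
(* The line [L] through [Rv] and [Mv u] contains [pv b u]. Its image passes through the fixed point
   [Rv], hence again has middle coordinate 0 and ordinary incidence. *)
have sp b u : b != 0 -> exists2 b', b' != 0 & s (pt (pv b u)) = pt (pv b' (tau u)).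
  move=> b0; set z := s _.
  have z2 : (v z).1.2 != 0.
    rewrite -RE -{1}sR sI RE; have [k k0 ->] := vpt (p0 b u).
    by rewrite /vsc /= mulr1.
  have := @offaxis (pv b u) (p0 b u); rewrite /= -subr_eq0.
  have -> : b * (1 + gam * u) - gam * (b * u) = b by ring.
  move=> /(_ b0); rewrite -/z -subr_eq0; set k := _ - _ => nk.
  have [b' [t [b'0 zE]]] : exists b' t, b' != 0 /\ z = pt (pv b' t).
    exists (k / (v z).1.2), ((v z).2 / k).
    split; first by rewrite mulf_neq0 // invr_eq0.
    apply/eqP; rewrite eq_sym pt_eq //.
    have -> : pv (k / (v z).1.2) ((v z).2 / k) = vsc (v z).1.2^-1 (v z).
      by rewrite /vsc /pv /=; apply: vecE; rewrite /k; field; rewrite ?nk ?z2.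
    by rewrite par_vsc.
  exists b' => //; rewrite zE; congr (pt (pv _ _)).
  pose L : vec K := (u, 0, - (1 + gam * u)).
  have L0 : L != vec0 K.
    apply: contraNneq (M0 u) => -[e1 /eqP]; rewrite oppr_eq0 => /eqP e2.
    by rewrite /Mv e2 e1.
  have nL : ~~ III L by rewrite /FigueroaVectors.III W_0m eqxx.
  pose k1 := pt (sharp L).
  have i1 : I (pt (pv b u)) k1 by rewrite I_cov // dot_pt // /dot /=; apply/eqP; ring.
  have i2 : I (pt (Mv u)) k1 by rewrite I_cov // dot_pt // /dot /=; apply/eqP; ring.
  have i3 : I (pt Rv) k1 by rewrite I_cov // dot_pt // /dot /=; apply/eqP; ring.
  have k2 : (v (s k1)).1.2 = 0 by apply/eqP; rewrite -RE -{1}sR sI I_symm.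
  have nk2 : ~~ III (v (s k1)).
    by rewrite [v _]surjective_pairing [_.1]surjective_pairing k2 /FigueroaVectors.III W_0m eqxx.
  move: i1 i2; rewrite -(sI _ k1) -(sI (pt (Mv u))) tauP -/z zE.
  rewrite -[s k1]ptv !I_pt // !Iv_ordr //.
  have := v_neq0 (s k1); case: (v (s k1)) k2 {nk2} => [[a d] e] /= ->.
  rewrite /FigueroaVectors.hf /dot /= rmorph0 mul1r mul0r !addr0.
  move=> nz /eqP e1 /eqP e2.
  have {}e1 : (1 + gam * t) * cj e + t * cj a = 0.
    by apply: (mulfI b'0); rewrite mulr0 -[RHS]e1; ring.
  have : (t - tau u) * (gam * cj e + cj a) = 0.
    by rewrite -[RHS](subrr 0) -{1}e1 -e2; ring.
  move/eqP; rewrite mulf_eq0 => /orP[|/eqP e3]; first by rewrite subr_eq0 => /eqP.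
  have ce : cj e = 0 by rewrite -[RHS]e1 -[LHS]addr0 -(mulr0 t) -e3; ring.
  move: e3; rewrite ce mulr0 add0r => ca.
  by case/negP: nz; rewrite !xpair_eqE -(fmorph_eq0 cj a) -(fmorph_eq0 cj e) ca ce !eqxx.
(* The points [pv b u] with [b] given lie on the line (1, -b, -gam) through the centre. The
   condition on [W] keeps this line out of type III, and it is fixed since its pole is on the
   axis. *)
have sB b u : b != 0 -> W (1, b, gam) = 0 -> s (pt (pv b u)) = pt (pv b (tau u)).
  move=> b0 wb; have [b' b'0 e] := sp b u b0; rewrite e; congr (pt (pv _ _)).
  pose L : vec K := (1, - b, - gam).
  have L0 : L != vec0 K by rewrite !xpair_eqE oner_eq0.
  have nL : ~~ III L.
    rewrite /FigueroaVectors.III negbK /L; apply/eqP; rewrite -wb /FigueroaVectors.W /det3 /dot /cross /=.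
    by rewrite !rmorphN !rmorph1; ring.
  have sk : s (pt (sharp L)) = pt (sharp L).
    apply: (proj2 sE); rewrite cE.
    have sL0 : sharp L != vec0 K by rewrite sharp_eq0.
    have [k k0 ->] := vpt sL0.
    by rewrite /vsc /FigueroaVectors.sharp /= !rmorphN rmorph1 cgam opprK mulr1 mulrC.
  have : I (pt (pv b u)) (pt (sharp L)) by rewrite I_cov // dot_pt // /dot /=; apply/eqP; ring.
  rewrite -sI sk e I_cov // dot_pt // => /eqP h.
  by apply/eqP; rewrite -subr_eq0; apply/eqP; rewrite -[RHS]h /dot /=; ring.
pose kap := tau 0.
have tauE t : tau t = t + kap.
  have [->|t0] := eqVneq t 0; first by rewrite add0r.
  pose e := - (1 + gam * kap).
  (* [b] is sought in the span of 1 and [gam] over the fixed field, where the first condition on [W]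
     is automatic. The second is one linear equation with coefficients [d0], [d1] in the fixed
     field, so it has a nonzero solution. *)
  have [b [b0 wb wz]] : exists b, [/\ b != 0, W (1, b, gam) = 0 & W (kap, t * b, e) = 0].
    pose d0 := W (kap, t, e); pose d1 := W (kap, t * gam, e).
    have fd0 : fr d0 = d0 by apply: fr_W.
    have fd1 : fr d1 = d1 by apply: fr_W.
    have [d00|d0n] := eqVneq d0 0.
      exists 1; rewrite oner_eq0 mulr1 -d00; split=> //.
      by rewrite W_N -W_C W_bb oppr0.
    pose f := - (d1 / d0).
    have ff : fr f = f by rewrite rmorphN fmorph_div fd0 fd1.
    exists (f + gam); split.
    - by apply: contra ngam; rewrite addrC addr_eq0 => /eqP ->; rewrite rmorphN ff.
    - rewrite W_C W_C W_D -[f in W (_, _, f)]mulr1 (W_F _ _ _ ff) W_bb W_aa mulr0 addr0 //.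
    - rewrite W_C W_C mulrDr W_D [t * f]mulrC (W_F _ _ _ ff).
      have -> : W (e, kap, t) = d0 by rewrite W_C.
      have -> : W (e, kap, t * gam) = d1 by rewrite W_C.
      by rewrite /f mulNr divfK // addNr.
  pose z := t * b; have z0 : z != 0 by rewrite mulf_neq0.
  pose L : vec K := (kap, z, e).
  have L0 : L != vec0 K by rewrite !xpair_eqE (negPf z0) andbF.
  have nL : ~~ III L by rewrite /FigueroaVectors.III negbK; apply/eqP.
  pose N : vec K := (0, - z, 1).
  have N0 : N != vec0 K by rewrite !xpair_eqE oner_eq0 andbF.
  have nN : ~~ III N by rewrite /FigueroaVectors.III W_0l eqxx.
  (* [N] joins [Av z] to [Mv 0], and [L] joins their images [Av z] and [Mv kap]. As [pv b t] lies on
     [N] and neither line is of type III, its image lies ordinarily on [L], which yields the value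
     of [tau t]. *)
  have sN : s (pt (sharp N)) = pt (sharp L).
    apply: (@I_unique _ _ v v_neq0 v_inj fr cj fr3 cj2 cjfr (pt (Av z)) (pt (Mv kap))).
    - rewrite pt_inj //; apply/eqP => -[e1 e2 e3].
      have k0 : kap = 0 by rewrite -[RHS]e1; ring.
      by move: e3; rewrite k0 !mulr0 addr0 mulr1 sub0r => /eqP; rewrite oppr_eq0 oner_eq0.
    - by rewrite -(saxis z) sI I_cov // dot_pt // /dot /=; apply/eqP; ring.
    - by rewrite -tauP sI I_cov // dot_pt // /dot /=; apply/eqP; ring.
    - by rewrite I_cov // dot_pt // /dot /= /e; apply/eqP; ring.
    - by rewrite I_cov // dot_pt // /dot /= /e; apply/eqP; ring.
  have : I (pt (pv b t)) (pt (sharp N)).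
    by rewrite I_cov // dot_pt // /dot /= /z; apply/eqP; ring.
  rewrite -sI sN sB // I_cov // dot_pt // => /eqP h.
  apply/eqP; rewrite eq_sym -subr_eq0; apply/eqP; apply: (mulfI b0).
  by rewrite mulr0 -[RHS]h /dot /= /e /z; ring.
have kap0 : kap != 0.
  apply: contra s_neq1 => /eqP k0; apply/eqP.
  apply: (elation_fix (c := c) (z := pt (Mv 0))) => //; last by rewrite tauP -/kap k0.
  rewrite cE; have [k kn ->] := vpt (M0 0).
  by rewrite /vsc /Mv /= !mulr0 addr0 mulr1.
have [f [g [ff fg fn gn /and3P[f1 g1 nfg]]]] := F3.
pose th e := kap * (e - gam).
(* Up to a nonzero factor this is a quadratic in [e]. If it vanished at 0, 1 and [f], all
   coefficients would be zero; the first then puts 1/kap into the span of 1 and [gam], and the other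
   two make it zero. The condition is what makes the image line below of type III. *)
have [e fe We] : exists2 e, fr e = e & W (1, th e, gam * th e) != 0.
  pose rho := kap^-1; have rho0 : rho != 0 by rewrite invr_eq0.
  pose a2 := W (rho, 1, gam); pose a1 := W (rho, 1, gam ^+ 2); pose a0 := W (rho, gam, gam ^+ 2).
  have WE e : fr e = e -> W (1, th e, gam * th e) =
      kap * fr kap * fr (fr kap) * (e ^+ 2 * a2 - e * a1 + a0).
    move=> fe; have -> : (1, th e, gam * th e) =
       (kap * rho, kap * (e - gam), kap * (gam * (e - gam))) :> vec K.
      by rewrite /rho mulfV // /th [gam * (kap * _)]mulrCA.
    rewrite W_K; congr (_ * _); rewrite /a2 /a1 /a0 /FigueroaVectors.W /det3 /dot /cross /=.
    by rewrite !(rmorphM, rmorphB, fe, rmorphXn, rmorph1); ring.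
  have [z0|n0] := eqVneq (0 ^+ 2 * a2 - 0 * a1 + a0) 0; last first.
    exists 0; first exact: rmorph0.
    by rewrite WE ?rmorph0 // !mulf_neq0 ?fmorph_eq0.
  have [z1|n1] := eqVneq (1 ^+ 2 * a2 - 1 * a1 + a0) 0; last first.
    exists 1; first exact: rmorph1.
    by rewrite WE ?rmorph1 // !mulf_neq0 ?fmorph_eq0.
  exists f => //; rewrite WE // !mulf_neq0 ?fmorph_eq0 //; apply/eqP => zf.
  have a00 : a0 = 0 by rewrite -[RHS]z0; ring.
  have e12 : a2 = a1 by apply/eqP; rewrite -subr_eq0; apply/eqP; rewrite -[RHS]z1 a00; ring.
  have : f * (f - 1) * a2 = 0 by rewrite -[RHS]zf a00 -e12; ring.
  move/eqP; rewrite !mulf_eq0 (negPf fn) subr_eq0 (negPf f1) /= => /eqP a20.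
  have a10 : a1 = 0 by rewrite -e12.
  have w1 : W (1, gam, rho) = 0 by rewrite -[RHS]a20 /a2 W_C W_C.
  have [A [B [fA fB rE]]] := W_basis ngam w1.
  have v1 := W_vander ngam.
  have B0 : B = 0.
    have : - (B * W (1, gam, gam ^+ 2)) = 0.
      rewrite -[RHS]a10 /a1 rE -(W_F _ _ _ fB) /FigueroaVectors.W /det3 /dot /cross /=.
      by rewrite !rmorphD !rmorphM !fA !fB !rmorph1; ring.
    by move/eqP; rewrite oppr_eq0 mulf_eq0 (negPf v1) orbF => /eqP.
  have A00 : A = 0.
    have : A * W (1, gam, gam ^+ 2) = 0.
      rewrite -[RHS]a00 /a0 rE B0 /FigueroaVectors.W /det3 /dot /cross /=.
      by rewrite mul0r addr0 !fA !rmorph1; ring.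
    by move/eqP; rewrite mulf_eq0 (negPf v1) orbF => /eqP.
  by move/eqP: rho0; apply; rewrite rE A00 B0 mul0r addr0.
pose t := th e; rewrite -/t in We.
have neg : e - gam != 0.
  by rewrite subr_eq0; apply: contra ngam => /eqP <-; rewrite fe.
pose us := (e - gam)^-1; have us0 : us != 0 by rewrite invr_eq0.
have usE : us * (e - gam) = 1 by rewrite mulVf.
have nus : fr us != us.
  apply: contra ngam => /eqP; rewrite fmorphV => /invr_inj; rewrite rmorphB fe.
  by move/addrI/oppr_inj => ->.
have nt : fr t != t.
  apply: contra We; move: (t) => t' /eqP ft; apply/eqP.
  by rewrite /FigueroaVectors.W /det3 /dot /cross /= !(rmorphM, rmorph1, ft); ring.
have npsi : fr ((e - gam) * t) != (e - gam) * t.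
  apply: contra We; have -> : gam * t = e * t - (e - gam) * t by ring.
  move: ((e - gam) * t) => psi /eqP fpsi; apply/eqP.
  by rewrite /FigueroaVectors.W /det3 /dot /cross /= !(rmorphB, rmorphM, rmorph1, fe, fpsi); ring.
have kE : kap = t * us by rewrite /t /th -mulrA [(e - gam) * us]mulrC usE mulr1.
(* The subplane line [N] passes through [Mv us] and [Av eta], so its image, with pole [x], passes
   through [Mv ks] and [Av eta]. Neither of these is of type III, so both lie ordinarily on the
   image line. *)
pose ks := us + kap; pose eta := - us.
have ksE : ks = us * (1 + t) by rewrite /ks kE; ring.
pose N : vec K := (1, - 1, - e).
have N0 : N != vec0 K by rewrite !xpair_eqE oner_eq0.
have nN : ~~ III N.
  by apply: fixed_nonIII; rewrite /FigueroaVectors.frv /= !rmorphN rmorph1 fe.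
set x := s (pt (sharp N)).
have nA : ~~ III (Av eta).
  apply: (@fixed_orth_nonIII _ fr N) => //.
    by rewrite /FigueroaVectors.frv /= !rmorphN rmorph1 fe.
  transitivity (us * (e - gam) - 1); last by rewrite usE subrr.
  by rewrite /dot /= /eta; ring.
have iA : I (pt (Av eta)) x.
  rewrite -(saxis eta) sI I_cov // dot_pt //; apply/eqP.
  transitivity (us * (e - gam) - 1); last by rewrite usE subrr.
  by rewrite /dot /= /eta; ring.
have iM : I (pt (Mv ks)) x.
  have -> : pt (Mv ks) = s (pt (Mv us)) by rewrite tauP tauE.
  rewrite sI I_cov // dot_pt // /dot /=; apply/eqP.
  by transitivity (1 - us * (e - gam)); [ring | rewrite usE subrr].
have hA : hf (Av eta) (v x) = 0 by move: iA; rewrite -{1}[x]ptv I_pt // Iv_ordl // => /eqP.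
have hM : hf (Mv ks) (v x) = 0 by move: iM; rewrite -{1}[x]ptv I_pt // Iv_ordl // => /eqP.
have WC : W (cross (Av eta) (Mv ks)) != 0.
  have -> : cross (Av eta) (Mv ks) = vsc us (1 + t, - 1, - (e + gam * t)).
    rewrite /cross /vsc /Av /Mv /=; apply: vecE; rewrite ksE /eta; try ring.
    transitivity (- (us * (e - gam)) - gam * (us * (1 + t))); last by ring.
    by rewrite usE; ring.
  rewrite WZ !mulf_neq0 ?fmorph_eq0 //.
  apply: contra We => /eqP w; rewrite -oppr_eq0 -w /FigueroaVectors.W /det3 /dot /cross /=; apply/eqP.
  by rewrite !rmorphN !rmorphD !rmorphM !rmorph1 !fe; ring.
have nAM : ~~ par (Av eta) (Mv ks) by apply: contra WC => /eqP ->; rewrite W_0l.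
have Ix : tIII x.
  rewrite /ProjectiveCoordinates.tIII -(III_sharp cjfr).
  have p : par (cross (Av eta) (Mv ks)) (sharp (v x)) by apply: par_orth; rewrite dotC.
  by rewrite -(III_par fr _ _ p) // sharp_eq0.
(* Such a point is ordinarily on the image line as a combination of two points there, and incident
   with it in the plane as the image of [pv b (us * (1 - b^-1))], a point of [N]. If of type III, it
   is therefore exceptional. *)
have Fp b : b != 0 -> W (1, b, gam) = 0 -> W (1, b * t, us * (b + b * t - 1)) != 0 ->
    pt (vadd (Av eta) (vsc b (Mv ks))) \in [set w | [&& tIII w, hf (v w) (v x) == 0 & I w x]].
  move=> b0 wb wn; set q := vadd _ _.
  have qE : q = pv b (us * (1 - b^-1) + kap).
    rewrite /q /vadd /vsc /pv /=; apply: vecE; rewrite ?mulr0 ?addr0 // /ks /eta; field; exact: b0.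
  have q0 : q != vec0 K by rewrite qE.
  rewrite inE tIII_pt //; apply/and3P; split.
  - rewrite /FigueroaVectors.III; apply: contra wn => /eqP w; rewrite -w qE; apply/eqP.
    have -> : W (pv b (us * (1 - b^-1) + kap)) =
       W (1 - b * t, 1, us * (b + b * t - 1)).
      have -> : pv b (us * (1 - b^-1) + kap) =
          (1 - b * t + e * (us * (b + b * t - 1)), 1, us * (b + b * t - 1)).
        rewrite kE /pv; apply: vecE => //; last by field; exact: b0.
        transitivity (b * 1 + gam * (us * (b + b * t - 1))); first by field; exact: b0.
        transitivity (b - (us * (e - gam)) * (b + b * t - 1) + e * (us * (b + b * t - 1))); first by ring.
        by rewrite usE; ring.
      by rewrite /FigueroaVectors.W /det3 /dot /cross /= !rmorphD !rmorphM !rmorph1 !fe; ring.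
    rewrite /FigueroaVectors.W /det3 /dot /cross /= !rmorphB !rmorphM !rmorphB !rmorphD !rmorphM !rmorph1; ring.
  - have [k k0 ->] := vpt q0.
    by rewrite hfZl hfDl hfZl hA hM mulr0 addr0 mulr0.
  - rewrite qE -tauE -sB // sI I_cov // dot_pt // /dot /=; apply/eqP.
    transitivity (b - (us * (e - gam)) * (b - b / b) - 1); first by ring.
    by rewrite usE mulfV //; ring.
(* A nonzero expression p X - Y has at most one root p, so at least two of the three values 1, [f],
   [g] avoid it. *)
have two X Y : ~ (X = 0 /\ Y = 0) -> exists p1 p2, [/\ p1 != p2, fr p1 = p1 & fr p2 = p2] /\
     [/\ p1 != 0, p2 != 0, p1 * X - Y != 0 & p2 * X - Y != 0].
  move=> nXY; have roots a b : a != b -> a * X - Y = 0 -> b * X - Y != 0.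
    move=> nab ea; apply/eqP => eb; apply: nXY.
    have X0 : X = 0.
      have : (a - b) * X = 0 by rewrite -[RHS](subrr 0) -{1}ea -eb; ring.
      by move/eqP; rewrite mulf_eq0 subr_eq0 (negPf nab) => /eqP.
    by split=> //; move: ea; rewrite X0 mulr0 sub0r => /eqP; rewrite oppr_eq0 => /eqP.
  have [z1|n1] := eqVneq (1 * X - Y) 0.
    by exists f, g; split; split=> //; apply: (roots 1); rewrite // eq_sym.
  have [zf|nf] := eqVneq (f * X - Y) 0.
    exists 1, g; split; split; rewrite ?rmorph1 ?oner_eq0 //; first by rewrite eq_sym.
    exact: (roots f).
  by exists 1, f; split; split; rewrite ?rmorph1 ?oner_eq0 // eq_sym.
pose X1 := W (1, t, us * t) + W (1, t, us); pose Y1 := W (1, t, us).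
have [|p1 [p2 [[n12 fp1 fp2] [p10 p20 w1 w2]]]] := two X1 Y1.
  case=> e1 e2; apply: (W_stable nt nus) => //.
  by rewrite -[RHS]e1 /X1 -/Y1 e2 addr0.
pose psi := (e - gam) * t; have tE : us * psi = t by rewrite /psi mulrA usE mul1r.
pose X2 := W (1, psi, t); pose Y2 := W (1, psi, us).
have [|p3 [_ [[_ fp3 _] [p30 _ w3 _]]]] := two X2 Y2.
  by case=> e1 e2; apply: (W_stable npsi nus) => //; rewrite tE.
have WF b : fr b = b -> W (1, b, gam) = 0.
  by move=> fb; rewrite /FigueroaVectors.W /det3 /dot /cross /= !fb !rmorph1; ring.
have m1 p : fr p = p -> p != 0 -> p * X1 - Y1 != 0 ->
   pt (vadd (Av eta) (vsc p (Mv ks))) \in [set w | [&& tIII w, hf (v w) (v x) == 0 & I w x]].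
  move=> fp pn w; apply: Fp => //; first exact: WF.
  have -> : W (1, p * t, us * (p + p * t - 1)) = p * (p * X1 - Y1).
    rewrite /X1 /Y1 /FigueroaVectors.W /det3 /dot /cross /=.
    by rewrite !(rmorphM, rmorphB, rmorphD, rmorph1, fp); ring.
  by rewrite mulf_neq0.
(* The third exceptional point has its parameter in the span of 1 and [gam] but outside the fixed
   field, so it differs from the first two. *)
have m3 : pt (vadd (Av eta) (vsc (p3 * (e - gam)) (Mv ks))) \in
    [set w | [&& tIII w, hf (v w) (v x) == 0 & I w x]].
  apply: Fp; first by rewrite mulf_neq0.
    rewrite /FigueroaVectors.W /det3 /dot /cross /= !(rmorphM, rmorphB, fp3, fe, rmorph1); ring.
  have -> : us * (p3 * (e - gam) + p3 * (e - gam) * t - 1) = p3 + p3 * t - us.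
    transitivity ((us * (e - gam)) * (p3 + p3 * t) - us); first by ring.
    by rewrite usE; ring.
  have -> : W (1, p3 * (e - gam) * t, p3 + p3 * t - us) = p3 * (p3 * X2 - Y2).
    rewrite /X2 /Y2 /psi /FigueroaVectors.W /det3 /dot /cross /=.
    by rewrite !(rmorphM, rmorphB, rmorphD, rmorph1, fp3); ring.
  by rewrite mulf_neq0.
have := exceptional_le2 Ix; rewrite leqNgt => /negP[].
apply/card_gt2P; exists (pt (vadd (Av eta) (vsc p1 (Mv ks)))),
  (pt (vadd (Av eta) (vsc p2 (Mv ks)))), (pt (vadd (Av eta) (vsc (p3 * (e - gam)) (Mv ks)))).
have nq b : vadd (Av eta) (vsc b (Mv ks)) != vec0 K.
  by rewrite /vadd /vsc !xpair_eqE /= mulr0 addr0 oner_eq0 andbF.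
have dst b b' : b != b' -> pt (vadd (Av eta) (vsc b (Mv ks))) != pt (vadd (Av eta) (vsc b' (Mv ks))).
  move=> nb; rewrite pt_inj // /par.
  have -> : cross (vadd (Av eta) (vsc b (Mv ks))) (vadd (Av eta) (vsc b' (Mv ks))) =
     vsc (b' - b) (cross (Av eta) (Mv ks)) by vr.
  by rewrite vsc_eq0 -/(par _ _) (negPf nAM) orbF subr_eq0 eq_sym.
have nF p : fr p = p -> p != p3 * (e - gam).
  move=> fp; apply: contra nus => /eqP ep.
  have -> : us = p3 / p by rewrite ep invfM mulrA mulfV // mul1r.
  by rewrite fmorph_div fp3 fp.
split; first by split; [exact: m1 | exact: m1 | exact: m3].
by split; [exact: dst | apply: dst; exact: nF | rewrite eq_sym; apply: dst; exact: nF].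
Qed.

End TypeII.

End Elations.

(** * Elations with centre of type III *)

Lemma card_roots_lt (K : finFieldType) (p : {poly K}) : p != 0 ->
  (#|[set t | root p t]| < size p)%N.
Proof.
move=> p0; rewrite cardE; apply: max_poly_roots => //; last exact: enum_uniq.
by apply/allP => t; rewrite mem_enum inE.
Qed.

Lemma leq_card_inj (T T' : finType) (A : {set T}) (B : {set T'}) (f : T -> T') :
  {in A &, injective f} -> {in A, forall x, f x \in B} -> (#|A| <= #|B|)%N.
Proof.
move=> fi fAB; rewrite -(card_in_imset fi); apply/subset_leq_card/subsetP => y.
by case/imsetP=> x xA ->; apply: fAB.
Qed.

Lemma vadd_eq0 (K : fieldType) k (u w : vec K) :
  vadd u (vsc k w) = vec0 K -> u = vsc (- k) w.
Proof.
case: u w => [[a b] c] [[x y] z] [] /= e1 e2 e3; apply: vecE => /=; apply/eqP;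
  by rewrite mulNr -addr_eq0 ?e1 ?e2 ?e3.
Qed.

Section TypeIII.

Variables (K : finFieldType) (T : finType) (v : T -> vec K) (x0 : T).
Hypothesis v_neq0 : forall x, v x != vec0 K.
Hypothesis v_surj : forall u : vec K, u != vec0 K -> exists x, par (v x) u.
Hypothesis v_inj : forall x y, par (v x) (v y) -> x = y.
Variables fr cj : {rmorphism K -> K}.
Hypothesis fr3 : forall x, fr (fr (fr x)) = x.
Hypothesis cj2 : forall x, cj (cj x) = x.
Hypothesis cjfr : forall x, cj (fr x) = fr (cj x).
Variable r : nat.
Hypothesis r_gt1 : (1 < r)%N.
Hypothesis frE : forall x, fr x = x ^+ r.
Hypothesis cardK : #|K| = (r ^ 3)%N.

Local Notation III := (III fr).
Local Notation star := (star fr).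
Local Notation sharp := (sharp cj).
Local Notation hf := (hf cj).
Local Notation frv := (frv fr).
Local Notation W := (W fr).
Local Notation Iv := (Iv fr cj).
Local Notation pt := (pt v x0).
Local Notation tIII := (tIII v fr).
Local Notation inD := (inD v fr).
Local Notation I := (I v fr cj).
Local Notation Dpts := (Dpts v fr).
Local Notation jn := (jn I).

Let Isym : symmetric I. Proof. exact: I_symm. Qed.
Let Iuniq x y a b : x != y -> I x a -> I y a -> I x b -> I y b -> a = b.
Proof. exact: I_unique. Qed.
Let K_gt1 : (1 < #|K|)%N.
Proof. by rewrite cardK -(exp1n 3) ltn_exp2r. Qed.
Let cpol y : #|[set x | I x y]| = #|K|.+1. Proof. exact: card_polI. Qed.
Let cT : #|T| = (#|K| ^ 2 + #|K| + 1)%N. Proof. exact: (card_points x0). Qed.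

Let jP x y : x != y -> I x (jn x y) && I y (jn x y).
Proof. by apply: (jnP (n := #|K|)). Qed.

Let jE x y a : x != y -> I x a -> I y a -> jn x y = a.
Proof. by move=> nxy xa ya; have /andP[h1 h2] := jP nxy; apply: (Iuniq nxy). Qed.

Let I_nonIIIl x y : ~~ tIII x -> I x y = (hf (v x) (v y) == 0).
Proof. by move=> nx; rewrite /ProjectiveCoordinates.I Iv_ordl. Qed.

Let card_nonIII y : tIII y -> #|[set x | I x y & ~~ tIII x]| = #|Dpts|.
Proof.
move=> Iy; have Is : III (sharp (v y)) by rewrite III_sharp.
rewrite -(@card_nonIII_orth _ _ v x0 v_neq0 v_surj v_inj fr _ Is).
apply: eq_card => x; rewrite !inE; case nx: (tIII x) => /=; first by rewrite andbF.
by rewrite andbT I_nonIIIl ?nx // /FigueroaVectors.hf dotC.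
Qed.

(** * Types of the points on a type II line *)

Section LineII.

Variable y : T.
Hypothesis ny : ~~ tIII y.
Hypothesis nDy : ~~ inD y.

Let w := sharp (v y).
Let w0 : w != vec0 K. Proof. by rewrite sharp_eq0. Qed.

(** [d] is a subplane point of the line and [u] another point on it. If the determinant vanished,
    the joins of [d] with the conjugates of [u] would coincide and the line would be fixed. *)
Let base : exists d u, [/\ frv d = d, ~~ par u d, dot w u = 0, dot w d = 0 &
  det3 d (frv u) (frv (frv u)) != 0].
Proof.
have nw : ~~ III w by rewrite III_sharp.
have [d [d0 fd ed]] := nonIII_fixed_orth nw.
have [u1 [u2 [e1 e2 n12]]] := orth2_ex w0.
have [u [eu nu]] : exists u, dot w u = 0 /\ ~~ par u d.
  have [p1|] := boolP (par u1 d); last by exists u1; rewrite dotC.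
  exists u2; rewrite dotC; split=> //; apply: contra n12 => p2.
  by apply: par_trans d0 p1 _; rewrite par_sym.
exists d, u; split; rewrite // ?(dotC w d) //; apply/eqP => z.
case/negP: nDy; rewrite /ProjectiveCoordinates.inD -(sharp_par cj) sharp_frv // -/w -(frv_par fr).
have p : par w (cross u d) by rewrite par_sym; apply: par_orth; rewrite // dotC.
have cu : cross u d != vec0 K by [].
have cr1 : cross (frv u) d = frv (cross u d) by rewrite frv_cross fd.
have cr2 : cross (frv (frv u)) d = frv (frv (cross u d)) by rewrite !frv_cross !fd.
have fp : par (frv w) (cross (frv u) d) by rewrite cr1 frv_par.
have fp2 : par (frv (frv w)) (cross (frv (frv u)) d) by rewrite cr2 !frv_par.
have c1 : cross (frv u) d != vec0 K by rewrite cr1 frv_eq0.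
have c2 : cross (frv (frv u)) d != vec0 K by rewrite cr2 !frv_eq0.
apply: par_trans c1 fp _; apply: (@par_trans _ (cross (frv (frv u)) d)) => //; last by rewrite par_sym.
apply/eqP; have -> : cross (cross (frv u) d) (cross (frv (frv u)) d) =
   vsc (det3 d (frv u) (frv (frv u))) d by vr.
by rewrite z vsc0.
Qed.

Let on_line x : ~~ tIII x \/ tIII x -> I x y -> dot w (v x) = 0.
Proof. by move=> _; rewrite /ProjectiveCoordinates.I Iv_ordr // => /eqP; rewrite /FigueroaVectors.hf dotC. Qed.

(** On the points u + t d with [d] fixed, terms of [W] containing [d] twice vanish, so [W] is a
    polynomial in t of degree at most r^2 with nonzero linear coefficient. The extra 1 is for [d]
    itself. *)
Lemma card_nonIII_line2 : (#|[set x | I x y & ~~ tIII x]| <= r ^ 2 + 1)%N.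
Proof.
have [d [u [fd nu eu ed dn]]] := base; have d0 := line_u2 nu.
pose B := det3 d (frv u) (frv (frv u)).
pose p : {poly K} := (W u)%:P + B *: 'X + fr B *: 'X^r + fr (fr B) *: 'X^(r ^ 2).
have r1 : (1 < r ^ 2)%N by rewrite -(exp1n 2) ltn_exp2r.
have pE t : W (vadd u (vsc t d)) = p.[t].
  rewrite /p !hornerE -mulnn exprM -!frE /B !fr_det3 !fd !frv3 //.
  rewrite /FigueroaVectors.W !frvD !frvZ !fd; move: (frv u) (frv (frv u)) (fr t) (fr (fr t)).
  by move=> u' u'' t' t''; vr.
have pn : p != 0.
  apply/eqP => /(congr1 (fun p : {poly K} => p`_1)).
  rewrite /p !coefD !coefZ coefC coefX !coefXn coef0 (ltn_eqF r_gt1) (ltn_eqF r1) /=.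
  by rewrite !mulr0 mulr1 add0r !addr0; apply/eqP.
have sp : (size p <= r ^ 2 + 1)%N.
  rewrite addn1 /p.
  have hs a k : (k <= r ^ 2)%N -> (size (a *: 'X^k : {poly K}) <= (r ^ 2).+1)%N.
    by move=> hk; apply: leq_trans (size_scale_leq _ _) _; rewrite size_polyXn.
  have hX : (size (B *: 'X) <= (r ^ 2).+1)%N.
    by apply: leq_trans (size_scale_leq _ _) _; rewrite size_polyX ltnW.
  rewrite !(leq_trans (size_polyD _ _)) // geq_max; apply/andP; split; last exact: hs.
  rewrite (leq_trans (size_polyD _ _)) // geq_max; apply/andP; split; last first.
    by apply: hs; rewrite -mulnn leq_pmulr // ltnW.
  rewrite (leq_trans (size_polyD _ _)) // geq_max hX andbT.
  by rewrite (leq_trans (size_polyC_leq1 _)).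
rewrite addn1; apply: leq_trans (_ : #|None |: (Some @: [set t | root p t])| <= _)%N; last first.
  rewrite cardsU1 -add1n; apply: leq_add; first by case: (_ \notin _).
  rewrite card_imset; last exact: Some_inj.
  by rewrite -ltnS; apply: leq_trans (card_roots_lt pn) _; rewrite -addn1.
apply: (@leq_trans #|line_pt v x0 u d @: (None |: (Some @: [set t | root p t]))|); last first.
  exact: leq_imset_card.
apply/subset_leq_card/subsetP => x; rewrite !inE => /andP[xy nx].
have [t xE] := line_ptP x0 v_surj v_inj w0 nu eu ed (on_line (or_introl nx) xy).
apply/imsetP; exists t => //; case: t xE => [t|] xE; last by rewrite setU11.
apply/setU1P; right; apply: imset_f; rewrite inE /root -pE.
have un := line_u12 nu t; move: nx; rewrite xE /= /ProjectiveCoordinates.tIII (III_par fr (v_neq0 _) un); last exact: ptP.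
by rewrite /FigueroaVectors.III negbK.
Qed.

(** The star of u + t d is a combination of 1, t^r and t^(r^2) whose three vector coefficients are
    independent, so the value of [f] on it is a nonzero polynomial. *)
Lemma card_III_line2 f : f != vec0 K ->
  (#|[set x | [&& I x y, tIII x & dot f (star (v x)) == 0%R]]| <= r ^ 2)%N.
Proof.
move=> f0; have [d [u [fd nu eu ed dn]]] := base; have d0 := line_u2 nu.
pose a0 := dot f (star u); pose a1 := dot f (cross d (frv (frv u))).
pose a2 := dot f (cross (frv u) d).
pose p : {poly K} := a0%:P + a1 *: 'X^r + a2 *: 'X^(r ^ 2).
have r1 : (1 < r ^ 2)%N by rewrite -(exp1n 2) ltn_exp2r.
have pE t : dot f (star (vadd u (vsc t d))) = p.[t].
  rewrite /p !hornerE -mulnn exprM -!frE /a0 /a1 /a2.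
  rewrite /FigueroaVectors.star !frvD !frvZ !fd; move: (frv u) (frv (frv u)) (fr t) (fr (fr t)).
  by move=> u' u'' t' t''; vr.
have pn : p != 0.
  apply/eqP => p0; case/negP: f0; apply/eqP.
  have c i : p`_i = 0 by rewrite p0 coef0.
  have nr2 : (r == r ^ 2)%N = false by apply/eqP => e; have := r_gt1; rewrite -(ltn_pmul2l (ltnW r_gt1)) mulnn muln1 -e ltnn.
  have z0 : a0 = 0.
    have := c 0%N; rewrite /p !coefD !coefZ coefC !coefXn (ltn_eqF (ltnW r_gt1)) (ltn_eqF (ltnW r1)) /=.
    by rewrite !mulr0 !addr0.
  have z1 : a1 = 0.
    have := c r; rewrite /p !coefD !coefZ coefC !coefXn eqxx nr2 (gtn_eqF (ltnW r_gt1)) /=.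
    by rewrite mulr0 mulr1 add0r addr0.
  have z2 : a2 = 0.
    have := c (r ^ 2)%N; rewrite /p !coefD !coefZ coefC !coefXn eqxx [(_ == r)%N]eq_sym nr2.
    by rewrite (gtn_eqF (ltnW r1)) /= mulr0 mulr1 !add0r.
  apply: (@det3_orth _ (star u) (cross d (frv (frv u))) (cross (frv u) d)) => //.
  rewrite /FigueroaVectors.star; have -> : det3 (cross (frv u) (frv (frv u))) (cross d (frv (frv u)))
     (cross (frv u) d) = det3 d (frv u) (frv (frv u)) ^+ 2 by vr.
  by rewrite expf_eq0.
have sp : (size p <= (r ^ 2).+1)%N.
  have hs a k : (k <= r ^ 2)%N -> (size (a *: 'X^k : {poly K}) <= (r ^ 2).+1)%N.
    by move=> hk; apply: leq_trans (size_scale_leq _ _) _; rewrite size_polyXn.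
  rewrite /p (leq_trans (size_polyD _ _)) // geq_max; apply/andP; split; last exact: hs.
  rewrite (leq_trans (size_polyD _ _)) // geq_max; apply/andP; split; last first.
    by apply: hs; rewrite -mulnn leq_pmulr // ltnW.
  by rewrite (leq_trans (size_polyC_leq1 _)).
rewrite -ltnS; apply: leq_trans sp; apply: leq_ltn_trans (card_roots_lt pn).
apply: leq_trans (_ : #|(fun t => line_pt v x0 u d (Some t)) @: [set t | root p t]| <= _)%N;
  last exact: leq_imset_card.
apply/subset_leq_card/subsetP => x; rewrite !inE => /and3P[xy Ix /eqP fx].
have [t xE] := line_ptP x0 v_surj v_inj w0 nu eu ed (on_line (or_intror Ix) xy).
case: t xE => [t|] xE; last first.
  move: Ix; rewrite xE /= /ProjectiveCoordinates.tIII (III_par fr (v_neq0 _) d0); last exact: ptP.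
  by rewrite (negPf (fixed_nonIII fd)).
apply/imsetP; exists t => //; rewrite inE /root -pE.
have un := line_u12 nu t; have [k k0 e] := v_pt x0 v_neq0 v_surj un.
move: fx; rewrite xE /= e starZ dotZr => /eqP; rewrite !mulf_eq0 !fmorph_eq0.
by rewrite (negPf k0).
Qed.

End LineII.

(** * Centre of type III, with r at least 8 *)

Section Elation.

Variables (s : {perm T}) (c : T).
Hypothesis sE : pol_elation I s c.
Hypothesis cc : I c c.
Hypothesis Ic : tIII c.
Hypothesis s_neq1 : s != 1%g.
Hypothesis r_ge8 : (8 <= r)%N.
Hypothesis cardD : #|Dpts| = (r ^ 2 + r + 1)%N.

Let sI : I_aut I s := proj1 sE.
Let sc : s c = c. Proof. exact: (proj2 sE). Qed.
Let fix_out z : ~~ I z c -> s z != z.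
Proof.
move=> nz; apply: contra s_neq1 => /eqP sz; apply/eqP.
exact: (elation_fix x0 v_neq0 v_surj v_inj fr3 cj2 cjfr K_gt1 cc sE nz sz).
Qed.

Let C := star (v c).
Let C0 : C != vec0 K. Proof. exact: star_neq0. Qed.
Let hCC : hf C C = 0.
Proof. by move: cc; rewrite /ProjectiveCoordinates.I /FigueroaVectors.Iv -!/(tIII _) Ic /= => /eqP. Qed.

Let I_III x y : tIII x -> tIII y -> I x y = (hf (star (v x)) (star (v y)) == 0).
Proof. by rewrite /ProjectiveCoordinates.I /FigueroaVectors.Iv -!/(tIII _) => -> ->. Qed.

Let good x := [&& tIII x, tIII (s x), tIII (jn x c) & ~~ I x c].

(** On stars [s] looks like a transvection with centre [C], but the parameter [l] may depend on the
    point. *)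
Let lam_rel x l := exists2 a, a != 0 &
  star (v (s x)) = vsc a (vadd (star (v x)) (vsc (l * hf (star (v x)) C) C)).

(** The points [x], [s x] and [c] lie on a common line whose pole is of type III, so their stars are
    orthogonal to one vector and hence dependent. *)
Let good_lam x : good x -> exists l, lam_rel x l.
Proof.
case/and4P=> Ix Isx Ik nx; set X := star (v x); set X1 := star (v (s x)).
have nxc : x != c by apply: contraNneq nx => ->.
have /andP[xk ck] := jP nxc; set k := jn x c in Ik xk ck.
have sk : s k = k by apply: (proj2 sE); rewrite Isym.
have hX : hf X (star (v k)) = 0 by apply/eqP; rewrite -I_III.
have hC : hf C (star (v k)) = 0 by apply/eqP; rewrite -I_III.
have hX1 : hf X1 (star (v k)) = 0 by apply/eqP; rewrite -I_III // -sk sI.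
have hXC : hf X C != 0 by rewrite -I_III.
have hX1C : hf X1 C != 0 by rewrite -I_III // -sc sI.
have nXC : ~~ par X C.
  by apply: contra hXC => /(par_ex C0)[m ->]; rewrite hfZl hCC mulr0.
have k0 : sharp (star (v k)) != vec0 K by rewrite sharp_eq0 star_neq0.
have [a [b e]] : exists a b, X1 = vadd (vsc a X) (vsc b C).
  by apply: (span2 nXC (w := sharp (star (v k)))) => //; rewrite dotC.
have a0 : a != 0.
  by apply: contraNneq hX1C => a0; rewrite e a0 hfDl !hfZl hCC mulr0 mul0r addr0.
exists (b / a / hf X C); exists a => //; rewrite -/X1 -/X e divfK //.
by rewrite /vadd /vsc /=; apply: vecE; field; exact: a0.
Qed.

(** Incidence before and after applying [s] leaves only the two mixed terms of the form, and these
    must cancel. *)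
Let lam_inc x j l m : good x -> good j -> I x j -> lam_rel x l -> lam_rel j m ->
  l = - cj m.
Proof.
case/and4P=> Ix Isx _ nx /and4P[Ij Isj _ nj] xj [a a0 ea] [b b0 eb].
have hXJ : hf (star (v x)) (star (v j)) = 0 by apply/eqP; rewrite -I_III.
have : hf (star (v (s x))) (star (v (s j))) = 0 by apply/eqP; rewrite -I_III // sI.
have nX : hf (star (v x)) C != 0 by rewrite -I_III.
have nJ : hf (star (v j)) C != 0 by rewrite -I_III.
rewrite ea eb hfZl hfZr => /eqP; rewrite !mulf_eq0 fmorph_eq0 (negPf a0) (negPf b0) /=.
rewrite !hfDl !hfDr !hfZl !hfZr hCC hXJ (hfC cj2 (star (v j)) C) rmorphM => /eqP h.
apply/eqP; rewrite -addr_eq0; apply/eqP.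
apply: (mulfI (_ : hf (star (v x)) C * cj (hf (star (v j)) C) != 0)).
  by rewrite mulf_neq0 // fmorph_eq0.
by rewrite mulr0 -[RHS]h; ring.
Qed.

Let jn_inj a b : ~~ I b a -> {in [set x | I x a] &, injective (fun x => jn x b)}.
Proof.
move=> nba x x'; rewrite !inE => xa x'a e; apply/eqP; apply: contraT => nxx'.
have nx z : I z a -> z != b by move=> za; apply: contraNneq nba => <-.
have /andP[xk bk] := jP (nx _ xa); have /andP[x'k _] := jP (nx _ x'a).
by case/negP: nba; rewrite (Iuniq nxx' xa x'a xk) // e.
Qed.

Let jn_pol a b x : ~~ I b a -> I x a -> I (jn x b) b.
Proof.
move=> nba xa; have nx : x != b by apply: contraNneq nba => <-.
by rewrite Isym; case/andP: (jP nx).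
Qed.

Let card_meet a b : a != b -> (#|[set x | I x a & I x b]| <= 1)%N.
Proof.
move=> nab; apply: leq_trans (joins_le1 Iuniq nab).
by apply/subset_leq_card/subsetP => x; rewrite !inE ![I x _]Isym.
Qed.

Lemma typeIII_false : False.
Proof.
have e10 : (1, 0, 0) != vec0 K by rewrite !xpair_eqE oner_eq0.
have fe1 : frv (1, 0, 0) = (1, 0, 0) by rewrite /FigueroaVectors.frv /= rmorph0 rmorph1.
pose P := pt (1, 0, 0).
have DP : inD P by apply: inD_pt.
have D_nonIII x y : inD x -> I x y -> ~~ tIII y.
  move=> Dx; rewrite I_nonIIIl; last exact: inD_nonIII.
  have [d [d0 fd pd]] := fixed_vec (v_neq0 x) Dx.
  rewrite /FigueroaVectors.hf dotC (par_dot _ (v_neq0 x) d0 pd) dotC => /eqP h.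
  by rewrite /ProjectiveCoordinates.tIII -(III_sharp cjfr); apply: fixed_orth_nonIII h.
have nPc : ~~ I P c by apply/negP => /(D_nonIII _ _ DP); rewrite Ic.
have nP : P != c by apply: contraTneq Ic => <-; apply: inD_nonIII.
set P1 := s P; have nDP1 : ~~ inD P1.
  apply/negP => DP1; have /andP[Pk ck] := jP nP; set k := jn P c in Pk ck.
  have sk : s k = k by apply: (proj2 sE); rewrite Isym.
  have P1k : I P1 k by rewrite -sk sI.
  have [d1 [d10 fd1 pd1]] := fixed_vec (v_neq0 P) DP.
  have [d2 [d20 fd2 pd2]] := fixed_vec (v_neq0 P1) DP1.
  have n12 : ~~ par d1 d2.
    apply: contra (fix_out nPc) => p; rewrite -/P1 eq_sym (v_eq_par v_inj).
    by apply: par_trans d10 pd1 _; apply: par_trans d20 p _; rewrite par_sym.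
  have h x d : inD x -> d != vec0 K -> par (v x) d -> I x k -> dot (sharp (v k)) d = 0.
    move=> Dx d0 p; rewrite I_nonIIIl ?inD_nonIII // /FigueroaVectors.hf dotC.
    by rewrite (par_dot _ (v_neq0 x) d0 p) => /eqP.
  have pk : par (cross d1 d2) (sharp (v k)).
    by apply: par_orth; [apply: (h P) | apply: (h P1)].
  have Dk : inD k.
    rewrite /ProjectiveCoordinates.inD -(sharp_par cj) sharp_frv //.
    have pk' : par (sharp (v k)) (cross d1 d2) by rewrite par_sym.
    have fz : frv (cross d1 d2) = cross d1 d2 by rewrite frv_cross fd1 fd2.
    by apply: par_trans n12 pk' _; rewrite -fz frv_par.
  by move: (D_nonIII k c Dk); rewrite Isym ck Ic => /(_ isT).
have bigr : (2 * (r ^ 2 + r + 1) + 2 < r ^ 3)%N.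
  have h8 := leq_mul r_ge8 (leqnn (r * r)%N); have h9 := leq_mul r_ge8 (leqnn r).
  rewrite !expnS !expn0 !muln1; move: r_ge8 h8 h9; clear; lia.
have c1 : (#|Dpts| < #|[set y | I y P1 & tIII y]|)%N.
  have := cpol P1; rewrite -(cardsID [set y | tIII y]).
  have -> : [set x | I x P1] :&: [set y | tIII y] = [set y | I y P1 & tIII y].
    by apply/setP => z; rewrite !inE.
  have -> : [set x | I x P1] :\: [set y | tIII y] = [set y | I y P1 & ~~ tIII y].
    by apply/setP => z; rewrite !inE andbC.
  have : (#|[set y | I y P1 & ~~ tIII y]| <= r ^ 2 + r + 1)%N.
    have [IP1|nP1] := boolP (tIII P1); first by rewrite card_nonIII // cardD.
    by apply: leq_trans (card_nonIII_line2 nP1 nDP1) _; rewrite leq_add2r leq_addr.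
  rewrite cardD cardK; move: bigr.
  by move: #|_| #|_| (r ^ 2)%N (r ^ 3)%N => a b r2 r3; clear; lia.
(* The image point [P1] carries more than [#|Dpts|] type III lines, so one of them comes from a line
   through [P] outside the subplane. That line is of type II, while its image is of type III. *)
have [l [lP Isl nDl]] : exists l, [/\ I l P, tIII (s l) & ~~ inD l].
  have [/exists_inP[l]|none] := boolP [exists l in [set l | I l P & tIII (s l)], ~~ inD l].
    by rewrite inE => /andP[h1 h2] h3; exists l.
  move: c1; rewrite ltnNge => /negP[].
  apply: (leq_card_inj (f := (s^-1)%g)); first by move=> ? ? _ _; apply: perm_inj.
  move=> y; rewrite inE => /andP[yP Iy]; rewrite inE.
  move: none; rewrite negb_exists_in => /forall_inP/(_ ((s^-1)%g y)).
  by rewrite inE -sI permKV yP Iy negbK; apply.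
have nl : ~~ tIII l by apply: (D_nonIII P) => //; rewrite Isym.
have ncl : ~~ I c l.
  by apply: contra nl => cl; rewrite -[l](proj2 sE) // Isym.
have ncl' : l != c by apply: contraNneq nl => ->.
have [k [kc Ik nkc]] : exists k, [/\ I k c, tIII k & k != c].
  have : (1 < #|[set x | I x c & tIII x]|)%N.
    have := cpol c; rewrite -(cardsID [set y | tIII y]).
    have -> : [set x | I x c] :&: [set y | tIII y] = [set y | I y c & tIII y].
      by apply/setP => z; rewrite !inE.
    have -> : [set x | I x c] :\: [set y | tIII y] = [set y | I y c & ~~ tIII y].
      by apply/setP => z; rewrite !inE andbC.
    rewrite card_nonIII // cardD cardK; move: bigr.
    by move: #|_| (r ^ 2)%N (r ^ 3)%N => a r2 r3; clear; lia.
  case/card_gt1P=> a [b []]; rewrite !inE => /andP[ac Ia] /andP[bc Ib] nab.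
  by have [e|n] := eqVneq a c; [exists b; split=> //; rewrite -e eq_sym | exists a].
have sk : s k = k by apply: (proj2 sE).
have nonIII_s z : tIII (s z) -> (#|[set x | I x z & ~~ tIII (s x)]| <= #|Dpts|)%N.
  move=> Isz; rewrite -(card_nonIII Isz); apply: (leq_card_inj (f := s)).
    by move=> ? ? _ _; apply: perm_inj.
  by move=> x; rewrite !inE sI.
have cU (A B : {set T}) a b : (#|A| <= a)%N -> (#|B| <= b)%N -> (#|A :|: B| <= a + b)%N.
  by move=> hA hB; apply: leq_trans (leq_card_setU _ _) (leq_add hA hB).
(* [y] is an auxiliary good point off the line [l]. Choosing it on a line through [c] with type III
   pole [k] secures the condition on [jn y c]. *)
have [y [yk Iy Isy nyc nyl]] :
    exists y, [/\ I y k, tIII y, tIII (s y), ~~ I y c & ~~ I y l].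
  pose G := [set y | [&& I y k, tIII y, tIII (s y), ~~ I y c & ~~ I y l]].
  have : (0 < #|G|)%N.
    have := cpol k; have sub : [set x | I x k] \subset
      G :|: [set x | I x k & ~~ tIII x] :|: [set x | I x k & ~~ tIII (s x)]
        :|: [set x | I x k & I x c] :|: [set x | I x k & I x l].
      apply/subsetP => x; rewrite !inE => ->.
      by case: (tIII x); case: (tIII (s x)); case: (I x c); case: (I x l).
    have nkl : k != l by apply: contraNneq nl => <-.
    have b1 := card_meet nkc; have b2 := card_meet nkl.
    have b3 := nonIII_s k; rewrite sk in b3; have {}b3 := b3 Ik.
    have b4 := card_nonIII Ik.
    have h := cU _ _ _ _ (cU _ _ _ _ (cU _ _ _ _ (cU _ _ _ _ (leqnn #|G|) (eq_leq b4)) b3) b1) b2.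
    have {h} := leq_trans (subset_leq_card sub) h; rewrite cpol cardK cardD.
    move: bigr; move: (r ^ 2)%N (r ^ 3)%N #|G| => r2 r3 m1.
    by clear; lia.
  by case/card_gt0P=> y; rewrite inE => /and5P[]; exists y.
have nyc' : y != c by apply: contraNneq nyc => ->.
have gy : good y.
  by rewrite /good Iy Isy nyc (jE nyc' yk) ?Ik // Isym.
have [lam Ly] := good_lam gy.
pose V := [set x | [&& I x l, good x & good (jn x y)]].
(* Passing from [x] to its join with [y] and on to [y] applies [lam_inc] twice, so all points of [V]
   share the parameter [lam] of [y]. Incidence of [s x] with the type III line [s l] then becomes
   one linear condition [f] on the star of [x]. *)
have Vle : (#|V| <= r ^ 2)%N.
  pose L1 := star (v (s l)).
  pose f := vadd (sharp L1) (vsc (lam * hf C L1) (sharp C)).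
  have f0 : f != vec0 K.
    apply: contra ncl' => /eqP f0; rewrite -(inj_eq (@perm_inj _ s)) sc (v_eq_par v_inj).
    have pl : par L1 C.
      rewrite -(sharp_par cj); have -> : sharp L1 = vsc (- (lam * hf C L1)) (sharp C).
        exact: vadd_eq0.
      exact: par_vsc.
    have := star_par fr pl (star_neq0 fr3 Isl) C0; rewrite !star_star //.
    by rewrite parZl // parZr.
  apply: leq_trans (card_III_line2 nl nDl f0).
  apply/subset_leq_card/subsetP => x; rewrite !inE => /and3P[xl gx gj].
  have [Ix Isx _ nx] := and4P gx; rewrite xl Ix /=.
  have nxy : x != y by apply: contraNneq nyl => <-.
  have /andP[xj yj] := jP nxy.
  have [lx Lx] := good_lam gx; have [lj Lj] := good_lam gj.
  have el : lx = lam by rewrite (lam_inc gx gj xj Lx Lj) (lam_inc gy gj yj Ly Lj).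
  case: Lx => a a0 ea; have : hf (star (v (s x))) L1 = 0 by apply/eqP; rewrite -I_III // sI.
  rewrite ea hfZl hfDl hfZl el => /eqP; rewrite mulf_eq0 (negPf a0) /= => /eqP h.
  apply/eqP; rewrite -[RHS]h /f dotC dotDr dotZr /FigueroaVectors.hf; ring.
(* Every other point of [l] violates one condition in [good x] or [good (jn x y)]. Each violation is
   counted by an injective map to a line through suitable projections from [c] and [y]. *)
have sub : [set x | I x l] \subset V
   :|: [set x | I x l & ~~ tIII x] :|: [set x | I x l & ~~ tIII (s x)]
   :|: [set x | I x l & ~~ tIII (jn x c)] :|: [set x | I x l & I x c]
   :|: [set x | I x l & ~~ tIII (jn x y)] :|: [set x | I x l & ~~ tIII (s (jn x y))]
   :|: [set x | I x l & ~~ tIII (jn (jn x y) c)] :|: [set x | I x l & I (jn x y) c].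
  apply/subsetP => x; rewrite !inE /good => ->.
  case: (tIII x); case: (tIII (s x)); case: (tIII (jn x c)); case: (I x c) => //=.
  by case: (tIII (jn x y)); case: (tIII (s (jn x y))); case: (tIII (jn (jn x y) c)); case: (I (jn x y) c).
have b1 := card_nonIII_line2 nl nDl.
have b2 := nonIII_s l Isl.
have b3 : (#|[set x | I x l & ~~ tIII (jn x c)]| <= #|Dpts|)%N.
  rewrite -(card_nonIII Ic); apply: (leq_card_inj (f := fun x => jn x c)).
    by move=> x x'; rewrite !inE => /andP[xl _] /andP[x'l _]; apply: (jn_inj ncl); rewrite inE.
  by move=> x; rewrite !inE => /andP[xl ->]; rewrite (jn_pol ncl xl).
have b4 := card_meet ncl'.
have b5 : (#|[set x | I x l & ~~ tIII (jn x y)]| <= #|Dpts|)%N.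
  rewrite -(card_nonIII Iy); apply: (leq_card_inj (f := fun x => jn x y)).
    by move=> x x'; rewrite !inE => /andP[xl _] /andP[x'l _]; apply: (jn_inj nyl); rewrite inE.
  by move=> x; rewrite !inE => /andP[xl ->]; rewrite (jn_pol nyl xl).
have b6 : (#|[set x | I x l & ~~ tIII (s (jn x y))]| <= #|Dpts|)%N.
  rewrite -(card_nonIII Isy); apply: (leq_card_inj (f := fun x => s (jn x y))).
    move=> x x'; rewrite !inE => /andP[xl _] /andP[x'l _] /perm_inj.
    by apply: (jn_inj nyl); rewrite inE.
  by move=> x; rewrite !inE => /andP[xl ->]; rewrite sI (jn_pol nyl xl).
have ncy : ~~ I c y by rewrite Isym.
have b7 : (#|[set x | I x l & ~~ tIII (jn (jn x y) c)]| <= #|Dpts|)%N.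
  rewrite -(card_nonIII Ic); apply: (leq_card_inj (f := fun x => jn (jn x y) c)).
    move=> x x'; rewrite !inE => /andP[xl _] /andP[x'l _] /(jn_inj ncy).
    rewrite !inE !(jn_pol nyl) // => /(_ isT isT); apply: (jn_inj nyl); by rewrite inE.
  by move=> x; rewrite !inE => /andP[xl ->]; rewrite (jn_pol ncy) // (jn_pol nyl xl).
have b8 : (#|[set x | I x l & I (jn x y) c]| <= 1)%N.
  apply: leq_trans (card_meet nyc'); apply: (leq_card_inj (f := fun x => jn x y)).
    by move=> x x'; rewrite !inE => /andP[xl _] /andP[x'l _]; apply: (jn_inj nyl); rewrite inE.
  by move=> x; rewrite !inE => /andP[xl ->]; rewrite (jn_pol nyl xl).
have := subset_leq_card sub; rewrite cpol cardK.
have := cU _ _ _ _ (cU _ _ _ _ (cU _ _ _ _ (cU _ _ _ _ (cU _ _ _ _ (cU _ _ _ _ (cU _ _ _ _ (cU _ _ _ _ Vle b1) b2) b3) b4) b5) b6) b7) b8.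
rewrite cardD => h1 h2; move: (leq_trans h2 h1).
(* The bounds add up to r^3 + 1 <= 7 r^2 + 5 r + 8; since r^3 >= 8 r^2, this would need r^2 < 5 r +
   8. *)
have h8 := leq_mul r_ge8 (leqnn (r * r)%N); have h9 := leq_mul r_ge8 (leqnn r).
rewrite !expnS !expn0 !muln1 => h; move: r_ge8 h8 h9 h; clear; lia.
Qed.

End Elation.

End TypeIII.

(** * The field of order 64 *)

Module F64.

Definition f4 := (bool * bool)%type.
Definition add4 (a b : f4) : f4 := (a.1 (+) b.1, a.2 (+) b.2).
Definition mul4 (a b : f4) : f4 :=
  ((a.1 && b.1) (+) (a.2 && b.2), (a.1 && b.2) (+) (a.2 && b.1) (+) (a.2 && b.2)).
Definition conj4 (a : f4) : f4 := (a.1 (+) a.2, a.2).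

(* The elements of F_64 on the basis 1, z, z^2 over F_4, with z^3 = z + 1; then
   z^4 = z^2 + z and z^8 = z. *)
Definition f64 := (f4 * f4 * f4)%type.
Definition zero : f64 := ((false, false), (false, false), (false, false)).
Definition one : f64 := ((true, false), (false, false), (false, false)).
Definition add (a b : f64) : f64 := (add4 a.1.1 b.1.1, add4 a.1.2 b.1.2, add4 a.2 b.2).
Definition mul (a b : f64) : f64 :=
  let c3 := add4 (mul4 a.1.2 b.2) (mul4 a.2 b.1.2) in
  let c4 := mul4 a.2 b.2 in
  (add4 (mul4 a.1.1 b.1.1) c3,
   add4 (add4 (mul4 a.1.1 b.1.2) (mul4 a.1.2 b.1.1)) (add4 c3 c4),
   add4 (add4 (mul4 a.1.1 b.2) (mul4 a.1.2 b.1.2)) (add4 (mul4 a.2 b.1.1) c4)).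
Definition frob4 (a : f64) : f64 := (a.1.1, add4 a.1.2 a.2, a.1.2).
Definition frob8 (a : f64) : f64 := (conj4 a.1.1, conj4 a.1.2, conj4 a.2).

(* Conditionals instead of boolean connectives, so that call-by-value evaluation
   short-circuits. *)
Definition fb (P : bool -> bool) := if P false then P true else false.
Definition all4 (P : f4 -> bool) := fb (fun a => fb (fun b => P (a, b))).
Definition all64 (P : f64 -> bool) :=
  all4 (fun a => all4 (fun b => all4 (fun c => P (a, b, c)))).

Lemma all64P (P : f64 -> bool) : all64 P -> forall a, P a.
Proof.
have fbP (Q : bool -> bool) : fb Q -> forall b, Q b.
  by rewrite /fb; case E: (Q false) => // ? [].
have all4P (Q : f4 -> bool) : all4 Q -> forall b, Q b.
  by move=> /fbP h [a b]; apply: (fbP (fun b => Q (a, b))).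
move=> /all4P h [[a b] c]; have /all4P h1 := h a; have /all4P h2 := h1 b; exact: h2.
Qed.

Definition bvec := (f64 * f64 * f64)%type.
Definition dotb (u v : bvec) :=
  add (add (mul u.1.1 v.1.1) (mul u.1.2 v.1.2)) (mul u.2 v.2).
Definition crossb (u v : bvec) : bvec :=
  (add (mul u.1.2 v.2) (mul u.2 v.1.2), add (mul u.2 v.1.1) (mul u.1.1 v.2),
   add (mul u.1.1 v.1.2) (mul u.1.2 v.1.1)).
Definition frvb (u : bvec) : bvec := (frob4 u.1.1, frob4 u.1.2, frob4 u.2).
Definition sharpb (u : bvec) : bvec := (frob8 u.2, frob8 u.1.2, frob8 u.1.1).
Definition addsc (u : bvec) (k : f64) (c : bvec) : bvec :=
  (add u.1.1 (mul k c.1.1), add u.1.2 (mul k c.1.2), add u.2 (mul k c.2)).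
Definition starb (u : bvec) := let u' := frvb u in crossb u' (frvb u').
Definition isz4 (a : f4) := if a.1 then false else ~~ a.2.
Definition isz (a : f64) :=
  if isz4 a.1.1 then (if isz4 a.1.2 then isz4 a.2 else false) else false.
Definition absb (u : bvec) :=
  let w := starb u in
  if isz (dotb u w) then false else isz (dotb w (sharpb w)).
(** Tests whether [y], a point that is not of type III, is on the Figueroa join of the type III
    points [p] and [q]. If the ordinary join is of type III, the Figueroa join has as covector the
    star of the join of the two stars. *)
Definition compatb (p q y : bvec) :=
  let l := crossb p q in let w := starb l in
  isz (dotb y (if isz (dotb l w) then l else starb (crossb (starb p) (starb q)))).

Definition P0 : bvec := (one, zero, zero).
Definition omega : f64 := ((false, true), (false, false), (false, false)).
Definition omega2 : f64 := ((true, true), (false, false), (false, false)).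
(** Together with [P0] these are the nine isotropic points of the subplane of order 4. *)
Definition Hs : seq bvec :=
  [:: (zero, zero, one); (one, zero, one); (omega, one, one); (omega2, one, one);
      (omega, omega, one); (omega2, omega, one); (omega, omega2, one);
      (omega2, omega2, one)].

Fixpoint allb (A : Type) (P : A -> bool) (t : seq A) :=
  if t is a :: t' then (if P a then allb P t' else false) else true.
Fixpoint hasb (A : Type) (P : A -> bool) (t : seq A) :=
  if t is a :: t' then (if P a then true else hasb P t') else false.

Definition els4 : seq f4 := [:: (false, false); (false, true); (true, false); (true, true)].
Definition els : seq f64 := 
  [seq (ab, c) | ab <- [seq (a, b) | a <- els4, b <- els4], c <- els4].

(** Candidates for the image of [Q] under an elation with centre [c]: the absolute type III points
    on the line joining them. *)
Definition images (c Q : bvec) : seq bvec :=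
  foldr (fun k t => if isz k then t else
    let q := addsc Q k c in if absb q then q :: t else t) [::] els.

(** The line through [P0] and [Q] meets the axis [m] in a fixed point, which must lie on the join of
    the two images. The check finds, for each candidate image of [P0], a [Q] none of whose
    candidates satisfies this. *)
Definition check_c (c : bvec) :=
  if absb c then
    let m := sharpb c in
    let t := map (fun Q => (crossb (crossb P0 Q) m, images c Q)) Hs in
    allb (fun p => hasb (fun yq => allb (fun q => ~~ compatb p q yq.1) yq.2) t)
      (images c P0)
  else true.

Lemma check1 a b : check_c (one, a, b).
Proof.
suff h : all64 (fun a => all64 (fun b => check_c (one, a, b))) by exact: all64P (all64P h a) b.
by vm_compute.
Qed.

Lemma check2 a : check_c (zero, one, a).
Proof. by apply: (all64P (P := fun a => check_c (zero, one, a))); vm_compute. Qed.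

Lemma check3 : check_c (zero, zero, one).
Proof. by vm_compute. Qed.

(** Nonzero elements of the model have inverses, so that its evaluation in the abstract field is
    injective. *)
Definition invertible := all64 (fun a => (a == zero) || ~~ all64 (fun b => mul a b != one)).

Lemma invertible_true : invertible.
Proof. by vm_compute. Qed.

End F64.

Section Order64.

Import F64.

Variables (K : finFieldType) (T : finType) (v : T -> vec K) (x0 : T).
Hypothesis v_neq0 : forall x, v x != vec0 K.
Hypothesis v_surj : forall u : vec K, u != vec0 K -> exists x, par (v x) u.
Hypothesis v_inj : forall x y, par (v x) (v y) -> x = y.
Variables fr cj : {rmorphism K -> K}.
Hypothesis fr3 : forall x, fr (fr (fr x)) = x.
Hypothesis cj2 : forall x, cj (cj x) = x.
Hypothesis cjfr : forall x, cj (fr x) = fr (cj x).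
Hypothesis frE : forall x, fr x = x ^+ 4.
Hypothesis cjE : forall x, cj x = x ^+ 8.
Hypothesis cardK : #|K| = 64%N.
Hypothesis char2 : 1 + 1 = 0 :> K.

Local Notation III := (III fr).
Local Notation star := (star fr).
Local Notation sharp := (sharp cj).
Local Notation hf := (hf cj).
Local Notation frv := (frv fr).
Local Notation W := (W fr).
Local Notation Iv := (Iv fr cj).
Local Notation pt := (pt v x0).
Local Notation tIII := (tIII v fr).
Local Notation inD := (inD v fr).
Local Notation I := (I v fr cj).
Local Notation jn := (jn I).

Let N2 (x : K) : x + x = 0. Proof. by rewrite -{1 2}[x]mulr1 -mulrDr char2 mulr0. Qed.
Let opp2 (x : K) : - x = x. Proof. by apply/eqP; rewrite eq_sym -addr_eq0 N2. Qed.

Let x63 (x : K) : x != 0 -> x ^+ 63 = 1.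
Proof.
move=> xn; apply: (mulfI xn); rewrite -exprS mulr1 -[RHS]expf_card cardK //.
Qed.

Let not_all_roots n : (0 < n)%N -> (n < 63)%N -> exists2 x : K, x != 0 & x ^+ n != 1.
Proof.
move=> n0 n63; have [/existsP[x /andP[h1 h2]]|none] := boolP [exists x : K, (x != 0) && (x ^+ n != 1)].
  by exists x.
have pn : ('X^n - 1 : {poly K}) != 0 by rewrite -size_poly_eq0 size_XnsubC.
have := card_roots_lt pn; rewrite size_XnsubC // ltnS => h.
have : (#|[set~ (0%R : K)]| <= n)%N.
  apply: leq_trans h; apply/subset_leq_card/subsetP => x; rewrite !inE => xn.
  move: none; rewrite negb_exists => /forallP/(_ x); rewrite xn negbK => /eqP e.
  by rewrite /root !hornerE ?hornerXn e subrr.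
by rewrite cardsC1 cardK leqNgt n63.
Qed.

Lemma order64_om_ex : exists om : K, om ^+ 2 = om + 1.
Proof.
have [x xn x21] := not_all_roots (n := 21) isT isT; exists (x ^+ 21).
have e3 : (x ^+ 21) ^+ 3 = 1 by rewrite -exprM x63.
move: (x ^+ 21) e3 x21 => y e3 y1.
have : (y - 1) * (y ^+ 2 - (y + 1)) = 0.
  transitivity (y ^+ 3 - 1 - (y ^+ 2 + y ^+ 2) + (1 + 1)); first by ring.
  by rewrite e3 subrr N2 subrr char2 addr0.
by move/eqP; rewrite mulf_eq0 !subr_eq0 (negPf y1) => /eqP.
Qed.

(** A nontrivial seventh root of unity is a root of X^3 + X + 1 or of X^3 + X^2 + 1, and inversion
    exchanges the two. *)
Lemma order64_z_ex : exists z : K, z ^+ 3 = z + 1.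
Proof.
have [x xn x9] := not_all_roots (n := 9) isT isT.
have yn : x ^+ 9 != 0 by rewrite expf_eq0.
have e7 : (x ^+ 9) ^+ 7 = 1 by rewrite -exprM x63.
move: (x ^+ 9) e7 x9 yn => y e7 y1 yn.
have : (y - 1) * (y ^+ 3 - (y + 1)) * (y ^+ 3 - (y ^+ 2 + 1)) = 0.
  transitivity (y ^+ 7 - 1 - (y ^+ 6 + y ^+ 6) + (y ^+ 3 + y ^+ 3)); first by ring.
  by rewrite e7 !N2 subrr subr0 addr0.
move/eqP; rewrite !mulf_eq0 !subr_eq0 (negPf y1) /= => /orP[/eqP e|/eqP e]; first by exists y.
exists y^-1; apply: (mulfI (_ : y ^+ 3 != 0)); first by rewrite expf_eq0.
rewrite exprVn mulfV ?expf_eq0 // mulrDr mulr1 exprS mulrC mulrA mulVf // mul1r.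
by rewrite -exprS e addrA N2 add0r.
Qed.

Variables (om z : K).
Hypothesis om2 : om ^+ 2 = om + 1.
Hypothesis z3 : z ^+ 3 = z + 1.

Definition ev4 (a : f4) : K := (a.1)%:R + (a.2)%:R * om.
Definition ev (a : f64) : K := ev4 a.1.1 + ev4 a.1.2 * z + ev4 a.2 * z ^+ 2.

Let xorbE (a b : bool) : (a (+) b)%:R = a%:R + b%:R :> K.
Proof. by case: a; case: b; rewrite ?addr0 ?add0r //= char2. Qed.

Let ev4D a b : ev4 (add4 a b) = ev4 a + ev4 b.
Proof. by rewrite /ev4 /= !xorbE; ring. Qed.

Let ev4M a b : ev4 (mul4 a b) = ev4 a * ev4 b.
Proof.
rewrite /ev4 /= !xorbE -!mulnb !natrM; apply/eqP; rewrite eq_sym -subr_eq0; apply/eqP.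
transitivity ((a.2)%:R * (b.2)%:R * (om ^+ 2 - (om + 1))); first by ring.
by rewrite om2 subrr mulr0.
Qed.

Let evD a b : ev (add a b) = ev a + ev b.
Proof. by rewrite /ev /= !ev4D; ring. Qed.

Let evM a b : ev (mul a b) = ev a * ev b.
Proof.
rewrite /ev /= !ev4D !ev4M; apply/eqP; rewrite eq_sym -subr_eq0; apply/eqP.
transitivity ((ev4 a.1.2 * ev4 b.2 + ev4 a.2 * ev4 b.1.2 + ev4 a.2 * ev4 b.2 * z) * (z ^+ 3 - (z + 1))).
  by ring.
by rewrite z3 subrr mulr0.
Qed.

Let cjom : cj om = om + 1.
Proof.
rewrite cjE (_ : om ^+ 8 = ((om ^+ 2) ^+ 2) ^+ 2); last by rewrite -!exprM.
rewrite om2; have -> : ((om + 1) ^+ 2) ^+ 2 = (om ^+ 2 + (om + om) + 1) ^+ 2 by ring.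
rewrite N2 addr0 om2 -addrA char2 addr0 om2 //.
Qed.

Let from : fr om = om.
Proof.
rewrite frE (_ : om ^+ 4 = (om ^+ 2) ^+ 2); last by rewrite -exprM.
rewrite om2; have -> : (om + 1) ^+ 2 = om ^+ 2 + (om + om) + 1 by ring.
by rewrite N2 addr0 om2 -addrA char2 addr0.
Qed.

Let frz : fr z = z ^+ 2 + z. Proof. by rewrite frE exprS z3; ring. Qed.
Let cjz : cj z = z.
Proof.
rewrite cjE (_ : z ^+ 8 = z ^+ 3 * z ^+ 3 * z ^+ 2); last by rewrite -!exprD.
rewrite z3; transitivity (z * z ^+ 3 + (z ^+ 3 + z ^+ 3) + z ^+ 2); first by ring.
by rewrite N2 addr0 z3; transitivity (z + (z ^+ 2 + z ^+ 2)); [ring | rewrite N2 addr0].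
Qed.

Let ev_fr a : ev (frob4 a) = fr (ev a).
Proof.
have f4 b : fr (ev4 b) = ev4 b by rewrite /ev4 rmorphD rmorphM !rmorph_nat from.
have push A B C : fr (A + B * z + C * z ^+ 2) = fr A + fr B * fr z + fr C * (fr z) ^+ 2.
  by rewrite rmorphD rmorphD (rmorphM _ B) (rmorphM _ C) rmorphXn.
rewrite /ev push /= !f4 frz ev4D.
have -> : (z ^+ 2 + z) ^+ 2 = z.
  transitivity (z * z ^+ 3 + (z ^+ 3 + z ^+ 3) + z ^+ 2); first by ring.
  by rewrite N2 addr0 z3; transitivity (z + (z ^+ 2 + z ^+ 2)); [ring | rewrite N2 addr0].
by ring.
Qed.

Let ev_cj a : ev (frob8 a) = cj (ev a).
Proof.
have c4 b : cj (ev4 b) = ev4 (conj4 b).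
  by rewrite /ev4 rmorphD rmorphM !rmorph_nat cjom /= xorbE; ring.
have push A B C : cj (A + B * z + C * z ^+ 2) = cj A + cj B * cj z + cj C * (cj z) ^+ 2.
  by rewrite rmorphD rmorphD (rmorphM _ B) (rmorphM _ C) rmorphXn.
by rewrite /ev push /= !c4 cjz.
Qed.

Let ev4_0 : ev4 (false, false) = 0.
Proof. by rewrite /ev4 (_ : (false, false).1%:R = 0 :> K) // add0r mul0r. Qed.
Let ev4_1 : ev4 (true, false) = 1.
Proof. by rewrite /ev4 (_ : (true, false).2%:R = 0 :> K) // mul0r addr0. Qed.
Let ev0 : ev zero = 0.
Proof. by rewrite /ev ev4_0 !mul0r !addr0. Qed.
Let ev1 : ev one = 1.
Proof. by rewrite /ev ev4_0 ev4_1 !mul0r !addr0. Qed.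

Let all64I (P : f64 -> bool) : (forall a, P a) -> all64 P.
Proof. by move=> h; rewrite /all64 /all4 /fb !h. Qed.

Let ev_eq0 a : (ev a == 0) = (a == zero).
Proof.
have [->|an] := eqVneq a zero; first by rewrite ev0 eqxx.
apply/negbTE/eqP => e.
have H : forall a, (a == zero) || ~~ all64 (fun b => mul a b != one).
  exact: all64P invertible_true.
have := H a; rewrite (negPf an) orFb => /negP; apply.
apply: all64I => b; apply/eqP => hb.
by have := congr1 ev hb; rewrite evM e mul0r ev1 => /esym/eqP; rewrite oner_eq0.
Qed.

Let iszE a : isz a = (ev a == 0).
Proof. by rewrite ev_eq0; case: a => [[[[] []] [[] []]] [[] []]]. Qed.

Let ev_surj x : exists a, x = ev a.
Proof.
have ei : injective ev.
  move=> a b e; have : add a b == zero by rewrite -ev_eq0 evD e N2.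
  move/eqP=> h; case: a b {e} h => [[[a1 a2] [a3 a4]] [a5 a6]] [[[b1 b2] [b3 b4]] [b5 b6]].
  by move: a1 b1 a2 b2 a3 b3 a4 b4 a5 b5 a6 b6 => [] [] // [] [] // [] [] // [] [] // [] [] // [] [].
have /(inj_card_bij ei)[g _ gK] : (#|K| <= #|{: f64}|)%N.
  by rewrite cardK !card_prod card_bool.
by exists (g x); rewrite gK.
Qed.

Definition evv (u : bvec) : vec K := (ev u.1.1, ev u.1.2, ev u.2).

Let evv_dot u w : ev (dotb u w) = dot (evv u) (evv w).
Proof. by rewrite /dotb /dot !evD !evM. Qed.
Let evv_cross u w : evv (crossb u w) = cross (evv u) (evv w).
Proof. by rewrite /crossb /cross /evv /= !evD !evM !opp2. Qed.
Let evv_frv u : evv (frvb u) = frv (evv u).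
Proof. by rewrite /frvb /FigueroaVectors.frv /evv /= !ev_fr. Qed.
Let evv_sharp u : evv (sharpb u) = sharp (evv u).
Proof. by rewrite /sharpb /FigueroaVectors.sharp /evv /= !ev_cj. Qed.
Let evv_star u : evv (starb u) = star (evv u).
Proof. by rewrite /starb evv_cross !evv_frv. Qed.
Let evv_addsc u k c : evv (addsc u k c) = vadd (evv u) (vsc (ev k) (evv c)).
Proof. by rewrite /evv /vadd /vsc /= !evD !evM. Qed.

Let absbE u : absb u = III (evv u) && (hf (star (evv u)) (star (evv u)) == 0).
Proof.
rewrite /absb !iszE !evv_dot evv_sharp evv_star /FigueroaVectors.III -/(det3 _ _ _).
by rewrite -/(FigueroaVectors.W fr (evv u)); case: (_ == 0).
Qed.

Let compatE p q y : compatb p q y =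
  (dot (evv y) (if III (cross (evv p) (evv q)) then
      star (cross (star (evv p)) (star (evv q))) else cross (evv p) (evv q)) == 0).
Proof.
have WE u : dot u (star u) = W u by [].
rewrite /compatb !iszE !evv_dot evv_star evv_cross WE /FigueroaVectors.III.
case: (W _ == 0); congr (dot _ _ == _); first exact: evv_cross.
by rewrite -[RHS]/(star (cross (star (evv p)) (star (evv q)))) -!evv_star -evv_cross -evv_star.
Qed.

Let allbP (A : eqType) (P : A -> bool) t : allb P t -> forall a, a \in t -> P a.
Proof.
elim: t => //= a t IH; case Pa: (P a) => // /IH h b; rewrite inE => /orP[/eqP ->|] //.
exact: h.
Qed.

Let hasbP (A : eqType) (P : A -> bool) t : hasb P t -> exists2 a, a \in t & P a.
Proof.
elim: t => //= a t IH; case Pa: (P a); first by exists a; rewrite ?mem_head.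
by move=> /IH[b bt Pb]; exists b; rewrite ?inE ?bt ?orbT.
Qed.

Let els_all a : a \in els.
Proof. by case: a => [[[[] []] [[] []]] [[] []]]. Qed.

Let mem_images (c Q : bvec) k : k != zero -> absb (addsc Q k c) -> addsc Q k c \in images c Q.
Proof.
move=> kn ab; rewrite /images; have := els_all k; elim: els => //= k' t IH.
rewrite inE => /orP[/eqP <-|/IH h].
  by rewrite iszE ev_eq0 (negPf kn) ab mem_head.
by case: (isz k') => //; case: (absb _) => //; rewrite inE h orbT.
Qed.

Let norm_ex (u : vec K) : u != vec0 K -> exists c : bvec,
  [/\ par u (evv c), evv c != vec0 K & check_c c].
Proof.
case: u => [[a b] d] un.
have [a0|an] := eqVneq a 0; last first.
  have [b' eb] := ev_surj (b / a); have [d' ed] := ev_surj (d / a).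
  exists (one, b', d'); split; [|by rewrite /evv !xpair_eqE ev1 oner_eq0|exact: check1].
  by rewrite /par /cross /evv /= ev1 -eb -ed; apply/eqP; apply: vecE; field.
have [b0|bn] := eqVneq b 0; last first.
  have [d' ed] := ev_surj (d / b).
  exists (zero, one, d'); split; [|by rewrite /evv !xpair_eqE ev1 oner_eq0 andbF|exact: check2].
  by rewrite /par /cross /evv /= ev1 ev0 -ed a0; apply/eqP; apply: vecE; field.
exists (zero, zero, one); split; [|by rewrite /evv !xpair_eqE ev1 oner_eq0 andbF|exact: check3].
by rewrite /par /cross /evv /= ev1 ev0 a0 b0; apply/eqP; apply: vecE; ring.
Qed.

Section Elation.

Variables (s : {perm T}) (c : T).
Hypothesis sE : pol_elation I s c.
Hypothesis cc : I c c.
Hypothesis Ic : tIII c.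
Hypothesis s_neq1 : s != 1%g.
Hypothesis sH : forall x, inD x -> I x x -> tIII (s x).

Let sI : I_aut I s := proj1 sE.
Let sc : s c = c. Proof. exact: (proj2 sE). Qed.
Let Isym : symmetric I. Proof. exact: I_symm. Qed.
Let Iuniq x y a b : x != y -> I x a -> I y a -> I x b -> I y b -> a = b.
Proof. exact: I_unique. Qed.
Let K_gt1 : (1 < #|K|)%N. Proof. by rewrite cardK. Qed.

Let jP x y : x != y -> I x (jn x y) && I y (jn x y).
Proof.
apply: (jnP (n := #|K|)) => //; first exact: (card_points x0).
by move=> b; apply: (card_polI x0).
Qed.

Let D_nonIII x y : inD x -> I x y -> ~~ tIII y.
Proof.
move=> Dx; rewrite /ProjectiveCoordinates.I Iv_ordl; last exact: inD_nonIII.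
have [d [d0 fd pd]] := fixed_vec (v_neq0 x) Dx.
rewrite /FigueroaVectors.hf dotC (par_dot _ (v_neq0 x) d0 pd) dotC => /eqP h.
by rewrite /ProjectiveCoordinates.tIII -(III_sharp cjfr); apply: fixed_orth_nonIII h.
Qed.

Let h0 x y : ~~ tIII x \/ ~~ tIII y -> I x y -> dot (v x) (sharp (v y)) = 0.
Proof. by case=> n; rewrite /ProjectiveCoordinates.I ?(Iv_ordl _ _ n) ?(Iv_ordr _ _ n) => /eqP h; exact: h. Qed.

(** The line from [Q] to the centre is fixed and, passing through a subplane point, not of type III;
    so the image is a linear combination of [Q] and [c0]. *)
Let image_pt (Q : vec K) (c0 : vec K) : frv Q = Q -> Q != vec0 K -> Iv Q Q ->
  c0 != vec0 K -> par (v c) c0 ->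
  exists k, [/\ k != 0, par (v (s (pt Q))) (vadd Q (vsc k c0)),
    III (vadd Q (vsc k c0)) & Iv (vadd Q (vsc k c0)) (vadd Q (vsc k c0))].
Proof.
move=> fQ Q0 QQ c00 pc; set x := pt Q; have Dx : inD x by apply: inD_pt.
have xx : I x x by rewrite I_pt.
have Isx := sH Dx xx; have sxx : I (s x) (s x) by rewrite sI.
have nxc : x != c by apply: contraTneq Ic => <-; apply: inD_nonIII.
have nxc' : ~~ I x c by apply/negP => /(D_nonIII Dx); rewrite Ic.
have /andP[xk ck] := jP nxc; set k := jn x c in xk ck.
have sk : s k = k by apply: (proj2 sE); rewrite Isym.
have nk : ~~ tIII k by apply: D_nonIII xk.
have hx := h0 (or_intror nk) xk; have hc := h0 (or_intror nk) ck.
have sxk : I (s x) k by rewrite -sk sI.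
have hsx := h0 (or_intror nk) sxk.
have nQc : ~~ par Q c0.
  apply: contra nxc => p; rewrite /x (v_eq_par v_inj).
  have px : par (v (pt Q)) Q by apply: ptP.
  by apply: par_trans Q0 px _; apply: par_trans c00 p _; rewrite par_sym.
have w0 : sharp (v k) != vec0 K by rewrite sharp_eq0.
have px : par (v x) Q by apply: ptP.
have eQ : dot (sharp (v k)) Q = 0.
  by apply/eqP; rewrite -(par_dot _ (v_neq0 x) Q0 px) dotC hx.
have ec : dot (sharp (v k)) c0 = 0.
  by apply/eqP; rewrite -(par_dot _ (v_neq0 c) c00 pc) dotC hc.
have es : dot (sharp (v k)) (v (s x)) = 0 by rewrite dotC.
have [a [b e]] := span2 nQc eQ ec w0 es.
have an : a != 0.
  apply: contra nxc => /eqP a0; rewrite -(inj_eq (@perm_inj _ s)) sc (v_eq_par v_inj).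
  apply: (@par_trans _ c0) => //; last by rewrite par_sym.
  rewrite e a0 vsc0; have -> : vadd (vec0 K) (vsc b c0) = vsc b c0 by vr.
  exact: par_vsc.
have bn : b != 0.
  apply: contra s_neq1 => /eqP b0; apply/eqP.
  apply: (elation_fix x0 v_neq0 v_surj v_inj fr3 cj2 cjfr K_gt1 cc sE nxc').
  apply/eqP; rewrite (v_eq_par v_inj); apply: (@par_trans _ Q) => //; last by rewrite par_sym.
  by rewrite e b0 vsc0 vadd0 par_vsc.
have e' : v (s x) = vsc a (vadd Q (vsc (b / a) c0)).
  by rewrite e /vadd /vsc /=; apply: vecE; field.
have pe : par (v (s x)) (vadd Q (vsc (b / a) c0)) by rewrite e' par_vsc.
have ne : vadd Q (vsc (b / a) c0) != vec0 K.
  by have := v_neq0 (s x); rewrite e' vsc_eq0 (negPf an).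
exists (b / a); split=> //; first by rewrite mulf_neq0 // invr_eq0.
  by rewrite -(III_par fr (v_neq0 _) ne pe).
move: sxx; rewrite /ProjectiveCoordinates.I (Iv_par _ _ _ (v_neq0 _) ne pe) Iv_sym //.
by rewrite (Iv_par _ _ _ (v_neq0 _) ne pe).
Qed.

Lemma typeIII_false_64 : False.
Proof.
have [c0 [pc c00 chk]] := norm_ex (v_neq0 c).
have Ic0 : III (evv c0) by rewrite -(III_par fr (v_neq0 c) c00 pc).
have ab : absb c0.
  rewrite absbE Ic0 /=; move: cc; rewrite /ProjectiveCoordinates.I (Iv_par _ _ _ (v_neq0 _) c00 pc) Iv_sym //.
  by rewrite (Iv_par _ _ _ (v_neq0 _) c00 pc) /FigueroaVectors.Iv Ic0.
move: chk; rewrite /check_c ab => chk.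
have allQ : all (fun Q => [&& frvb Q == Q, dotb Q (sharpb Q) == zero &
    (Q.1.1 == one) || (Q.2 == one)]) (P0 :: Hs) by vm_compute.
have fx Q : Q \in P0 :: Hs -> [/\ frv (evv Q) = evv Q, evv Q != vec0 K & Iv (evv Q) (evv Q)].
  move=> /(allP allQ) /and3P[/eqP e1 /eqP e2 e3].
  have fQ : frv (evv Q) = evv Q by rewrite -evv_frv e1.
  split=> //; last by rewrite Iv_ordl ?fixed_nonIII // /FigueroaVectors.hf -evv_sharp -evv_dot e2 ev0.
  by case/orP: e3 => /eqP e; rewrite /evv !xpair_eqE e ev1 oner_eq0 ?andbF.
have img Q : Q \in P0 :: Hs -> exists k, [/\ addsc Q k c0 \in images c0 Q,
    par (v (s (pt (evv Q)))) (evv (addsc Q k c0)) & III (evv (addsc Q k c0))].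
  move=> /fx[fQ Q0 QQ]; have [k [kn pk Ik Uk]] := image_pt fQ Q0 QQ c00 pc.
  have [k' ek] := ev_surj k; exists k'; rewrite evv_addsc -ek; split=> //.
  apply: mem_images; first by rewrite -ev_eq0 -ek.
  by rewrite absbE evv_addsc -ek Ik /=; move: Uk; rewrite /FigueroaVectors.Iv Ik.
have [k [kp pk Ik]] := img P0 (mem_head _ _).
have /hasbP[yq /mapP[Q QH ->] /allbP h] := allbP chk kp.
have QH' : Q \in P0 :: Hs by rewrite inE QH orbT.
have [k2 [kq pk2 Ik2]] := img Q QH'.
have := h _ kq; rewrite /= => /negP; apply; rewrite compatE {h chk}.
have [fP P00 _] := fx P0 (mem_head _ _); have [fQ Q0 _] := fx Q QH'.
move: pk Ik pk2 Ik2; rewrite evv_cross evv_cross evv_sharp.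
set p := evv (addsc P0 k c0); set q := evv (addsc Q k2 c0) => pp Ip pq Iq.
set P := pt (evv P0) in pp; set R := pt (evv Q) in pq.
have PQ : cross (evv P0) (evv Q) != vec0 K.
  have : all (fun Q => Q.2 == one) Hs by vm_compute.
  move=> /allP/(_ Q QH)/eqP e; apply/eqP => -[_ e2 _]; move: e2; rewrite /= e ev1 ev0 mul0r sub0r mulr1.
  by move/eqP; rewrite oppr_eq0 oner_eq0.
have nPR : P != R by rewrite pt_inj.
have /andP[Pm Rm] := jP nPR; set m := jn P R in Pm Rm.
have DP : inD P by apply: inD_pt.
have DR : inD R by apply: inD_pt.
have nm : ~~ tIII m by apply: D_nonIII Pm.
have pm : par (cross (evv P0) (evv Q)) (sharp (v m)).
  have e u : u != vec0 K -> I (pt u) m -> dot (sharp (v m)) u = 0.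
    move=> u0 /(h0 (or_intror nm)); rewrite dotC => e.
    have pu : par (v (pt u)) u by apply: ptP.
    by apply/eqP; rewrite -(par_dot _ (v_neq0 _) u0 pu) e.
  by apply: par_orth; apply: e.
have nmc : m != c by apply: contraNneq nm => ->.
have /andP[my cy] := jP nmc; set y := jn m c in my cy.
have ym : I y m by rewrite Isym.
have sy : s y = y by apply: (proj2 sE); rewrite Isym.
have sm0 : sharp (v m) != vec0 K by rewrite sharp_eq0.
have dym : dot (cross (evv P0) (evv Q)) (v y) = 0.
  by apply/eqP; rewrite dotC (par_dot _ PQ sm0 pm) h0 //; right.
have ny : ~~ tIII y.
  by apply: (fixed_orth_nonIII PQ _ dym); rewrite frv_cross fP fQ.
have sc0 : sharp (evv c0) != vec0 K by rewrite sharp_eq0.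
have psc : par (sharp (v c)) (sharp (evv c0)) by rewrite sharp_par.
have dyc : dot (v y) (sharp (evv c0)) = 0.
  have sc1 : sharp (v c) != vec0 K by rewrite sharp_eq0.
  by apply/eqP; rewrite -(par_dot _ sc1 sc0 psc) h0 //; [left | rewrite Isym].
set yv := cross _ _; have py : par yv (v y) by apply: par_orth => //; rewrite dotC.
have yv0 : yv != vec0 K.
  apply/negP => pz; have : III (cross (evv P0) (evv Q)).
    by rewrite (III_par fr PQ sc0 pz) III_sharp.
  by apply/negP; apply: fixed_nonIII; rewrite frv_cross fP fQ.
have p0 : p != vec0 K by apply: III_neq0 Ip.
have q0 : q != vec0 K by apply: III_neq0 Iq.
have sP : s P = pt p by apply/esym/eqP; rewrite pt_eq // par_sym.
have sR : s R = pt q by apply/esym/eqP; rewrite pt_eq // par_sym.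
have n12 : pt p != pt q by rewrite -sP -sR (inj_eq perm_inj).
have npq : cross p q != vec0 K by move: n12; rewrite pt_inj.
have i1 : I (pt p) (s m) by rewrite -sP sI.
have i2 : I (pt q) (s m) by rewrite -sR sI.
have i3 : I y (s m) by rewrite -{1}sy sI.
(* The image [s m] of the line joining the two subplane points contains both images and the fixed
   point [y]. By uniqueness, any covector of a line through both images vanishes on [y]. *)
have fin L : L != vec0 K -> I (pt p) (pt (sharp L)) -> I (pt q) (pt (sharp L)) -> dot yv L == 0.
  move=> L0 j1 j2; have sL0 : sharp L != vec0 K by rewrite sharp_eq0.
  move: i3; rewrite (Iuniq n12 i1 i2 j1 j2) -[y](pt_v x0 v_neq0 v_surj v_inj) I_pt // Iv_ordl //.
  by rewrite hf_sharp // dotC -(par_dot _ yv0 (v_neq0 y) py) dotC.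
have [IL|nL] := boolP (III (cross p q)); last first.
  have nsL : ~~ III (sharp (cross p q)) by rewrite III_sharp.
  by apply: fin => //; rewrite I_pt ?sharp_eq0 // Iv_ordr // hf_sharp // ?dot_crossl ?dot_crossr.
set Z := cross (star p) (star q).
have IZ : III Z by rewrite /FigueroaVectors.III W_cross_star // !mulf_neq0.
have Is : III (star Z) by rewrite III_star.
have sZ0 : sharp (star Z) != vec0 K by rewrite sharp_eq0; apply: III_neq0 Is.
have key u : III u -> u != vec0 K -> dot (star u) Z = 0 -> I (pt u) (pt (sharp (star Z))).
  move=> Iu u0 e; rewrite I_pt // /FigueroaVectors.Iv Iu III_sharp // Is /= star_sharp // hfZr hf_sharp //.
  by rewrite star_star // dotZr e !mulr0.
by apply: fin; [apply: III_neq0 Is | apply: key | apply: key]; rewrite // ?dot_crossl ?dot_crossr.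
Qed.

End Elation.

End Order64.

(** * Finite fields *)

Section MakeMorphism.

Variables (R S : nzRingType) (f : R -> S).
Hypotheses (fB : forall x y, f (x - y) = f x - f y)
  (fM : forall x y, f (x * y) = f x * f y) (f1 : f 1 = 1).

Let g := f.
Let gB : zmod_morphism g. Proof. exact: fB. Qed.
Let gM : monoid_morphism g. Proof. by split. Qed.
HB.instance Definition _ := GRing.isZmodMorphism.Build R S g gB.
HB.instance Definition _ := GRing.isMonoidMorphism.Build R S g gM.

Lemma rmorphism_ex : exists h : {rmorphism R -> S}, forall x, h x = f x.
Proof. by exists (g : {rmorphism R -> S}). Qed.

End MakeMorphism.

Lemma pow_rmorphism (L : finFieldType) p k j : prime p -> #|L| = (p ^ k)%N ->
  exists f : {rmorphism L -> L}, forall x, f x = x ^+ (p ^ j)%N.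
Proof.
move=> pp cL; have ch := card_finPcharP cL pp.
have pn : [pchar L].-nat (p ^ j)%N by rewrite pnatX pnatE // ch.
apply: rmorphism_ex => [x y|x y|]; last exact: expr1n.
  by rewrite exprDn_pchar // exprNn_pchar.
exact: exprMn.
Qed.

(** All bounds are tight since the total is n k. Applied to trace and norm, it turns bounds on
    numbers of roots into surjectivity. *)
Lemma card_fiber_eq (A B : finType) (f : A -> B) (D : {set A}) (E : {set B}) n k :
  {in D, forall x, f x \in E} -> (#|E| <= n)%N ->
  (forall b, #|[set x in D | f x == b]| <= k)%N -> #|D| = (n * k)%N ->
  {in E, forall b, #|[set x in D | f x == b]| = k}.
Proof.
move=> fE En fk Dn b bE.
have : #|D| = (\sum_(b in E) #|[set x in D | f x == b]|)%N.
  rewrite -sum1_card (partition_big f (mem E)) //=; apply: eq_bigr => c _.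
  by rewrite -sum1_card; apply: eq_bigl => x; rewrite !inE.
rewrite (bigD1 b) //= Dn => e; apply/eqP; rewrite eqn_leq fk /=.
have le : (\sum_(i in E | i != b) #|[set x in D | f x == i]| <= #|E :\ b| * k)%N.
  rewrite -sum_nat_const big_mkcond [X in (_ <= X)%N]big_mkcond; apply: leq_sum => i _.
  by rewrite !inE andbC; case: ifP.
have := cardsD1 b E; rewrite bE; move: le e En; move: (\sum_(i in E | _) _)%N => S'.
move: #|E :\ b| => m; case: n {Dn} => [|n]; nia.
Qed.

(** * Trace and norm of a quadratic extension *)

Section TraceNorm.

Variables (L : finFieldType) (s : nat) (cj : {rmorphism L -> L}).
Hypothesis s_gt1 : (1 < s)%N.
Hypothesis cardL : #|L| = (s ^ 2)%N.
Hypothesis cjE : forall x, cj x = x ^+ s.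

Lemma conjK x : cj (cj x) = x.
Proof. by rewrite !cjE -exprM mulnn -cardL expf_card. Qed.

Let card_fixed_le : (#|[set t | cj t == t]| <= s)%N.
Proof.
have sz : size ('X^s - 'X : {poly L}) = s.+1.
  by rewrite size_polyDl size_polyXn // size_polyN size_polyX.
have pn : ('X^s - 'X : {poly L}) != 0 by rewrite -size_poly_eq0 sz.
have := card_roots_lt pn; rewrite sz ltnS; apply: leq_trans.
apply/subset_leq_card/subsetP => t; rewrite !inE cjE => /eqP e.
by rewrite /root !hornerE ?hornerXn e subrr.
Qed.

Lemma card_trace t : cj t = t -> #|[set x | x + cj x == t]| = s.
Proof.
move=> ct; have := @card_fiber_eq _ _ (fun x => x + cj x) setT [set t | cj t == t] s s.
move=> H; have -> : [set x | x + cj x == t] = [set x in setT | x + cj x == t].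
  by apply/setP => x; rewrite !inE.
apply: H; rewrite ?inE ?ct //; last by rewrite cardsT cardL.
  by move=> x _; rewrite inE rmorphD conjK addrC.
move=> b; have sz : size ('X^s + ('X - b%:P) : {poly L}) = s.+1.
  by rewrite size_polyDl size_polyXn // size_XsubC.
have pn : ('X^s + ('X - b%:P) : {poly L}) != 0 by rewrite -size_poly_eq0 sz.
have := card_roots_lt pn; rewrite sz ltnS; apply: leq_trans.
apply/subset_leq_card/subsetP => x; rewrite !inE cjE => /eqP e.
by rewrite /root hornerD hornerXn hornerXsubC addrCA addrA e subrr.
Qed.

Lemma trace1_ex : exists th, th + cj th = 1.
Proof.
have /card_trace h : cj 1 = 1 by exact: rmorph1.
have /card_gt0P[x] : (0 < #|[set x | (x + cj x == 1)%R]|)%N by rewrite h; lia.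
by rewrite inE => /eqP e; exists x.
Qed.

Lemma trace_ex t : cj t = t -> exists x, x + cj x = t.
Proof.
by have [th e] := trace1_ex => ct; exists (th * t); rewrite rmorphM ct -mulrDl e mul1r.
Qed.

Lemma norm_ex t : cj t = t -> exists x, x * cj x = t.
Proof.
move=> ct; have [->|t0] := eqVneq t 0; first by exists 0; rewrite mul0r.
(* The s^2 - 1 nonzero elements map to at most s - 1 fixed ones, and a fibre consists of roots of a
   polynomial of degree s + 1. *)
have H := @card_fiber_eq _ _ (fun x => x * cj x) [set~ 0] ([set t | cj t == t] :\ 0) s.-1 s.+1.
suff : #|[set x in [set~ 0] | x * cj x == t]| = s.+1.
  move=> e; have /card_gt0P[x] : (0 < #|[set x in [set~ 0%R] | (x * cj x == t)%R]|)%N by rewrite e.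
  by rewrite !inE => /andP[_ /eqP]; exists x.
apply: H; rewrite ?inE ?t0 ?ct ?eqxx //.
- move=> x; rewrite !inE => x0; rewrite rmorphM conjK mulf_eq0 fmorph_eq0 orbb x0 /=.
  by rewrite mulrC.
- have := card_fixed_le; rewrite (cardsD1 0) inE rmorph0 eqxx add1n => h.
  by rewrite -ltnS prednK // ltnW.
- move=> b; have sz : size ('X^(s.+1) - b%:P : {poly L}) = s.+2 by rewrite size_XnsubC.
  have pn : ('X^(s.+1) - b%:P : {poly L}) != 0 by rewrite -size_poly_eq0 sz.
  have := card_roots_lt pn; rewrite sz ltnS; apply: leq_trans.
  apply/subset_leq_card/subsetP => x; rewrite !inE cjE => /andP[_ /eqP e].
  by rewrite /root !hornerE ?hornerXn exprS e subrr.
- by rewrite cardsC1 cardL; case: (s) s_gt1 => // s' _; rewrite /=; nia.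
Qed.

Lemma skew_ex : exists2 e, e != 0 & cj e = - e.
Proof.
have c0 : cj 0 = 0 by exact: rmorph0.
have := cardsD1 0 [set x | x + cj x == 0]; rewrite (card_trace c0) inE c0 addr0 eqxx => h.
have /card_gt0P[x] : (0 < #|[set x | (x + cj x == 0)%R] :\ 0%R|)%N by move: s_gt1; rewrite h add1n ltnS.
rewrite !inE => /andP[x0 /eqP e]; exists x => //.
by apply/eqP; rewrite -addr_eq0 addrC e.
Qed.

(** Dividing the s elements of trace zero by a nonzero one among them gives s fixed elements. *)
Lemma fixed_gt2 : (2 < s)%N -> exists a, [/\ a != 0, a != 1 & cj a = a].
Proof.
move=> s2; have [e e0 ce] := skew_ex.
have c0 : cj 0 = 0 by exact: rmorph0.
have h : (s <= #|[set t | cj t == t]|)%N.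
  rewrite -(card_trace c0) -(card_imset _ (mulIf (invr_neq0 e0))).
  apply/subset_leq_card/subsetP => y /imsetP[x + ->]; rewrite !inE => /eqP xe.
  rewrite rmorphM fmorphV ce; apply/eqP.
  have -> : cj x = - x by apply/eqP; rewrite -addr_eq0 addrC xe.
  by rewrite invrN mulrNN.
have /card_gt0P[x] : (0 < #|[set t | cj t == t] :\: [set 0%R; 1%R]|)%N.
  rewrite cardsD subn_gt0; apply: leq_ltn_trans (leq_trans s2 h).
  apply: leq_trans (subset_leq_card (subsetIr _ _)) _.
  by rewrite cards2; case: (_ != _).
by rewrite !inE negb_or => /andP[/andP[x0 x1] /eqP]; exists x.
Qed.

End TraceNorm.

(** * Embedding of the smaller field *)

Section Embedding.

Variables (p a b : nat) (F K : finFieldType).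
Hypotheses (p_pr : prime p) (cardF : #|F| = (p ^ a)%N) (cardK : #|K| = (p ^ (a * b))%N).

Let chF : p \in [pchar F] := card_finPcharP cardF p_pr.
Let chK : p \in [pchar K] := card_finPcharP cardK p_pr.
Let F' := pPrimeCharType chF.
Let K' := pPrimeCharType chK.

Let gen_ex : exists g : F', forall y : F', y != 0 -> exists n, y = g ^+ n.
Proof.
have /cyclicP[g gE] := field_unit_group_cyclic [set: {unit F}]%G.
exists (val g : F) => y y0; have uy : (y : F) \is a GRing.unit by rewrite unitfE.
have : FinRing.unit F uy \in <[g]>%g by rewrite -gE inE.
by move=> /cycleP[n e]; exists n; have := congr1 val e; rewrite FinRing.val_unitX.
Qed.

(** [F] consists of the values at a generator g of polynomials over the prime field. The minimal
    polynomial of g divides X^N - X with N the order of [K], so it has a root r in [K], and g may be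
    sent to r. *)
Lemma embedding_ex : exists iota : {rmorphism F -> K}, injective iota.
Proof.
have [g gP] := gen_ex.
pose eF := horner_alg g : {poly 'F_p} -> F'.
have eFM : {morph eF : x y / x * y} by move=> x y; rewrite /eF rmorphM.
have eFD : {morph eF : x y / x + y} by move=> x y; rewrite /eF rmorphD.
have eF1 : eF 1 = 1 by rewrite /eF rmorph1.
have eFC c : eF c%:P = c%:A by rewrite /eF horner_algC.
have eFB : {morph eF : x y / x - y} by move=> x y; rewrite /eF rmorphB.
pose N : nat := (p ^ (a * b))%N.
have N1 : (1 < N)%N by rewrite /N -cardK finNzRing_gt1.
have frobN (y : F) : y ^+ N = y.
  rewrite /N expnM -cardF; elim: b => [|b' IH]; first by rewrite expn0 expr1.
  by rewrite expnS exprM expf_card.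
have hN : eF ('X^N - 'X) = 0.
  by rewrite eFB /eF rmorphXn /= horner_algX; apply/eqP; rewrite subr_eq0; apply/eqP; exact: frobN.
have sN : size ('X^N - 'X : {poly 'F_p}) = N.+1.
  by rewrite size_polyDl size_polyXn // size_polyN size_polyX.
(* Coding polynomials as tuples makes the property decidable, so that an annihilating polynomial of
   least size can be picked. *)
pose Q n := [exists t : n.-tuple 'F_p, (Poly t != 0) && (eF (Poly t) == 0)].
have QP (P : {poly 'F_p}) : P != 0 -> eF P = 0 -> Q (size P).
  move=> P0 eP; apply/existsP; exists (in_tuple (polyseq P)); rewrite polyseqK P0; exact/eqP.
have exQ : exists n, Q n by exists (size ('X^N - 'X : {poly 'F_p})); apply: QP; rewrite // -size_poly_eq0 sN.
case: (ex_minnP exQ) => n /existsP[t /andP[m0 /eqP em]] nmin.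
set m := Poly t in m0 em; have sm : (size m <= n)%N by rewrite (leq_trans (size_Poly _)) ?size_tuple.
have mdvd P : eF P = 0 -> m %| P.
  move=> eP; rewrite /dvdp; apply: contraT => r0.
  have e : eF (P %% m) = 0.
    by have := congr1 eF (divp_eq P m); rewrite eP eFD eFM em mulr0 add0r => <-.
  have := nmin _ (QP _ r0 e); have := ltn_modp P m; rewrite m0 => h1 h2.
  by have := leq_trans h2 (ltnW (leq_trans h1 sm)); have := leq_trans h1 (leq_trans sm h2); rewrite ltnn.
pose mK := map_poly (in_alg K') m.
have sizem : size mK != 1%N.
  rewrite size_map_poly; apply/eqP => /eqP; rewrite size_poly_eq1 => /eqpP[[c1 c2] /= /andP[c10 c20] e].
  move: e; rewrite -!mul_polyC mulr1 => /(congr1 eF); rewrite eFM em mulr0 eFC => /esym/eqP.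
  by rewrite scaler_eq0 (negPf c20) oner_eq0.
have /dvdp_prod_XsubC[mask e] : mK %| \prod_(x <- enum K) ('X - (x : K')%:P).
  have : mK %| map_poly (in_alg K') ('X^N - 'X) by rewrite dvdp_map mdvd.
  rewrite rmorphB /= map_polyXn map_polyX.
  have := finField_genPoly K; rewrite cardK -/N => -> ; congr (_ %| _).
  by rewrite big_enum.
have [r rr] : exists r : K', root mK r.
  move: e; case: (seq.mask mask (enum K)) => [|r t'] e.
    by move: e; rewrite big_nil -size_poly_eq1 (negPf sizem).
  by exists r; rewrite (eqp_root e) big_cons rootM root_XsubC eqxx.
pose eK := horner_alg r : {poly 'F_p} -> K'.
have eKB P Q' : eK (P - Q') = eK P - eK Q' by rewrite /eK rmorphB.
have eKM P Q' : eK (P * Q') = eK P * eK Q' by rewrite /eK rmorphM.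
have eK1 : eK 1 = 1 by rewrite /eK rmorph1.
have wd P : eF P = 0 -> eK P = 0.
  move=> /mdvd/dvdpP[c ->]; rewrite /eK rmorphM /=.
  have -> : horner_alg r m = mK.[r] by [].
  by move/eqP: rr => ->; rewrite mulr0.
have surj (y : F') : exists P, eF P == y.
  have [->|y0] := eqVneq y 0; first by exists 0; rewrite /eF rmorph0.
  by have [k ->] := gP _ y0; exists ('X^k); rewrite /eF rmorphXn /= horner_algX.
pose io (y : F) : K := eK (xchoose (surj y)).
have eq P Q' : eF P = eF Q' -> eK P = eK Q'.
  move=> h; apply/eqP; rewrite -subr_eq0 /eK -rmorphB; apply/eqP; apply: wd.
  by rewrite eFB h subrr.
have xc (y : F') : eF (xchoose (surj y)) = y by apply/eqP; exact: (xchooseP (surj y)).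
have [iota _] : exists iota : {rmorphism F -> K}, forall x, iota x = io x.
  apply: rmorphism_ex => [x y|x y|].
  - by apply: (etrans _ (eKB _ _)); apply: eq; rewrite eFB !xc.
  - by apply: (etrans _ (eKM _ _)); apply: eq; rewrite eFM !xc.
  - by apply: (etrans _ eK1); apply: eq; rewrite xc eF1.
by exists iota; apply: fmorph_inj.
Qed.

Lemma embedding_image (iota : {rmorphism F -> K}) x : x ^+ (p ^ a)%N = x -> exists y, x = iota y.
Proof.
move=> ex; pose n := (p ^ a)%N.
have n1 : (1 < n)%N by rewrite /n -cardF finNzRing_gt1.
have sz : size ('X^n - 'X : {poly K}) = n.+1.
  by rewrite size_polyDl size_polyXn // size_polyN size_polyX.
have pn : ('X^n - 'X : {poly K}) != 0 by rewrite -size_poly_eq0 sz.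
have le := card_roots_lt pn; rewrite sz ltnS in le.
have sub : iota @: setT \subset [set x | root ('X^n - 'X) x].
  apply/subsetP => _ /imsetP[y _ ->]; rewrite inE /root !hornerE ?hornerXn -rmorphXn /n -cardF.
  by rewrite expf_card subrr.
have : x \in iota @: setT.
  have /eqP -> : iota @: setT == [set x | root ('X^n - 'X) x].
    by rewrite eqEcard sub card_imset ?cardsT ?cardF //; apply: fmorph_inj.
  by rewrite inE /root !hornerE ?hornerXn ex subrr.
by move=> /imsetP[y _ ->]; exists y.
Qed.

End Embedding.

Section CardIsotropic.

Variables (L : finFieldType) (s : nat) (cj : {rmorphism L -> L}).
Hypothesis s_gt1 : (1 < s)%N.
Hypothesis cardL : #|L| = (s ^ 2)%N.
Hypothesis cjE : forall x, cj x = x ^+ s.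
Variables (T : finType) (v : T -> vec L) (x0 : T).
Hypothesis v_neq0 : forall x, v x != vec0 L.
Hypothesis v_surj : forall u : vec L, u != vec0 L -> exists x, par (v x) u.
Hypothesis v_inj : forall x y, par (v x) (v y) -> x = y.

(** Besides (1, 0, 0) these are the points (x, y, 1) where the trace of x is minus the norm of y: s
    values of x for each of the s^2 values of y. *)
Lemma card_isotropic : #|[set x | hf cj (v x) (v x) == 0]| = (s ^ 3 + 1)%N.
Proof.
pose A := [set xy : L * L | xy.1 + cj xy.1 == - (xy.2 * cj xy.2)].
pose f (xy : L * L) := pt v x0 (xy.1, xy.2, 1).
have n1 (xy : L * L) : (xy.1, xy.2, 1) != vec0 L by rewrite !xpair_eqE oner_eq0 andbF.
have e0 : (1, 0, 0) != vec0 L by rewrite !xpair_eqE oner_eq0.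
have hZ x u : u != vec0 L -> par (v x) u -> (hf cj (v x) (v x) == 0) = (hf cj u u == 0).
  move=> u0 pu; have [k k0 ->] := par_exn (v_neq0 x) u0 pu.
  by rewrite hfZl hfZr !mulf_eq0 fmorph_eq0 (negPf k0).
have -> : [set x | hf cj (v x) (v x) == 0] = pt v x0 (1, 0, 0) |: f @: A.
  apply/setP => x; rewrite !inE.
  case E: (v x) => [[a b] c]; have vx0 := v_neq0 x; rewrite E in vx0.
  have hE : hf cj (a, b, c) (a, b, c) = a * cj c + b * cj b + c * cj a by [].
  rewrite -E (hZ x (a, b, c)) ?E ?paruu // hE.
  have [c0|cn] := eqVneq c 0.
    rewrite c0 rmorph0 mulr0 mul0r add0r addr0 mulf_eq0 fmorph_eq0 orbb.
    have -> : (x \in f @: A) = false.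
      apply/negP => /imsetP[xy _ ex]; have : par (v x) (xy.1, xy.2, 1) by rewrite ex; apply: ptP.
      by rewrite E c0 /par /cross /= => /eqP[h1 h2 _]; move: h1 h2 vx0;
         rewrite c0 !mulr1 !mul0r subr0 sub0r => -> /eqP; rewrite oppr_eq0 => /eqP ->; rewrite eqxx.
    rewrite orbF [x == _]eq_sym pt_eq // E c0; apply/eqP/idP => [->|/eqP[_ _]].
      by rewrite /par; apply/eqP; vr.
    by rewrite /= mul1r mul0r subr0.
  have -> : (x == pt v x0 (1, 0, 0)) = false.
    apply/negbTE; rewrite eq_sym pt_eq // E; apply/eqP => -[_ h _].
    by move: h; rewrite /= !mul0r mul1r sub0r => /eqP; rewrite oppr_eq0 (negPf cn).
  have px : par (a, b, c) (a / c, b / c, 1).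
    by rewrite /par /cross /=; apply/eqP; apply: vecE; field.
  apply/idP/imsetP => [h|[xy]].
    exists (a / c, b / c); last by apply/esym/eqP; rewrite pt_eq // E par_sym.
    rewrite inE /= -addr_eq0 !rmorphM !fmorphV /=; apply/eqP.
    transitivity ((a * cj c + b * cj b + c * cj a) / (c * cj c)); last by rewrite (eqP h) mul0r.
    by field; rewrite fmorph_eq0 cn.
  rewrite inE -addr_eq0 => h ex; have pxy : par (v x) (xy.1, xy.2, 1) by rewrite ex; apply: ptP.
  rewrite -hE -E (hZ x _ _ pxy) // /hf /dot /sharp /= rmorph1 mulr1 mul1r.
  by rewrite -addrA [_ * _ + _]addrC addrA.
rewrite cardsU1 card_in_imset; last first.
  move=> xy xy' _ _ /eqP; rewrite pt_inj // /par /cross /= => /eqP[h1 h2 _].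
  case: xy xy' h1 h2 => [x y] [x' y'] /=; rewrite !mulr1 !mul1r => /eqP + /eqP.
  by rewrite !subr_eq0 => /eqP -> /eqP ->.
have -> : pt v x0 (1, 0, 0) \notin f @: A.
  apply/negP => /imsetP[xy _ /eqP]; rewrite pt_inj // => /eqP[_ h _].
  by move: h; rewrite /= mulr1 mul0r sub0r => /eqP; rewrite oppr_eq0 oner_eq0.
rewrite addnC; congr (_ + _)%N.
rewrite -sum1_card (partition_big snd predT) //=.
transitivity (\sum_(y : L) s)%N; last by rewrite sum_nat_const cardL; ring.
apply: eq_bigr => y _; rewrite sum1dep_card.
rewrite -(@card_trace _ _ _ s_gt1 cardL cjE (- (y * cj y))); last first.
  by rewrite rmorphN rmorphM (conjK cardL cjE) mulrC.
rewrite -(card_imset _ (_ : injective (fun x : L => (x, y)))); last by move=> x x' [].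
apply: eq_card => -[x y']; rewrite !inE; apply/andP/imsetP => /=.
  by move=> [h /eqP e]; exists x; rewrite ?inE -e.
by move=> [x' h [-> ->]]; rewrite inE in h.
Qed.

End CardIsotropic.

(** * Matrices and coordinates *)

Notation j0 := (ord0 : 'I_3).
Notation j1 := (lift ord0 ord0 : 'I_3).
Notation j2 := (lift ord0 (lift ord0 ord0) : 'I_3).

Lemma ord3P (i : 'I_3) : [\/ i = j0, i = j1 | i = j2].
Proof.
by case: i => [[|[|[|]]]] // h; [apply: Or31 | apply: Or32 | apply: Or33]; apply: val_inj.
Qed.

Lemma map_mx_pow (L : nzRingType) (f : L -> L) k m n (A : 'M[L]_(m, n)) :
  (forall x, f x = x ^+ k) -> map_mx (fun x => x ^+ k) A = map_mx f A.
Proof. by move=> fE; apply/matrixP => i j; rewrite !mxE fE. Qed.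

Section Rows.

Variable L : fieldType.

Definition tov (r : 'rV[L]_3) : vec L := (r 0 j0, r 0 j1, r 0 j2).
Definition ofv (u : vec L) : 'rV[L]_3 :=
  \row_j (if j == j0 then u.1.1 else if j == j1 then u.1.2 else u.2).

Lemma tovK : cancel tov ofv.
Proof. by move=> r; apply/rowP => i; rewrite mxE; case: (ord3P i) => ->. Qed.

Lemma ofvK : cancel ofv tov.
Proof. by move=> [[a b] c]; rewrite /tov !mxE. Qed.

Lemma tovD r s : tov (r + s) = vadd (tov r) (tov s).
Proof. by rewrite /tov !mxE. Qed.

Lemma tovZ k r : tov (k *: r) = vsc k (tov r).
Proof. by rewrite /tov !mxE. Qed.

Lemma ofvD u w : ofv (vadd u w) = ofv u + ofv w.
Proof. by apply: (can_inj tovK); rewrite tovD !ofvK. Qed.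

Lemma ofvZ k u : ofv (vsc k u) = k *: ofv u.
Proof. by apply: (can_inj tovK); rewrite tovZ !ofvK. Qed.

Lemma tov_eq0 r : (tov r == vec0 L) = (r == 0).
Proof.
apply/eqP/eqP => [h|->]; last by rewrite /tov !mxE.
by apply: (can_inj tovK); rewrite h /tov !mxE.
Qed.

Lemma ofv_eq0 u : (ofv u == 0) = (u == vec0 L).
Proof. by rewrite -tov_eq0 ofvK. Qed.

Lemma sum3 (f : 'I_3 -> L) : \sum_i f i = f j0 + f j1 + f j2.
Proof. by rewrite !big_ord_recl big_ord0 addr0 addrA. Qed.

Lemma dot_mx u w : dot u w = (ofv u *m (ofv w)^T) 0 0.
Proof. by rewrite mxE sum3 !mxE. Qed.

Lemma dot_mx_eq0 u w : (dot u w == 0) = (ofv u *m (ofv w)^T == 0).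
Proof.
rewrite dot_mx; apply/eqP/eqP => [h|->]; last by rewrite mxE.
by apply/matrixP => i j; rewrite !ord1 h mxE.
Qed.

Definition A0 : 'M[L]_3 := \matrix_(i, j) ((i + j == 2)%N)%:R.

Lemma mulA0_row (r : 'rV[L]_3) : ofv (tov (r *m A0)) = ofv (r 0 j2, r 0 j1, r 0 j0).
Proof.
by congr ofv; rewrite /tov !mxE !sum3 !mxE /= !mulr0 !mulr1 ?add0r ?addr0.
Qed.

Lemma hf_mx (cj : {rmorphism L -> L}) u w :
  hf cj u w = (ofv u *m A0 *m (map_mx cj (ofv w))^T) 0 0.
Proof.
rewrite -[ofv u *m A0]tovK mulA0_row mxE sum3 !mxE /= /hf /dot /sharp /=.
by ring.
Qed.

Definition mulv (A : 'M[L]_3) (u : vec L) : vec L := tov (ofv u *m A).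

Lemma mulvM A B u : mulv (A *m B) u = mulv B (mulv A u).
Proof. by rewrite /mulv tovK mulmxA. Qed.

Lemma mulv1 u : mulv 1%:M u = u.
Proof. by rewrite /mulv mulmx1 ofvK. Qed.

Lemma mulvD A u w : mulv A (vadd u w) = vadd (mulv A u) (mulv A w).
Proof. by rewrite /mulv ofvD mulmxDl tovD. Qed.

Lemma mulvZ A k u : mulv A (vsc k u) = vsc k (mulv A u).
Proof. by rewrite /mulv ofvZ -scalemxAl tovZ. Qed.

Lemma mulv_eq0 A u : A \in unitmx -> (mulv A u == vec0 L) = (u == vec0 L).
Proof.
move=> uA; rewrite tov_eq0 -ofv_eq0; apply/eqP/eqP => [h|->]; last by rewrite mul0mx.
by rewrite -[LHS](mulmxK uA) h mul0mx.
Qed.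

Lemma mulv_inj A B : (forall u, mulv A u = mulv B u) -> A = B.
Proof.
move=> h; apply/row_matrixP => i; rewrite !rowE -[delta_mx 0 i]tovK.
by apply: (can_inj tovK); apply: h.
Qed.

End Rows.

(** * Normal form of a hermitian form *)

Section Frame.

Variables (L : finFieldType) (s : nat) (cj : {rmorphism L -> L}).
Hypothesis s_gt1 : (1 < s)%N.
Hypothesis cardL : #|L| = (s ^ 2)%N.
Hypothesis cjE : forall x, cj x = x ^+ s.
Variable N : 'M[L]_3.
Hypothesis N_herm : (map_mx cj N)^T = N.
Hypothesis N_unit : N \in unitmx.

Let cjK := conjK cardL cjE.
Let h (u w : 'rV[L]_3) : L := (u *m N *m (map_mx cj w)^T) 0 0.

Let hDl u u' w : h (u + u') w = h u w + h u' w.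
Proof. by rewrite /h !mulmxDl mxE. Qed.
Let hDr u w w' : h u (w + w') = h u w + h u w'.
Proof. by rewrite /h map_mxD linearD mulmxDr mxE. Qed.
Let hZl k u w : h (k *: u) w = k * h u w.
Proof. by rewrite /h -!scalemxAl mxE. Qed.
Let hZr k u w : h u (k *: w) = cj k * h u w.
Proof. by rewrite /h map_mxZ linearZ -scalemxAr mxE. Qed.
Let hC u w : h w u = cj (h u w).
Proof.
have -> : cj (h u w) = ((map_mx cj (u *m N *m (map_mx cj w)^T))^T) 0 0.
  by rewrite [RHS]mxE [RHS]mxE.
have ccw : map_mx cj (map_mx cj w) = w by apply/matrixP => i j; rewrite !mxE cjK.
by rewrite !map_mxM trmx_mul trmx_mul -map_trmx trmxK ccw N_herm mulmxA.
Qed.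
Let nondeg e : e != 0 -> exists z, h e z != 0.
Proof.
move=> e0; have : e *m N != 0.
  by apply: contraNneq e0 => e'; rewrite -[e](mulmxK N_unit) e' mul0mx.
move=> /rV0Pn[j nj]; exists (delta_mx 0 j); rewrite /h map_delta_mx trmx_delta -colE mxE.
exact: nj.
Qed.

Let notin m (A : 'M[L]_(m, 3)) : (m < 3)%N -> exists z : 'rV[L]_3, ~~ (z <= A)%MS.
Proof.
move=> m3; have : ~~ ((1%:M : 'M[L]_3) <= A)%MS.
  apply/negP => /mxrankS; rewrite mxrank1 => /(fun x => leq_trans x (rank_leq_row A)).
  by rewrite leqNgt m3.
by move=> /row_subPn[i ni]; exists (row i 1%:M).
Qed.

(** Surjectivity of the norm scales [r] to length 1 and gives an isotropic vector orthogonal to it;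
    surjectivity of the trace corrects a partner of that vector to an isotropic one. Prescribing the
    middle row lets a type II centre be moved into standard position. *)
Lemma frame_ex r : h r r != 0 -> exists B : 'M[L]_3,
  [/\ B *m N *m (map_mx cj B)^T = A0 L & exists2 k, k != 0 & row j1 B = k *: r].
Proof.
move=> rr; have chh u : cj (h u u) = h u u by rewrite -hC.
have [k ek] : exists k, k * cj k = (h r r)^-1.
  by apply: (norm_ex s_gt1 cardL cjE); rewrite fmorphV chh.
have k0 : k != 0 by apply: contraNneq rr => k0; move: ek; rewrite k0 mul0r => /esym/eqP; rewrite invr_eq0.
have [R RE] : exists R, R = k *: r by exists (k *: r).
have RR : h R R = 1 by rewrite RE hZl hZr mulrA ek mulVf.
have orth z : h (z - h z R *: R) R = 0 by rewrite hDl -scaleNr hZl RR mulr1 subrr.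
have orth' e z : h e R = 0 -> h e (z - h z R *: R) = h e z.
  by move=> e'; rewrite hDr -scaleNr hZr e' mulr0 addr0.
have [e [e0 ee eR]] : exists e, [/\ e != 0, h e e = 0 & h e R = 0].
  have [z nz] := @notin 1 R isT; pose w1 := z - h z R *: R.
  have w10 : w1 != 0 by apply: contra nz; rewrite subr_eq0 => /eqP ->; rewrite scalemx_sub.
  have w1R : h w1 R = 0 by exact: orth.
  clearbody w1.
  have [e1|n1] := eqVneq (h w1 w1) 0; first by exists w1.
  have [z' nz'] := @notin _ (col_mx R w1) isT.
  pose w2 := z' - h z' R *: R - (h z' w1 / h w1 w1) *: w1.
  have w20 : w2 != 0.
    apply: contra nz'; rewrite subr_eq0 subr_eq => /eqP ->; rewrite -addsmxE addmx_sub // scalemx_sub //.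
      exact: addsmxSr.
    exact: addsmxSl.
  have w2R : h w2 R = 0.
    by rewrite hDl orth add0r -scaleNr hZl w1R mulr0.
  have Rw1 : h R w1 = 0 by rewrite hC w1R rmorph0.
  have w21 : h w2 w1 = 0.
    by rewrite /w2 !hDl -!scaleNr !hZl Rw1 mulr0 addr0 mulNr mulfVK // subrr.
  clearbody w2.
  have [x ex] : exists x, x * cj x = - h w2 w2 / h w1 w1.
    by apply: (norm_ex s_gt1 cardL cjE); rewrite rmorphM rmorphN fmorphV !chh.
  exists (x *: w1 + w2); split; last by rewrite hDl hZl w1R w2R mulr0 addr0.
    apply: contra w20 => /eqP e1; have : h (x *: w1 + w2) w1 = 0 by rewrite e1 /h !mul0mx mxE.
    rewrite hDl hZl w21 addr0 => /eqP; rewrite mulf_eq0 (negPf n1) orbF => /eqP x0.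
    by move: e1; rewrite x0 scale0r add0r => ->.
  rewrite hDl !hDr !hZl !hZr w21 (hC w2 w1) w21 rmorph0 !mulr0 addr0 add0r mulrA ex.
  by rewrite mulfVK // addNr.
have [z nz] := nondeg e0.
pose u := (cj (h e z))^-1 *: (z - h z R *: R).
have uR : h u R = 0 by rewrite hZl orth mulr0.
have eu : h e u = 1 by rewrite hZr orth' // fmorphV cjK mulVf.
clearbody u.
have hu : cj (- h u u) = - h u u by rewrite rmorphN chh.
have [x ex] := trace_ex s_gt1 cardL cjE hu.
pose f := u + x *: e.
have ue : h u e = 1 by rewrite hC eu rmorph1.
have ff : h f f = 0.
  rewrite hDl !hDr !hZl !hZr ee ue eu !mulr1 !mulr0 addr0 -addrA [cj x + x]addrC ex subrr //.
have fR : h f R = 0 by rewrite hDl hZl eR uR mulr0 addr0.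
have ef : h e f = 1 by rewrite hDr hZr eu ee mulr0 addr0.
exists (\matrix_i (if i == j0 then e else if i == j1 then R else f)); split; last first.
  by exists k => //; rewrite rowK -RE.
set B := \matrix_i _.
have hB i j : (B *m N *m (map_mx cj B)^T) i j = h (row i B) (row j B).
  rewrite /h -row_mul; move: (B *m N) => C.
  by rewrite [RHS]mxE [LHS]mxE; apply: eq_bigr => l _; rewrite !mxE.
apply/matrixP => i j; rewrite hB !rowK mxE.
have Re : h R e = 0 by rewrite hC eR rmorph0.
have Rf : h R f = 0 by rewrite hC fR rmorph0.
have fe : h f e = 1 by rewrite hC ef rmorph1.
by case: (ord3P i) => ->; case: (ord3P j) => -> /=.
Qed.

Lemma hermitian_normal_form : exists B : 'M[L]_3, B *m N *m (map_mx cj B)^T = A0 L.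
Proof.
have [/existsP[r rr]|none] := boolP [exists r, h r r != 0].
  by have [B []] := frame_ex rr; exists B.
have iso r : h r r = 0.
  by apply/eqP; move: none; rewrite negb_exists => /forallP/(_ r); rewrite negbK.
have [|z nz] := @nondeg (delta_mx 0 0).
  by apply/eqP => /rowP/(_ 0); rewrite !mxE eqxx => /eqP; rewrite oner_eq0.
(* A nonzero hermitian form is not alternating: adding a multiple of [e] to [z] produces a vector
   whose value is the trace of [th], namely 1. *)
set e := delta_mx _ _ in nz; have [th eth] := trace1_ex s_gt1 cardL cjE.
have := iso (z + (th / h e z) *: e).
rewrite hDl !hDr !hZl !hZr !iso !mulr0 addr0 add0r (hC e z) -rmorphM mulfVK //.
by rewrite addrC eth => /eqP; rewrite oner_eq0.
Qed.

End Frame.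

(** * Subspace matrices in coordinates *)

Section Coordinates.

Variables (L : finFieldType) (C : 'M[L]_3).
Hypothesis C_unit : C \in unitmx.

(** [C] is the change of coordinates that makes the form antidiagonal; [nz_row] picks a spanning
    vector of the point. *)
Definition crd (x : point L) : vec L := tov (nz_row (val x) *m C).
Definition zin (z : vec L) m (A : 'M[L]_(m, 3)) := (ofv z *m invmx C <= A)%MS.

Let row_neq0 (x : point L) : nz_row (val x) != 0.
Proof.
rewrite nz_row_eq0 -mxrank_eq0; case/andP: (valP x) => _ /eqP e.
by apply/negP => /eqP; rewrite e.
Qed.

Let row_eqmx (x : point L) : (nz_row (val x) :=: val x)%MS.
Proof.
apply/eqmxP; rewrite -(mxrank_leqif_eq (nz_row_sub _)).2.
by rewrite rank_rV row_neq0; case/andP: (valP x) => _ /eqP ->.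
Qed.

Lemma crd_neq0 x : crd x != vec0 L.
Proof.
rewrite tov_eq0; apply/eqP => e; have := row_neq0 x.
by rewrite -[nz_row _](mulmxK C_unit) e mul0mx eqxx.
Qed.

Lemma sub_zin x m (A : 'M[L]_(m, 3)) : (val x <= A)%MS = zin (crd x) A.
Proof. by rewrite /zin tovK mulmxK // row_eqmx. Qed.

Lemma zin_point z x : zin z (val x) = par z (crd x).
Proof.
rewrite /zin -row_eqmx; apply/sub_rVP/idP => [[a e]|/(par_ex (crd_neq0 x))[a ->]].
  have -> : z = vsc a (crd x).
    apply: (can_inj (@ofvK L)); rewrite ofvZ tovK scalemxAl -e.
    by rewrite mulmxKV.
  exact: par_vsc.
by exists a; rewrite ofvZ tovK -scalemxAl mulmxK.
Qed.

Lemma zinP m n (A : 'M[L]_(m, 3)) (B : 'M[L]_(n, 3)) :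
  reflect (forall z, zin z A -> zin z B) (A <= B)%MS.
Proof.
apply: (iffP rV_subP) => [h z|h r rA]; first exact: h.
by have := h (tov (r *m C)); rewrite /zin tovK mulmxK //; apply.
Qed.

Lemma zinD z w m (A : 'M[L]_(m, 3)) : zin z A -> zin w A -> zin (vadd z w) A.
Proof. by rewrite /zin ofvD mulmxDl; apply: addmx_sub. Qed.

Lemma zinZ k z m (A : 'M[L]_(m, 3)) : zin z A -> zin (vsc k z) A.
Proof. by rewrite /zin ofvZ -scalemxAl; apply: scalemx_sub. Qed.

Lemma zin_eq0 z : zin z (0 : 'M[L]_3) -> z = vec0 L.
Proof.
rewrite /zin submx0 => /eqP e; apply/eqP; rewrite -ofv_eq0.
by rewrite -[ofv z](mulmxKV C_unit) e mul0mx.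
Qed.

Lemma crd_inj x y : par (crd x) (crd y) -> x = y.
Proof.
move=> p; apply: val_inj; case/andP: (valP x) => /eqP <- _; case/andP: (valP y) => /eqP <- _.
by apply/eq_genmx/eqmxP; rewrite !sub_zin !zin_point p par_sym.
Qed.

Lemma crd_surj u : u != vec0 L -> exists x, par (crd x) u.
Proof.
move=> u0; have r0 : ofv u *m invmx C != 0.
  by apply: contra u0 => /eqP e; rewrite -ofv_eq0 -[ofv u](mulmxKV C_unit) e mul0mx.
have pP : (<<<<ofv u *m invmx C>>>>%MS == <<ofv u *m invmx C>>%MS) &&
    (\rank <<ofv u *m invmx C>>%MS == 1%N) by rewrite genmx_id eqxx genmxE rank_rV r0.
exists (exist _ <<ofv u *m invmx C>>%MS pP); rewrite par_sym -zin_point /zin /= genmxE.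
exact: submx_refl.
Qed.

Lemma cov_line w : w != vec0 L -> exists l : line L, forall z, zin z (val l) = (dot z w == 0).
Proof.
move=> w0; pose A := kermx (C *m (ofv w)^T).
have rA : \rank A = 2%N.
  have e : \rank (C *m (ofv w)^T) = 1%N.
    by rewrite eqmxMfull ?row_full_unit // mxrank_tr rank_rV ofv_eq0 w0.
  by rewrite mxrank_ker e.
have lP : (<<<<A>>>>%MS == <<A>>%MS) && (\rank <<A>>%MS == 2%N).
  by rewrite genmx_id eqxx genmxE rA.
exists (exist _ <<A>>%MS lP) => z; rewrite /zin /= genmxE sub_kermx mulmxA mulmxKV //.
by rewrite dot_mx_eq0.
Qed.

Lemma line_cov (l : line L) : exists2 w, w != vec0 L & forall z, zin z (val l) = (dot z w == 0).
Proof.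
case/andP: (valP l) => _ /eqP rl.
pose t := nz_row (kermx (val l)^T).
have t0 : t != 0 by rewrite nz_row_eq0 -mxrank_eq0 mxrank_ker mxrank_tr rl.
have lt : val l *m t^T = 0.
  apply: (can_inj (@trmxK _ _ _)); rewrite trmx_mul trmxK trmx0; apply/eqP.
  by rewrite -sub_kermx nz_row_sub.
have e : (val l :=: kermx t^T)%MS.
  apply/eqmxP; rewrite -(mxrank_leqif_eq _).2; last by rewrite sub_kermx lt.
  by rewrite mxrank_ker mxrank_tr rank_rV t0 rl.
exists (tov (t *m (invmx C)^T)) => [|z].
  rewrite tov_eq0; apply: contra t0 => /eqP e'.
  have uT : (invmx C)^T \in unitmx by rewrite unitmx_tr unitmx_inv.
  by rewrite -[t](mulmxK uT) e' mul0mx.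
by rewrite /zin e sub_kermx dot_mx_eq0 tovK trmx_mul trmxK mulmxA.
Qed.

Section Hermitian.

Variables (s : nat) (cj : {rmorphism L -> L}) (N : 'M[L]_3).
Hypothesis cjE : forall x, cj x = x ^+ s.
Hypothesis NE : N = C *m A0 L *m (map_mx cj C)^T.

Lemma zin_perp z y : zin z (perp s N (val y)) = (dot z (sharp cj (crd y)) == 0).
Proof.
rewrite /zin /perp genmxE sub_kermx.
rewrite (map_mx_pow _ cjE).
have sub m n (A : 'M[L]_(m, 3)) (B : 'M[L]_(n, 3)) (Z : 'rV[L]_3) : (A <= B)%MS ->
    Z *m (map_mx cj B)^T = 0 -> Z *m (map_mx cj A)^T = 0.
  by case/submxP=> D -> e; rewrite map_mxM trmx_mul mulmxA e mul0mx.
rewrite mulmxA; transitivity (ofv z *m invmx C *m N *m (map_mx cj (nz_row (val y)))^T == 0).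
  by apply/eqP/eqP; apply: sub; rewrite row_eqmx.
rewrite -/(hf cj z (crd y)) hf_mx tovK map_mxM trmx_mul NE !mulmxA mulmxKV //.
apply/eqP/eqP => [->|e]; first by rewrite mxE.
by apply/matrixP => i j; rewrite !ord1 e mxE.
Qed.

End Hermitian.

Section Frobenius.

Variables (r : nat) (fr : {rmorphism L -> L}).
Hypothesis frE : forall x, fr x = x ^+ r.
Hypothesis fr3 : forall x, fr (fr (fr x)) = x.
Hypothesis Cfix : map_mx fr C = C.

Local Notation frob := (frob r).
Local Notation frv := (frv fr).

Let frobE (A : 'M[L]_3) : (frob A :=: map_mx fr A)%MS.
Proof.
rewrite /Defs.frob (map_mx_pow _ frE).
exact: genmxE.
Qed.

Lemma zin_frob_frv z A : zin (frv z) (frob A) = zin z A.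
Proof.
rewrite /zin frobE -(map_submx fr (ofv z *m invmx C)) map_mxM map_invmx Cfix.
congr (_ *m _ <= _)%MS; apply/rowP => i; rewrite !mxE /=.
by case: (ord3P i) => ->.
Qed.

Lemma zin_frob z A : zin z (frob A) = zin (frv (frv z)) A.
Proof. by rewrite -[RHS]zin_frob_frv frv3. Qed.

Lemma subplane_inD x : (frob (val x) == val x) = inD crd fr x.
Proof.
rewrite /inD; apply/eqP/idP => [e|p].
  have : zin (crd x) (val x) by rewrite zin_point paruu.
  by rewrite -{1}e zin_frob zin_point -(frv_par fr) frv3.
have sub : (val x <= frob (val x))%MS by rewrite sub_zin zin_frob zin_point -(frv_par fr) frv3.
case/andP: (valP x) => /eqP ex _; rewrite -{2}ex.
have -> : frob (val x) = <<frob (val x)>>%MS by rewrite /Defs.frob genmx_id.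
apply/esym/eq_genmx/eqmxP; rewrite -(mxrank_leqif_eq sub).2 frobE.
by rewrite mxrank_map.
Qed.

Let zin_fr_cov A w : (forall z, zin z A = (dot z w == 0)) ->
  forall z, zin z (frob A) = (dot z (frv w) == 0).
Proof.
move=> h z; rewrite zin_frob h -(fmorph_eq0 fr) fr_dot // frv3 //.
Qed.

Let sub_cov d m (A : 'M[L]_(m, 3)) (l : line L) : (forall z, zin z (val l) = (dot z d == 0)) ->
  (A <= val l)%MS -> forall z, zin z A -> dot z d = 0.
Proof. by move=> lE /zinP sub z /sub; rewrite lE => /eqP. Qed.

Lemma triangle_pointE x : triangle_point r (val x) = III fr (crd x).
Proof.
rewrite /triangle_point; set u := crd x.
have zu : zin u (val x) by rewrite zin_point paruu.
have zu' : zin (frv u) (frob (val x)) by rewrite zin_frob_frv.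
have zu'' : zin (frv (frv u)) (frob (frob (val x))) by rewrite !zin_frob_frv.
apply/idP/idP => [h|Iu].
  apply: contraT => /nonIII_fixed_orth[d [d0 fd du]].
  have [l lE] := cov_line d0.
  have p0 y : par y u -> dot y d = 0.
    move=> /(par_ex (crd_neq0 x))[k ->]; rewrite dotZl.
    by move: du; rewrite dotC => ->; rewrite mulr0.
  have sub : (val x + frob (val x) + frob (frob (val x)) <= val l)%MS.
    rewrite !addsmx_sub -andbA; apply/and3P; split; apply/zinP => z; rewrite lE ?zin_frob zin_point => pz.
    - by rewrite p0.
    - by rewrite -(fmorph_eq0 fr) -(fmorph_eq0 fr) !fr_dot !fd p0.
    - by rewrite -(fmorph_eq0 fr) fr_dot fd p0 //; move: pz; rewrite frv3.
  have := mxrankS sub; case/andP: (valP l) => _ /eqP ->; by rewrite (eqP h).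
have full z : zin z (val x + frob (val x) + frob (frob (val x)))%MS.
  have e := det3_basis u (frv u) (frv (frv u)) z.
  have -> : z = vsc (W fr u)^-1 (vsc (det3 u (frv u) (frv (frv u))) z).
    by rewrite vscA mulVf // vsc1.
  rewrite e; apply: zinZ; apply: zinD; first apply: zinD; apply: zinZ.
  - by apply: submx_trans zu _; rewrite -addsmxA addsmxSl.
  - by apply: submx_trans zu' _; rewrite (submx_trans _ (addsmxSl _ _)) // addsmxSr.
  - by apply: submx_trans zu'' _; rewrite addsmxSr.
rewrite eqn_leq rank_leq_col /= -[X in (X <= _)%N](mxrank1 L 3); apply: mxrankS.
by apply/zinP => z _; apply: full.
Qed.

Section LineMatrix.

Variables (A : 'M[L]_3) (w : vec L).
Hypothesis AE : forall z, zin z A = (dot z w == 0).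

Let A1 := zin_fr_cov AE.
Let A2 := zin_fr_cov A1.

Lemma triangle_lineE : triangle_line r A = III fr w.
Proof.
rewrite /triangle_line mxrank_eq0; apply/idP/idP => [/eqP h|Iw].
  apply: contraT => /nonIII_fixed_orth[d [d0 fd dw]].
  suff /zin_eq0 e : zin d (0 : 'M[L]_3) by rewrite e eqxx in d0.
  rewrite -h /zin !sub_capmx -!/(zin d _) AE A1 A2 dw eqxx /=.
  by rewrite -{1}fd -fr_dot dw rmorph0 eqxx -{1}fd -{1}fd -!fr_dot dw !rmorph0 eqxx.
rewrite -submx0; apply/zinP => z; rewrite {1}/zin !sub_capmx -!/(zin z _) AE A1 A2.
move=> /andP[/andP[/eqP z0 /eqP z1] /eqP z2].
rewrite (det3_orth Iw z0 z1 z2) /zin.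
have -> : ofv (vec0 L) = 0 by apply/eqP; rewrite ofv_eq0.
by rewrite mul0mx sub0mx.
Qed.

(** The meet of the conjugates of the line [w] is the point [star w], and the conjugates of the
    point span the line with covector [star] of it. *)
Lemma mu_incident x : III fr w -> III fr (crd x) ->
  (mu_line r A <= mu_point r (val x))%MS = (dot (star fr (crd x)) (star fr w) == 0).
Proof.
move=> Iw Iu; set u := crd x; rewrite /mu_line /mu_point.
have su0 : star fr u != vec0 L by apply: (III_neq0 (fr := fr)); rewrite III_star.
have sw0 : star fr w != vec0 L by apply: (III_neq0 (fr := fr)); rewrite III_star.
have zu' : zin (frv u) (frob (val x)) by rewrite zin_frob_frv zin_point paruu.
have zu'' : zin (frv (frv u)) (frob (frob (val x))) by rewrite !zin_frob_frv zin_point paruu.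
have capE z : zin z (frob A :&: frob (frob A))%MS = (dot z (frv w) == 0) && (dot z (frv (frv w)) == 0).
  by rewrite /zin sub_capmx -!/(zin z _) A1 A2.
apply/zinP/idP => [h|/eqP e z].
  have [l lE] := cov_line su0.
  have sub : (frob (val x) + frob (frob (val x)) <= val l)%MS.
    have key y y' : y != vec0 L -> dot y (star fr u) = 0 -> par y' y -> dot y' (star fr u) == 0.
      by move=> y0 e /(par_ex y0)[k ->]; rewrite dotZl e mulr0.
    rewrite addsmx_sub; apply/andP; split; apply/zinP => z; rewrite lE ?zin_frob zin_point => p.
      apply: (key (frv u)); rewrite ?frv_eq0 ?crd_neq0 ?dot_crossl //.
      by rewrite -[par _ _](frv_par fr) frv3 // in p *.
    apply: (key (frv (frv u))); rewrite ?frv_eq0 ?crd_neq0 ?dot_crossr //.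
    by rewrite -[par _ _](frv_par fr) -[par _ _](frv_par fr) !frv3 // in p *.
  have := sub_cov lE sub (h (star fr w) _); rewrite capE dotC dot_crossl dotC dot_crossr eqxx.
  by rewrite dotC => ->.
rewrite capE => /andP[/eqP z1 /eqP z2].
have pz : par (star fr w) z by apply: par_orth; rewrite // dotC.
have ze : dot (star fr u) z = 0.
  have [->|z0] := eqVneq z (vec0 L); first by rewrite dot0.
  by apply/eqP; rewrite -(par_dot _ sw0 z0 pz) e.
have npu : ~~ par (frv u) (frv (frv u)) by rewrite frv_par III_npar_frv.
have [a [b ->]] := span2 npu (etrans (dotC _ _) (dot_crossl _ _)) (etrans (dotC _ _) (dot_crossr _ _)) su0 ze.
apply: zinD; apply: zinZ; first exact: submx_trans zu' (addsmxSl _ _).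
exact: submx_trans zu'' (addsmxSr _ _).
Qed.

End LineMatrix.

Variable cj : {rmorphism L -> L}.
Hypothesis cj2 : forall x, cj (cj x) = x.
Hypothesis cjfr : forall x, cj (fr x) = fr (cj x).

Lemma fig_incidentE A (y : vec L) x :
  (forall z, zin z A = (dot z (sharp cj y) == 0)) ->
  fig_incident r (val x) A = Iv fr cj (crd x) y.
Proof.
move=> AE; rewrite /fig_incident triangle_pointE (triangle_lineE AE) III_sharp // /Iv.
case: ifP => [/andP[Ix Iy]|_]; last by rewrite sub_zin AE.
rewrite (mu_incident AE) ?III_sharp // star_sharp // dotZr.
by rewrite mulf_eq0 oppr_eq0 oner_eq0.
Qed.

Lemma fig_lines_polar : fig_lines L r = polar_lines (I crd fr cj).
Proof.
apply/setP => b; apply/imsetP/imsetP => [[l _ ->]|[y _ ->]].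
  have [w w0 lE] := line_cov l.
  have sw0 : sharp cj w != vec0 L by rewrite sharp_eq0.
  have [y py] := crd_surj sw0; exists y => //; apply/setP => x; rewrite !inE.
  rewrite (fig_incidentE (y := sharp cj w)); last by move=> z; rewrite sharpK.
  by rewrite /I Iv_sym // [RHS]Iv_sym // (Iv_par _ _ _ (crd_neq0 y) sw0 py).
have sy0 : sharp cj (crd y) != vec0 L by rewrite sharp_eq0 crd_neq0.
have [l lE] := cov_line sy0; exists l => //; apply/setP => x; rewrite !inE.
by rewrite (fig_incidentE (y := crd y)).
Qed.

Lemma fig_absolute_abs (s : nat) N : (forall x, cj x = x ^+ s) ->
  N = C *m A0 L *m (map_mx cj C)^T ->
  fig_absolute_points r s N = abs_points (I crd fr cj).
Proof.
move=> cjE NE; apply/setP => x; rewrite !inE (fig_incidentE (y := crd x)) //.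
by move=> z; apply: zin_perp.
Qed.

End Frobenius.

Section Desarguesian.

Variable cj : {rmorphism L -> L}.
Hypothesis cj2 : forall x, cj (cj x) = x.

(** With the identity in place of Frobenius no vector is of type III, so the results on [I] also
    cover the desarguesian plane. *)
Lemma I_id x y : I crd idfun cj x y = (hf cj (crd x) (crd y) == 0).
Proof.
have fE u : frv idfun u = u :> vec L by case: u => [[a b] c].
have det0 (u : vec L) : det3 u u u = 0 by vr.
by rewrite /I /Iv /III /W !fE det0 eqxx.
Qed.

Lemma desarguesian_lines_polar : desarguesian_lines L = polar_lines (I crd idfun cj).
Proof.
apply/setP => b; apply/imsetP/imsetP => [[l _ ->]|[y _ ->]].
  have [w w0 lE] := line_cov l.
  have sw0 : sharp cj w != vec0 L by rewrite sharp_eq0.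
  have [y py] := crd_surj sw0; exists y => //; apply/setP => x; rewrite !inE I_id sub_zin lE.
  have py' : par w (sharp cj (crd y)) by rewrite -(sharp_par cj) sharpK // par_sym.
  by rewrite /hf (par_dot _ w0 _ py') // sharp_eq0 crd_neq0.
have sy0 : sharp cj (crd y) != vec0 L by rewrite sharp_eq0 crd_neq0.
have [l lE] := cov_line sy0; exists l => //; apply/setP => x; rewrite !inE I_id.
by rewrite sub_zin lE.
Qed.

Lemma hermitian_points_abs (s : nat) N : (forall x, cj x = x ^+ s) ->
  N = C *m A0 L *m (map_mx cj C)^T ->
  hermitian_points s N = abs_points (I crd idfun cj).
Proof.
move=> cjE NE; apply/setP => x; rewrite !inE I_id sub_zin.
by rewrite (zin_perp cjE NE).
Qed.

End Desarguesian.

End Coordinates.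

(** * Transvections *)

Lemma eq_commg_inv (gT : finGroupType) (g x y : gT) :
  (g * (y * x) = x * y -> g = [~ x^-1, y^-1])%g.
Proof. by move=> e; rewrite commgEl conjgE !invgK !mulgA -e mulgA !mulgK. Qed.

(** Modulo [N] the factors [n], [m] and [t] disappear and the equation says that [x] and [y]
    commute. *)
Lemma commg_mod (gT : finGroupType) (N : {group gT}) (x y n m t : gT) :
  x \in 'N(N)%g -> y \in 'N(N)%g -> n \in N -> m \in N -> t \in N ->
  (n * x * (m * y) = t * (m * y * (n * x)))%g -> [~ x, y]%g \in N.
Proof.
move=> xN yN nN mN tN e; have NN z : z \in N -> z \in 'N(N)%g by apply: (subsetP (normG N)).
have nx := groupM (NN _ nN) xN; have my := groupM (NN _ mN) yN.
have ce : (coset N x * coset N y = coset N y * coset N x)%g.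
  have := congr1 (coset N) e.
  rewrite (morphM (coset_morphism N) nx my).
  rewrite (morphM (coset_morphism N) (NN _ tN) (groupM my nx)).
  rewrite (morphM (coset_morphism N) my nx).
  rewrite (morphM (coset_morphism N) (NN _ nN) xN) (morphM (coset_morphism N) (NN _ mN) yN).
  by rewrite /= (coset_id nN) (coset_id mN) (coset_id tN) !mul1g.
apply: coset_idr; first by rewrite groupR.
by rewrite morphR //; apply/eqP/commgP.
Qed.

Section Matrix3.

Variable L : fieldType.

Lemma det3E (A : 'M[L]_3) : \det A = det3 (tov (row j0 A)) (tov (row j1 A)) (tov (row j2 A)).
Proof.
have e10 : lift j1 (ord0 : 'I_2) = j0 by apply: val_inj.
have e11 : lift j1 (lift ord0 ord0 : 'I_2) = j2 by apply: val_inj.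
have e20 : lift j2 (ord0 : 'I_2) = j0 by apply: val_inj.
have e21 : lift j2 (lift ord0 ord0 : 'I_2) = j1 by apply: val_inj.
have f0 : lift (lift ord0 ord0 : 'I_2) (ord0 : 'I_1) = ord0 by apply: val_inj.
have d2 (B : 'M[L]_2) : \det B = B ord0 ord0 * B (lift ord0 ord0) (lift ord0 ord0)
    - B ord0 (lift ord0 ord0) * B (lift ord0 ord0) ord0.
  rewrite (expand_det_row B ord0) !big_ord_recl big_ord0 /cofactor !det_mx11 !mxE f0.
  rewrite /= expr0 expr1; move: (B _ _) (B _ _) (B _ _) (B _ _) => b1 b2 b3 b4.
  by ring.
rewrite (expand_det_row A j0) sum3 /cofactor !d2 !mxE e10 e11 e20 e21.
rewrite /det3 /dot /cross /tov /= !mxE expr0 expr1 sqrrN expr1n.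
move: (A j0 j0) (A j0 j1) (A j0 j2) (A j1 j0) (A j1 j1) (A j1 j2) (A j2 j0) (A j2 j1) (A j2 j2).
by move=> a b c a' b' c' a'' b'' c''; ring.
Qed.

Definition mxv (r1 r2 r3 : vec L) : 'M[L]_3 :=
  \matrix_i ofv (if i == j0 then r1 else if i == j1 then r2 else r3).

Lemma mulv_mxv r1 r2 r3 u :
  mulv (mxv r1 r2 r3) u = vadd (vadd (vsc u.1.1 r1) (vsc u.1.2 r2)) (vsc u.2 r3).
Proof. by rewrite /mulv /tov !mxE !sum3 !mxE. Qed.

Lemma det_mxv r1 r2 r3 : \det (mxv r1 r2 r3) = det3 r1 r2 r3.
Proof. by rewrite det3E !rowK !ofvK. Qed.

Lemma mulv_row (A : 'M[L]_3) u :
  mulv A u = vadd (vadd (vsc u.1.1 (tov (row j0 A))) (vsc u.1.2 (tov (row j1 A))))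
    (vsc u.2 (tov (row j2 A))).
Proof. by rewrite /mulv /tov !mxE !sum3 !mxE. Qed.

Variable cj : {rmorphism L -> L}.
Local Notation hf := (hf cj).

Lemma unitary_hf (A : 'M[L]_3) : A *m A0 L *m (map_mx cj A)^T = A0 L ->
  forall u w, hf (mulv A u) (mulv A w) = hf u w.
Proof. by move=> h u w; rewrite !hf_mx !tovK map_mxM trmx_mul -{2}h !mulmxA. Qed.

Lemma hf_unitary (A : 'M[L]_3) : (forall u w, hf (mulv A u) (mulv A w) = hf u w) ->
  A *m A0 L *m (map_mx cj A)^T = A0 L.
Proof.
move=> h; apply/matrixP => i j.
have e (B : 'M[L]_3) : B i j =
    ((delta_mx 0 i : 'rV[L]_3) *m B *m (map_mx cj (delta_mx 0 j : 'rV[L]_3))^T) 0 0.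
  by rewrite map_delta_mx trmx_delta -rowE -colE !mxE.
have := h (tov (delta_mx 0 i)) (tov (delta_mx 0 j)).
by rewrite !hf_mx !tovK map_mxM trmx_mul !mulmxA => hh; rewrite !e !mulmxA.
Qed.

Lemma A0_unit : A0 L \in unitmx.
Proof.
rewrite unitmxE unitfE det3E /tov !mxE /= /det3 /dot /cross /=.
by rewrite !(mul0r, mulr0, mul1r, mulr1, subr0, sub0r, addr0, add0r) oppr_eq0 oner_eq0.
Qed.

Lemma unitary_unit (A : 'M[L]_3) : A *m A0 L *m (map_mx cj A)^T = A0 L -> A \in unitmx.
Proof. by move=> h; have := A0_unit; rewrite -h -mulmxA unitmx_mul => /andP[]. Qed.

End Matrix3.

(** * Transvections and the derived group of SU_3 *)

Section UnitaryGroup.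

Variables (F : finFieldType) (q : nat) (cj : {rmorphism F -> F}).
Hypothesis q_gt1 : (1 < q)%N.
Hypothesis cardF : #|F| = (q ^ 2)%N.
Hypothesis cjE : forall x, cj x = x ^+ q.

Local Notation hf := (hf cj).
Local Notation vec := (vec F).
Let cj2 := conjK cardF cjE.
Let hfcj u w : cj (hf u w) = hf w u. Proof. by rewrite -hfC. Qed.

Definition gl (A : 'M[F]_3) : {'GL_3[F]} := insubd (1%g : {'GL_3[F]}) A.

Lemma glK A : A \in unitmx -> GLval (gl A) = A.
Proof. by move=> uA; rewrite -[GLval _]/(val _) insubdK. Qed.

Local Notation S := (SU3 q (A0 F)).

Lemma in_SU3 g : (g \in S) =
  (GLval g *m A0 F *m (map_mx cj (GLval g))^T == A0 F) && (\det (GLval g) == 1).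
Proof. by rewrite inE (map_mx_pow _ cjE). Qed.

Lemma SU3_group_set : group_set S.
Proof.
apply/group_setP; split=> [|g h].
  by rewrite in_SU3 GL_1E map_mx1 trmx1 mulmx1 mul1mx det1 !eqxx.
rewrite !in_SU3 => /andP[/eqP ug /eqP dg] /andP[/eqP uh /eqP dh].
rewrite GL_MxE det_mulmx dg dh mulr1 eqxx andbT; apply/eqP/hf_unitary => u w.
by rewrite !mulvM !unitary_hf.
Qed.
Canonical SU3_group := group SU3_group_set.

Definition glact (g : {'GL_3[F]}) u := mulv (GLval g) u.

Lemma glactM g h u : glact (g * h)%g u = glact h (glact g u).
Proof. by rewrite /glact GL_MxE mulvM. Qed.
Lemma glact1 u : glact 1%g u = u. Proof. by rewrite /glact mulv1. Qed.
Lemma glactK g u : glact g^-1%g (glact g u) = u. Proof. by rewrite -glactM mulgV glact1. Qed.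
Lemma glactKV g u : glact g (glact g^-1%g u) = u. Proof. by rewrite -glactM mulVg glact1. Qed.
Lemma glactZ g k u : glact g (vsc k u) = vsc k (glact g u). Proof. exact: mulvZ. Qed.
Lemma glactD g u w : glact g (vadd u w) = vadd (glact g u) (glact g w). Proof. exact: mulvD. Qed.
Lemma glact_eq0 g u : (glact g u == vec0 F) = (u == vec0 F).
Proof. exact: (mulv_eq0 _ (GL_unit g)). Qed.

Lemma glact_inj g h : (forall u, glact g u = glact h u) -> g = h.
Proof. by move=> e; apply: val_inj; apply: mulv_inj. Qed.

Lemma glact_hf g u w : g \in S -> hf (glact g u) (glact g w) = hf u w.
Proof. by rewrite in_SU3 => /andP[/eqP h _]; apply: unitary_hf. Qed.

Definition tv c l u := vadd u (vsc (l * hf u c) c).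
Definition tm c l : 'M[F]_3 := mxv (tv c l (1, 0, 0)) (tv c l (0, 1, 0)) (tv c l (0, 0, 1)).

Lemma tmE c l u : mulv (tm c l) u = tv c l u.
Proof.
rewrite mulv_mxv /tv; case: u => [[u1 u2] u3]; case: c => [[c1 c2] c3].
by rewrite /hf /dot /sharp /vadd /vsc /=; apply: vecE; ring.
Qed.

Lemma hf_tv c l u w : hf c c = 0 -> cj l = - l -> hf (tv c l u) (tv c l w) = hf u w.
Proof.
move=> cc sl; rewrite /tv !hfDl !hfDr !hfZl !hfZr rmorphM hfcj cc sl.
by move: (hf u w) (hf u c) (hf c w) => x y z; ring.
Qed.

Lemma det_tm c l : \det (tm c l) = 1 + l * hf c c.
Proof.
rewrite det_mxv /tv; case: c => [[c1 c2] c3].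
rewrite /det3 /hf /dot /sharp /cross /vadd /vsc /=.
by ring.
Qed.

(** A zero [c] or [l] gives the identity, in agreement with the identity counting as an elation. *)
Definition transvections : {set {'GL_3[F]}} :=
  [set g : {'GL_3[F]} | [exists c : vec, exists l : F,
     [&& hf c c == 0, cj l == - l & (GLval g : 'M[F]_3) == tm c l]]].
Local Notation X := transvections.
Definition transvection_group := <<X>>%G.
Local Notation N0 := transvection_group.

Lemma tm_unitary c l : hf c c = 0 -> cj l = - l ->
  tm c l *m A0 F *m (map_mx cj (tm c l))^T = A0 F.
Proof. by move=> cc sl; apply: hf_unitary => u w; rewrite !tmE hf_tv. Qed.

Lemma transvection_in c l : hf c c = 0 -> cj l = - l -> gl (tm c l) \in X.
Proof.
move=> cc sl; rewrite inE; apply/existsP; exists c; apply/existsP; exists l.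
by rewrite cc sl glK ?eqxx //; exact: (unitary_unit (tm_unitary cc sl)).
Qed.

Lemma glact_tm c l u : hf c c = 0 -> cj l = - l -> glact (gl (tm c l)) u = tv c l u.
Proof. by move=> cc sl; rewrite /glact glK ?tmE // (unitary_unit (tm_unitary cc sl)). Qed.

Lemma transvectionP (g : {'GL_3[F]}) : g \in X -> exists c l, [/\ hf c c = 0, cj l = - l & forall u, glact g u = tv c l u].
Proof.
rewrite inE => /existsP[c /existsP[l /and3P[/eqP cc /eqP sl /eqP e]]].
by exists c, l; split=> // u; rewrite /glact e tmE.
Qed.

Lemma transvection_intro g c l : hf c c = 0 -> cj l = - l ->
  (forall u, glact g u = tv c l u) -> g \in X.
Proof.
move=> cc sl h; have -> : g = gl (tm c l) by apply: glact_inj => u; rewrite h glact_tm.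
exact: transvection_in.
Qed.

Lemma transvections_sub : X \subset S.
Proof.
apply/subsetP => g /[1!inE] /existsP[c /existsP[l /and3P[/eqP cc /eqP sl /eqP e]]].
by rewrite in_SU3 e tm_unitary // det_tm cc mulr0 addr0 !eqxx.
Qed.

Lemma N0_sub : N0 \subset S.
Proof. by rewrite gen_subG transvections_sub. Qed.

Lemma tvJ g c l u : g \in S -> glact g (tv c l (glact g^-1%g u)) = tv (glact g c) l u.
Proof.
move=> gS; rewrite /tv glactD glactKV glactZ; congr (vadd _ (vsc (_ * _) _)).
by rewrite -[in RHS](glactKV g u) glact_hf.
Qed.

Lemma transvectionJ (g x : {'GL_3[F]}) : g \in S -> x \in X -> (x ^ g)%g \in X.
Proof.
move=> gS /transvectionP[c [l [cc sl h]]]; apply: (@transvection_intro _ (glact g c) l) => //.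
  by rewrite glact_hf.
by move=> u; rewrite conjgE !glactM h tvJ.
Qed.

Lemma S_norm_N0 : S \subset 'N(N0)%g.
Proof.
apply: norms_gen; apply/subsetP => g gS; rewrite inE; apply/subsetP => _ /imsetP[x xX ->].
exact: transvectionJ.
Qed.

Lemma N0_tv c l : hf c c = 0 -> cj l = - l -> exists2 g : {'GL_3[F]}, g \in N0 & forall u, glact g u = tv c l u.
Proof.
move=> cc sl; exists (gl (tm c l)) => [|u]; last exact: glact_tm.
by rewrite mem_gen ?transvection_in.
Qed.

Lemma isotropic_hf c d : c != vec0 F -> d != vec0 F -> hf c c = 0 -> hf d d = 0 ->
  ~~ par c d -> hf c d != 0.
Proof.
move=> c0 d0 cc dd; apply: contra => /eqP cd; apply: contraT => np.
have dc : hf d c = 0 by rewrite -hfcj cd rmorph0.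
by have := hf_orth_par c0 d0 np cc cd dc dd; rewrite (negPf np).
Qed.

Lemma N0_trans c d : c != vec0 F -> d != vec0 F -> hf c c = 0 -> hf d d = 0 ->
  exists2 g : {'GL_3[F]}, g \in N0 & exists2 k, k != 0 & glact g c = vsc k d.
Proof.
move=> c0 d0 cc dd; have [p|np] := boolP (par c d).
  have [k k0 e] := par_exn c0 d0 p; exists 1%g => //.
  by exists k => //; rewrite glact1.
have n := isotropic_hf c0 d0 cc dd np.
have n' : hf d c != 0 by rewrite -hfcj fmorph_eq0.
have [e e0 se] := skew_ex q_gt1 cardF cjE.
have [g gN gE] := N0_tv dd se.
(* The first transvection adds a multiple of [d] to [c]; the second, with this parameter and centre
   [c], removes the component along [c]. *)
have sm : cj (- (e * (hf c d * hf d c))^-1) = - - (e * (hf c d * hf d c))^-1.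
  by rewrite rmorphN fmorphV !rmorphM se !hfcj mulNr invrN [hf d c * _]mulrC.
have [h hN hE] := N0_tv cc sm; exists (g * h)%g; first by rewrite groupM.
exists (e * hf c d); first by rewrite mulf_neq0.
rewrite glactM gE hE /tv hfDl hfZl cc add0r.
case: (c) (d) n n' => [[c1 c2] c3] [[d1 d2] d3]; move: (hf _ _) (hf _ _) => a b a0 b0.
by rewrite /vadd /vsc /=; apply: vecE; field; rewrite a0 b0 e0.
Qed.

(* On the coordinates with respect to c and e this is the usual factorisation
   of diag(a, 1/a) into four elementary matrices of SL_2. *)
Lemma N0_torus c e a : hf c c = 0 -> hf e e = 0 -> hf e c = 1 -> cj a = a -> a != 0 ->
  exists2 g : {'GL_3[F]}, g \in N0 & forall u,
    glact g u = vadd (vadd u (vsc ((a - 1) * hf u e) c)) (vsc ((a^-1 - 1) * hf u c) e).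
Proof.
move=> cc ee ec ca a0; have ce : hf c e = 1 by rewrite -hfcj ec rmorph1.
have [t t0 st] := skew_ex q_gt1 cardF cjE.
have s1 : cj (- (t * (a - 1) / a)) = - - (t * (a - 1) / a).
  by rewrite rmorphN rmorphM rmorphM rmorphB rmorph1 fmorphV st ca !mulNr.
have s2 : cj t^-1 = - t^-1 by rewrite fmorphV st invrN.
have s3 : cj (t * (a - 1)) = - (t * (a - 1)) by rewrite rmorphM rmorphB rmorph1 st ca mulNr.
have s4 : cj (- (a * t)^-1) = - - (a * t)^-1.
  by rewrite rmorphN fmorphV rmorphM st ca mulrN invrN.
have [g1 n1 h1] := N0_tv cc s1; have [g2 n2 h2] := N0_tv ee s2.
have [g3 n3 h3] := N0_tv cc s3; have [g4 n4 h4] := N0_tv ee s4.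
exists (g1 * g2 * g3 * g4)%g; first by rewrite !groupM.
move=> u; rewrite !glactM h1 h2 h3 h4 /tv.
rewrite !(hfDl, hfZl) cc ee ec ce !mulr0 !mulr1 !addr0.
move: (hf u c) (hf u e) => x y; case: u c e {h1 h2 h3 h4 cc ee ec ce} => [[u1 u2] u3] [[c1 c2] c3] [[d1 d2] d3].
by rewrite /vadd /vsc /=; apply: vecE; field; rewrite a0 t0.
Qed.

Lemma N0_same_block c d y : hf c c = 0 -> hf d d = 0 -> hf d c = 1 ->
  hf (vadd d (vsc y c)) (vadd d (vsc y c)) = 0 ->
  exists2 g : {'GL_3[F]}, g \in N0 & glact g c = c /\ glact g d = vadd d (vsc y c).
Proof.
move=> cc dd dc; have cd : hf c d = 1 by rewrite -hfcj dc rmorph1.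
rewrite !hfDl !hfDr !hfZl !hfZr cc dd dc cd !mulr0 !mulr1 addr0 add0r => /eqP.
rewrite addr_eq0 => /eqP sy; have [g gN gE] := N0_tv cc sy.
exists g => //; rewrite !gE /tv cc dc mulr0 mulr1; split=> //.
by rewrite vsc0 vadd0.
Qed.

Lemma N0_2trans c d d' : (2 < q)%N -> c != vec0 F -> d != vec0 F -> d' != vec0 F ->
  hf c c = 0 -> hf d d = 0 -> hf d' d' = 0 -> ~~ par c d -> ~~ par c d' ->
  exists2 g : {'GL_3[F]}, g \in N0 & par (glact g c) c /\ par (glact g d) d'.
Proof.
move=> q2 c0 d0 d'0 cc dd dd' nd nd'.
have n1 : hf d c != 0 by rewrite isotropic_hf // par_sym.
have n2 : hf d' c != 0 by rewrite isotropic_hf // par_sym.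
wlog e1 : d d0 dd nd n1 / hf d c = 1 => [W|].
  have k0 : (hf d c)^-1 != 0 by rewrite invr_eq0.
  have [|||||g gN [gc gd]] := W (vsc (hf d c)^-1 d).
  - by rewrite vsc_eq0 negb_or k0.
  - by rewrite hfZl hfZr dd !mulr0.
  - by rewrite parZr.
  - by rewrite hfZl mulVf ?oner_eq0.
  - by rewrite hfZl mulVf.
  by exists g => //; split=> //; move: gd; rewrite glactZ parZl.
wlog e2 : d' d'0 dd' nd' n2 / hf d' c = 1 => [W|].
  have k0 : (hf d' c)^-1 != 0 by rewrite invr_eq0.
  have [|||||g gN [gc gd]] := W (vsc (hf d' c)^-1 d').
  - by rewrite vsc_eq0 negb_or k0.
  - by rewrite hfZl hfZr dd' !mulr0.
  - by rewrite parZr.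
  - by rewrite hfZl mulVf ?oner_eq0.
  - by rewrite hfZl mulVf.
  by exists g => //; split=> //; move: gd; rewrite parZr.
have [a [a0 a1 ca]] := fixed_gt2 q_gt1 cardF cjE q2.
have b0 : a^-1 - 1 != 0.
  by rewrite subr_eq0; apply: contra a1 => /eqP e; rewrite -[a]invrK e invr1.
(* [e0] solves d + (1/a - 1) e0 = d'/a. Once made isotropic by a multiple of [c], it gives a torus
   element that takes [d] to d'/a modulo [c]; a transvection with centre [c] removes the rest. This
   needs [a] different from 0 and 1. *)
have [e0 e0E] : exists e0, e0 = vsc (a^-1 - 1)^-1 (vadd (vsc a^-1 d') (vsc (-1) d)) by eexists.
have e0c : hf e0 c = 1 by rewrite e0E hfZl hfDl !hfZl e1 e2 !mulr1 mulVf.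
have he : cj (- hf e0 e0) = - hf e0 e0 by rewrite rmorphN hfcj.
have [x ex] := trace_ex q_gt1 cardF cjE he.
pose e := vadd e0 (vsc x c).
have ec : hf e c = 1 by rewrite hfDl hfZl cc mulr0 addr0.
have ce0 : hf c e0 = 1 by rewrite -hfcj e0c rmorph1.
have ee : hf e e = 0.
  rewrite hfDl !hfDr !hfZl !hfZr cc ce0 e0c !mulr1 !mulr0 addr0 -addrA [cj x + x]addrC ex.
  by rewrite subrr.
have [g gN gE] := N0_torus cc ee ec ca a0.
have ce : hf c e = 1 by rewrite -hfcj ec rmorph1.
pose y := (a - 1) * hf d e + (a^-1 - 1) * x.
have gd : glact g d = vsc a^-1 (vadd d' (vsc (a * y) c)).
  rewrite gE e1 mulr1 /y; move: (hf d e) => t; rewrite /e e0E.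
  case: (c) (d) (d') => [[c1 c2] c3] [[u1 u2] u3] [[w1 w2] w3].
  by rewrite /vadd /vsc /=; apply: vecE; field; rewrite a0 mulN1r subr_eq0 eq_sym a1.
clearbody y; have gc : glact g c = vsc a c.
  rewrite gE ce cc mulr0 vsc0 vadd0 mulr1; case: (c) => [[c1 c2] c3].
  by rewrite /vadd /vsc /=; apply: vecE; ring.
pose d1 := vadd d' (vsc (a * y) c).
have d1E : d1 = vsc a (glact g d) by rewrite gd vscA mulfV // vsc1.
have gS : g \in S by apply: (subsetP N0_sub).
have d1d1 : hf d1 d1 = 0 by rewrite d1E hfZl hfZr glact_hf // dd !mulr0.
have d1c : hf d1 c = 1 by rewrite hfDl hfZl cc mulr0 addr0.
have e' : d' = vadd d1 (vsc (- (a * y)) c).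
  by rewrite /d1; case: (d') (c) => [[w1 w2] w3] [[c1 c2] c3]; rewrite /vadd /vsc /=; apply: vecE; ring.
have [|h hN [hc hd]] := @N0_same_block c d1 (- (a * y)) cc d1d1 d1c; first by rewrite -e'.
exists (g * h)%g; first by rewrite groupM.
rewrite !glactM gc gd !glactZ hc -/d1 hd -e'; split; exact: par_vsc.
Qed.

(** The unipotent elements fixing (1, 0, 0); those with [a] zero are the transvections with this
    centre. *)
Definition qm a b : 'M[F]_3 := mxv (1, 0, 0) (- cj a, 1, 0) (b, a, 1).

Lemma qm_in a b : b + cj b + a * cj a = 0 -> gl (qm a b) \in S /\
  forall u, glact (gl (qm a b)) u = (u.1.1 - cj a * u.1.2 + b * u.2, u.1.2 + a * u.2, u.2).
Proof.
move=> h; have qE u : mulv (qm a b) u = (u.1.1 - cj a * u.1.2 + b * u.2, u.1.2 + a * u.2, u.2).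
  by rewrite mulv_mxv; case: u => [[u1 u2] u3]; rewrite /vadd /vsc /=; apply: vecE; ring.
have un : qm a b *m A0 F *m (map_mx cj (qm a b))^T = A0 F.
  apply: hf_unitary => u w; rewrite !qE; case: u w => [[u1 u2] u3] [[w1 w2] w3].
  rewrite /hf /dot /sharp /= !(rmorphD, rmorphM, rmorphN, rmorphB) /= cj2.
  have -> : cj b = - b - a * cj a by apply/eqP; rewrite -subr_eq0 -h; apply/eqP; ring.
  by ring.
have uu := unitary_unit un; rewrite in_SU3 /glact glK // un eqxx; split=> //.
rewrite det_mxv /det3 /dot /cross /=; apply/eqP; ring.
Qed.

Lemma transvection_der1 (g : {'GL_3[F]}) : g \in X -> g \in [~: S, S]%g.
Proof.
move=> gX; have [c [l [cc sl gE]]] := transvectionP gX.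
have [c0|c0] := eqVneq c (vec0 F).
  have -> : g = 1%g.
    apply: glact_inj => u; rewrite gE glact1 /tv c0; move: (l * _) => k.
    by case: u => [[u1 u2] u3]; rewrite /vadd /vsc /=; apply: vecE; ring.
  exact: group1.
have e10 : (1, 0, 0) != vec0 F by rewrite !xpair_eqE oner_eq0.
have e1e : hf (1, 0, 0) (1, 0, 0) = 0.
  by rewrite /hf /dot /sharp /= !rmorph0 rmorph1 !mul0r !mulr0 !addr0.
have [h hN [k k0 hc]] := N0_trans c0 e10 cc e1e.
have hS : h \in S by apply: (subsetP N0_sub).
rewrite -(memJ_norm _ (_ : h \in 'N([~: S, S]))%g); last first.
  by apply: subsetP hS; apply: (subset_trans _ (commg_normr _ _)).
pose m := l * (k * cj k).
have sm : cj m = - m by rewrite !rmorphM cj2 sl mulNr [cj k * k]mulrC.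
have hfe (w : vec) : hf w (1, 0, 0) = w.2.
  case: w => [[w1 w2] w3]; rewrite /FigueroaVectors.hf /dot /FigueroaVectors.sharp /= !rmorph0 rmorph1.
  by rewrite !mulr0 !add0r mulr1.
have [gh ghE hE] : exists2 gh : {'GL_3[F]}, (g ^ h)%g = gh & forall u, glact gh u = (u.1.1 + m * u.2, u.1.2, u.2).
  exists (g ^ h)%g => // u; rewrite conjgE !glactM gE tvJ // hc /tv hfZr hfe.
  by case: u => [[u1 u2] u3]; rewrite /vadd /vsc /= /m; apply: vecE; ring.
clearbody m; have [th eth] := trace1_ex q_gt1 cardF cjE.
have b1 : - th + cj (- th) + 1 * cj 1 = 0.
  by rewrite rmorphN rmorph1 mulr1 -opprD eth addNr.
(* Elements [qm] with first parameters 1 and m th have as commutator the transvection with parameter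
   m th - cj (m th), which is m since [th] has trace 1. *)
have b2 : - (m * th * cj (m * th)) * th + cj (- (m * th * cj (m * th)) * th)
     + m * th * cj (m * th) = 0.
  rewrite !(rmorphM, rmorphN) /= !cj2 sm; have -> : cj th = 1 - th by rewrite -eth addrC addKr.
  by ring.
have [q1S q1E] := qm_in b1; have [q2S q2E] := qm_in b2.
set Q1 := gl _ in q1S q1E; set Q2 := gl _ in q2S q2E.
rewrite ghE; have -> : (gh = [~ Q1^-1, Q2^-1])%g.
  have key : (gh * (Q2 * Q1) = Q1 * Q2)%g.
    apply: glact_inj => u; rewrite glactM hE glactM q2E q1E [RHS]glactM q1E q2E.
    case: u => [[u1 u2] u3] /=; rewrite rmorph1 rmorphM sm.
    have -> : cj th = 1 - th by rewrite -eth addrC addKr.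
    by apply: vecE; ring.
  exact: eq_commg_inv key.
by apply: mem_commg; rewrite groupV.
Qed.

Section Derived.

(** For q > 2 its elements are diagonal. For q = 2 the group generated by transvections is not known
    to be transitive on pairs, so only one point is stabilised and the elements are triangular. *)
Let stab : {set {'GL_3[F]}} :=
  [set g in S | par (glact g (1, 0, 0)) (1, 0, 0) &&
     ((2 < q)%N ==> par (glact g (0, 0, 1)) (0, 0, 1))].

Let par1 (u : vec) : par u (1, 0, 0) -> u = (u.1.1, 0, 0).
Proof.
case: u => [[a b] c]; rewrite /par /cross /= => /eqP[_]; rewrite !mulr1 !mulr0 subr0 sub0r.
by move=> -> /eqP; rewrite oppr_eq0 => /eqP ->.
Qed.

Let par3 (u : vec) : par u (0, 0, 1) -> u = (0, 0, u.2).
Proof.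
case: u => [[a b] c]; rewrite /par /cross /= => /eqP[]; rewrite !mulr1 !mulr0 subr0 sub0r.
by move=> -> /eqP; rewrite oppr_eq0 => /eqP ->.
Qed.

Let glactE g (u : vec) : glact g u = vadd (vadd (vsc u.1.1 (glact g (1, 0, 0)))
  (vsc u.1.2 (glact g (0, 1, 0)))) (vsc u.2 (glact g (0, 0, 1))).
Proof.
rewrite -!glactZ -!glactD; congr (glact g _); case: u => [[a b] c].
by rewrite /vadd /vsc /=; apply: vecE; ring.
Qed.

Let h12 : hf (0, 1, 0) (1, 0, 0) = 0.
Proof. by rewrite /hf /dot /sharp /= !rmorph0 rmorph1; ring. Qed.
Let h32 : hf (0, 1, 0) (0, 0, 1) = 0.
Proof. by rewrite /hf /dot /sharp /= !rmorph0 rmorph1; ring. Qed.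
Let h31 : hf (0, 0, 1) (1, 0, 0) = 1.
Proof. by rewrite /hf /dot /sharp /= !rmorph0 rmorph1; ring. Qed.
Let e1n : (1, 0, 0) != vec0 F. Proof. by rewrite !xpair_eqE oner_eq0. Qed.
Let e3n : (0, 0, 1) != vec0 F. Proof. by rewrite !xpair_eqE oner_eq0 andbF. Qed.

Let stab_tri (g : {'GL_3[F]}) : g \in stab -> exists a b d x y z,
  [/\ glact g (1, 0, 0) = (a, 0, 0), glact g (0, 1, 0) = (x, b, 0), glact g (0, 0, 1) = (y, z, d),
      a != 0 & (2 < q)%N -> [/\ x = 0, y = 0 & z = 0]] /\ ((q <= 2)%N -> b = a /\ d = a).
Proof.
rewrite inE => /and3P[gS p1 p3].
have [a e1] : exists a, glact g (1, 0, 0) = (a, 0, 0) by exists (glact g (1, 0, 0)).1.1; exact: par1.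
have a0 : a != 0.
  by apply: contraTneq e1n => a0; rewrite negbK -(glact_eq0 g) e1 a0.
case E2: (glact g (0, 1, 0)) => [[x b] t]; case E3: (glact g (0, 0, 1)) => [[y z] d].
have t0 : t = 0.
  have := glact_hf (0, 1, 0) (1, 0, 0) gS; rewrite h12 e1 E2 /hf /dot /sharp /= !rmorph0 !mulr0 !add0r.
  by move/eqP; rewrite mulf_eq0 fmorph_eq0 (negPf a0) orbF => /eqP.
exists a, b, d, x, y, z; rewrite t0 in E2 *; split.
  split=> // q2; have := par3 (implyP p3 q2); rewrite E3 => -[y0 z0]; split=> //.
  have := glact_hf (0, 1, 0) (0, 0, 1) gS; rewrite h32 E2 E3 y0 z0 /hf /dot /sharp /=.
  rewrite !rmorph0 !mulr0 !addr0 => /eqP; rewrite mulf_eq0 fmorph_eq0 => /orP[/eqP //|/eqP d0].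
  by have := glact_eq0 g (0, 0, 1); rewrite E3 y0 z0 d0 (negPf e3n) eqxx.
move=> q2; have q2' : q = 2%N by lia.
(* For q = 2 the field has order 4, so the isometry condition and determinant 1 force the three
   diagonal entries to agree. *)
have c3 (w : F) : w != 0 -> w ^+ 3 = 1.
  move=> w0; apply: (mulfI w0); rewrite -exprS mulr1 -[RHS]expf_card cardF q2' //.
have da : d * cj a = 1.
  have := glact_hf (0, 0, 1) (1, 0, 0) gS; rewrite h31 e1 E3 /hf /dot /sharp /=.
  by rewrite !rmorph0 !mulr0 !add0r.
have dE : d = a.
  move: da; rewrite cjE q2' => da; apply: (mulIf (_ : a ^+ 2 != 0)); first by rewrite expf_eq0.
  by rewrite da -exprS c3.
split=> //; move: gS; rewrite in_SU3 => /andP[_ /eqP]; rewrite det3E.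
have r0 : tov (row j0 (GLval g)) = (a, 0, 0).
  rewrite -e1 /glact mulv_row; move: (tov _) (tov _) (tov _) => [[? ?] ?] [[? ?] ?] [[? ?] ?].
  by rewrite /vadd /vsc /=; apply: vecE; ring.
have r1 : tov (row j1 (GLval g)) = (x, b, 0).
  rewrite -E2 /glact mulv_row; move: (tov _) (tov _) (tov _) => [[? ?] ?] [[? ?] ?] [[? ?] ?].
  by rewrite /vadd /vsc /=; apply: vecE; ring.
have r2 : tov (row j2 (GLval g)) = (y, z, d).
  rewrite -E3 /glact mulv_row; move: (tov _) (tov _) (tov _) => [[? ?] ?] [[? ?] ?] [[? ?] ?].
  by rewrite /vadd /vsc /=; apply: vecE; ring.
rewrite r0 r1 r2 /det3 /dot /cross /= dE => h.
apply: (mulIf (_ : a ^+ 2 != 0)); first by rewrite expf_eq0.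
by rewrite -exprS c3 // -h; ring.
Qed.

(** Diagonal matrices commute. Triangular ones with constant diagonal commute up to an element that
    only adds a multiple of the third coordinate to the first, a transvection. *)
Let stab_comm (x y : {'GL_3[F]}) : x \in stab -> y \in stab -> exists2 t : {'GL_3[F]}, t \in N0 & (x * y = t * (y * x))%g.
Proof.
move=> xs ys; have xS : x \in S by move: xs; rewrite inE => /andP[].
have yS : y \in S by move: ys; rewrite inE => /andP[].
have [a [b [d [u [v [w [[x1 x2 x3 a0 xq] xq']]]]]]] := stab_tri xs.
have [a' [b' [d' [u' [v' [w' [[y1 y2 y3 a'0 yq] yq']]]]]]] := stab_tri ys.
have xE r : glact x r = (r.1.1 * a + r.1.2 * u + r.2 * v, r.1.2 * b + r.2 * w, r.2 * d).
  by case: r => [[r1 r2] r3]; rewrite glactE x1 x2 x3 /vadd /vsc /=; apply: vecE; ring.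
have yE r : glact y r = (r.1.1 * a' + r.1.2 * u' + r.2 * v', r.1.2 * b' + r.2 * w', r.2 * d').
  by case: r => [[r1 r2] r3]; rewrite glactE y1 y2 y3 /vadd /vsc /=; apply: vecE; ring.
have [q2|q2] := ltnP 2 q.
  exists 1%g; first exact: group1.
  have [? ? ?] := xq q2; have [? ? ?] := yq q2; subst u v w u' v' w'.
  rewrite mul1g; apply: glact_inj => r; rewrite !glactM !(xE, yE); case: r => [[r1 r2] r3] /=.
  by apply: vecE; ring.
have [? ?] := xq' q2; have [? ?] := yq' q2; subst b d b' d'.
pose k := (w * u' - w' * u) / (a * a').
pose t := (x * y * (y * x)^-1)%g.
have tS : t \in S by rewrite !(groupM, groupV).
have tE r : glact t r = (r.1.1 + k * r.2, r.1.2, r.2).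
  suff h r' : glact (x * y)%g r' = glact (y * x)%g (r'.1.1 + k * r'.2, r'.1.2, r'.2).
    by rewrite /t glactM h glactK.
  rewrite !glactM !(xE, yE); case: r' => [[r1 r2] r3] /=.
  by rewrite /k; apply: vecE; field; rewrite ?a0 ?a'0.
exists t; last by rewrite /t mulgKV.
have sk : cj k = - k.
  have := glact_hf (0, 0, 1) (0, 0, 1) tS; rewrite !tE /hf /dot /sharp /= !rmorphD !rmorphM !rmorph0 rmorph1.
  by rewrite !(mulr0, mul0r, mulr1, add0r, addr0, mul1r) => /eqP; rewrite addrC addr_eq0 => /eqP.
have e1e : hf (1, 0, 0) (1, 0, 0) = 0 by rewrite /hf /dot /sharp /= !rmorph0 rmorph1; ring.
apply/mem_gen/(@transvection_intro _ (1, 0, 0) k) => // r.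
case: r => [[r1 r2] r3]; rewrite tE /tv (_ : hf (r1, r2, r3) (1, 0, 0) = r3).
  by rewrite /vadd /vsc /= !mulr0 !addr0 mulr1.
by rewrite /FigueroaVectors.hf /dot /FigueroaVectors.sharp /= !rmorph0 rmorph1 !mulr0 !add0r mulr1.
Qed.

Let S_stab (g : {'GL_3[F]}) : g \in S -> exists2 n : {'GL_3[F]}, n \in N0 & (n * g)%g \in stab.
Proof.
move=> gS; set c := glact g^-1%g (1, 0, 0); set d := glact g^-1%g (0, 0, 1).
have gVS : (g^-1)%g \in S by rewrite groupV.
have h11 : hf (1, 0, 0) (1, 0, 0) = 0 by rewrite /hf /dot /sharp /= !rmorph0 rmorph1; ring.
have h33 : hf (0, 0, 1) (0, 0, 1) = 0 by rewrite /hf /dot /sharp /= !rmorph0 rmorph1; ring.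
have c0 : c != vec0 F by rewrite glact_eq0.
have d0 : d != vec0 F by rewrite glact_eq0.
have cc : hf c c = 0 by rewrite glact_hf.
have dd : hf d d = 0 by rewrite glact_hf.
have [n nN [k k0 nE]] := N0_trans e1n c0 h11 cc.
have nS : n \in S by apply: (subsetP N0_sub).
have [q2|q2] := ltnP 2 q; last first.
  exists n => //; rewrite inE groupM //= glactM nE glactZ glactKV par_vsc /=.
  by rewrite ltnNge q2.
set d1 := glact n (0, 0, 1).
have d10 : d1 != vec0 F by rewrite glact_eq0.
have d11 : hf d1 d1 = 0 by rewrite glact_hf.
have n1 : ~~ par c d1.
  apply/negP => /(par_exn c0 d10)[k' k'0 e].
  have : hf d1 (glact n (1, 0, 0)) = 1 by rewrite glact_hf.
  by rewrite nE e !hfZr d11 !mulr0 => /eqP; rewrite eq_sym oner_eq0.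
have n2 : ~~ par c d.
  apply/negP => /(par_exn c0 d0)[k' k'0 e].
  have : hf d c = 1 by rewrite glact_hf.
  by rewrite e !hfZr dd !mulr0 => /eqP; rewrite eq_sym oner_eq0.
have [m mN [mc md]] := N0_2trans q2 c0 d10 d0 cc d11 dd n1 n2.
have mS : m \in S by apply: (subsetP N0_sub).
exists (n * m)%g; first by rewrite groupM.
have pg u w : par u w -> w != vec0 F -> par (glact g u) (glact g w).
  by move=> p w0; have [r ->] := par_ex w0 p; rewrite glactZ par_vsc.
rewrite inE !groupM //= !glactM nE !glactZ parZl // q2 /=.
by have := pg _ _ mc c0; have := pg _ _ md d0; rewrite !glactKV => -> ->.
Qed.

Lemma N0_der1 : N0 = [~: S, S]%g :> {set _}.
Proof.
apply/eqP; rewrite eqEsubset; apply/andP; split.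
  rewrite gen_subG; apply/subsetP => g; exact: transvection_der1.
rewrite gen_subG; apply/subsetP => _ /imset2P[x y xS yS ->].
have NN z : z \in S -> z \in 'N(N0)%g by apply: (subsetP S_norm_N0).
have [n nN nx] := S_stab xS; have [m mN my] := S_stab yS.
have [t tN e] := stab_comm nx my.
exact: (commg_mod (NN _ xS) (NN _ yS) nN mN tN e).
Qed.

End Derived.

End UnitaryGroup.

(** * The group generated by the elations *)

Lemma pol_elationJ (T : finType) (I : rel T) (s t : {perm T}) c : I_aut I t ->
  pol_elation I s c -> pol_elation I (s ^ t)%g (t c).
Proof.
move=> tI [sI sc]; have tVI x y : I (t^-1 x)%g (t^-1 y)%g = I x y by rewrite -tI !permKV.
split=> [x y|x]; rewrite conjgE !permM; first by rewrite tI sI tVI.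
by rewrite -[x](permKV t) tI permK => /sc ->.
Qed.

Lemma unital_transfer (T T' : finType) m (X : {set T}) B (X' : {set T'}) B' :
  isomorphic_structures X B X' B' -> is_unital m X B -> is_unital m X' B'.
Proof.
case=> f [fi <- <-] [cX bX pX]; split; first by rewrite card_in_imset.
  move=> _ /imsetP[b /bX[bs cb] ->]; split; first exact: imsetS.
  by rewrite card_in_imset // => x y xb yb; apply: fi; apply: (subsetP bs).
have memf x b : x \in X -> b \in B -> (f x \in f @: b) = (x \in b).
  move=> xX /bX[/subsetP bs _]; apply/imsetP/idP => [[y yb e]|xb]; last by exists x.
  by rewrite (fi _ _ xX (bs _ yb) e).
move=> _ _ /imsetP[x xX ->] /imsetP[y yX ->] nxy.
have nxy' : x != y by apply: contra nxy => /eqP ->.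
have /eqP/cards1P[b0 b0E] := pX x y xX yX nxy'.
apply/eqP/cards1P; exists (f @: b0); apply/setP => b; rewrite !inE.
have : b0 \in [set b0] by rewrite inE.
rewrite -b0E inE => /andP[b0B xy0].
apply/andP/eqP => [[/imsetP[b1 b1B ->]]|->]; last first.
  by split; [exact: imset_f | rewrite !memf].
rewrite !memf // => xy1; have -> // : b1 = b0.
by apply/set1P; rewrite -b0E inE b1B.
Qed.

Section Action.

Variables (F K : finFieldType) (q : nat) (cjF : {rmorphism F -> F}).
Variables (fr cj : {rmorphism K -> K}) (iota : {rmorphism F -> K}).
Hypothesis q_gt1 : (1 < q)%N.
Hypothesis cardF : #|F| = (q ^ 2)%N.
Hypothesis cardK : #|K| = ((q ^ 2) ^ 3)%N.
Hypothesis cjFE : forall x, cjF x = x ^+ q.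
Hypothesis cjE : forall x, cj x = x ^+ (q ^ 3)%N.
Hypothesis frE : forall x, fr x = x ^+ (q ^ 2)%N.
Hypothesis fr3 : forall x, fr (fr (fr x)) = x.
Hypothesis cj2 : forall x, cj (cj x) = x.
Hypothesis cjfr : forall x, cj (fr x) = fr (cj x).
Hypothesis fr_iota : forall a, fr (iota a) = iota a.
Hypothesis cj_iota : forall a, cj (iota a) = iota (cjF a).
Hypothesis iota_im : forall x, fr x = x -> exists a, x = iota a.
Variables (T : finType) (v : T -> vec K) (x0 : T).
Hypothesis v_neq0 : forall x, v x != vec0 K.
Hypothesis v_surj : forall u : vec K, u != vec0 K -> exists x, par (v x) u.
Hypothesis v_inj : forall x y, par (v x) (v y) -> x = y.
Variables (TF : finType) (vF : TF -> vec F) (y0 : TF).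
Hypothesis vF_neq0 : forall x, vF x != vec0 F.
Hypothesis vF_surj : forall u : vec F, u != vec0 F -> exists x, par (vF x) u.
Hypothesis vF_inj : forall x y, par (vF x) (vF y) -> x = y.

Local Notation III := (III fr).
Local Notation sharp := (sharp cj).
Local Notation hf := (hf cj).
Local Notation hfF := (FigueroaVectors.hf cjF).
Local Notation frv := (frv fr).
Local Notation Iv := (Iv fr cj).
Local Notation pt := (pt v x0).
Local Notation tIII := (tIII v fr).
Local Notation inD := (inD v fr).
Local Notation I := (I v fr cj).
Local Notation Dpts := (Dpts v fr).
Local Notation S := (SU3 q (A0 F)).
Local Notation X := (transvections cjF).
Local Notation N0 := (transvection_group cjF).

Let cjF2 := conjK cardF cjFE.
Let K_gt1 : (1 < #|K|)%N. Proof. exact: finNzRing_gt1. Qed.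
Let Isym : symmetric I. Proof. exact: I_symm. Qed.
Let Iuniq x y a b : x != y -> I x a -> I y a -> I x b -> I y b -> a = b.
Proof. exact: I_unique. Qed.
Let cardT : #|T| = (#|K| ^ 2 + #|K| + 1)%N. Proof. exact: (card_points x0). Qed.
Let card_pol y : #|[set x | I x y]| = #|K|.+1. Proof. exact: (card_polI x0). Qed.

Definition iv (u : vec F) : vec K := (iota u.1.1, iota u.1.2, iota u.2).

Lemma iv_tov r : iv (tov r) = tov (map_mx iota r). Proof. by rewrite /tov !mxE. Qed.
Lemma ofv_iv u : ofv (iv u) = map_mx iota (ofv u).
Proof. by rewrite -[u]ofvK iv_tov tovK ofvK. Qed.
Lemma iv_eq0 u : (iv u == vec0 K) = (u == vec0 F).
Proof. by case: u => [[a b] c]; rewrite !xpair_eqE !fmorph_eq0. Qed.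
Lemma iv_par u w : par (iv u) (iv w) = par u w.
Proof.
rewrite /par -[RHS]iv_eq0; congr (_ == _).
by rewrite /iv /cross /= !rmorphB !rmorphM.
Qed.
Lemma iv_hf u w : hf (iv u) (iv w) = iota (hfF u w).
Proof. by rewrite /FigueroaVectors.hf /dot /FigueroaVectors.sharp /= !rmorphD !rmorphM !cj_iota. Qed.
Lemma iv_vsc k u : iv (vsc k u) = vsc (iota k) (iv u).
Proof. by rewrite /iv /vsc /= !rmorphM. Qed.
Lemma iv_vadd u w : iv (vadd u w) = vadd (iv u) (iv w).
Proof. by rewrite /iv /vadd /= !rmorphD. Qed.
Lemma frv_iv u : frv (iv u) = iv u.
Proof. by rewrite /FigueroaVectors.frv /iv /= !fr_iota. Qed.
Lemma iv_nonIII u : ~~ III (iv u).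
Proof. by apply: fixed_nonIII; apply: frv_iv. Qed.
Lemma fixed_iv z : frv z = z -> exists u, z = iv u.
Proof.
case: z => [[a b] c] [/iota_im[a' ->] /iota_im[b' ->] /iota_im[c' ->]].
by exists (a', b', c').
Qed.
Lemma inD_iv x : inD x -> exists2 u, u != vec0 F & x = pt (iv u).
Proof.
move=> /(fixed_vec (v_neq0 x))[d [d0 fd pd]]; have [u e] := fixed_iv fd.
exists u; first by rewrite -iv_eq0 -e.
by apply/esym/eqP; rewrite pt_eq -?e // par_sym.
Qed.
Lemma pt_iv_inD u : u != vec0 F -> inD (pt (iv u)).
Proof. by move=> u0; apply: inD_pt; rewrite ?iv_eq0 ?frv_iv. Qed.
Lemma I_iv x u : u != vec0 F -> I x (pt (iv u)) = (hf (v x) (iv u) == 0).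
Proof.
move=> u0; have vu : iv u != vec0 K by rewrite iv_eq0.
by rewrite -[x](pt_v x0 v_neq0 v_surj v_inj) I_pt // Iv_ordr ?iv_nonIII // pt_v.
Qed.
Lemma I_iv2 u w : u != vec0 F -> w != vec0 F -> I (pt (iv u)) (pt (iv w)) = (hfF u w == 0).
Proof.
move=> u0 w0; rewrite I_pt ?iv_eq0 // Iv_ordr ?iv_nonIII // iv_hf.
exact: fmorph_eq0.
Qed.

Lemma isotropic_pair u : u != vec0 F -> hfF u u = 0 ->
  exists w, [/\ w != vec0 F, hfF w w = 0 & hfF w u != 0].
Proof.
case: u => [[a b] c] u0 uu.
have [a0|an] := eqVneq a 0; last first.
  exists (0, 0, 1); split; first by rewrite !xpair_eqE oner_eq0 andbF.
    by rewrite /FigueroaVectors.hf /dot /FigueroaVectors.sharp /= rmorph0 !mulr0 !mul0r !addr0.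
  by rewrite /FigueroaVectors.hf /dot /FigueroaVectors.sharp /= !mul0r !add0r mul1r fmorph_eq0.
exists (1, 0, 0); split; first by rewrite !xpair_eqE oner_eq0.
  by rewrite /FigueroaVectors.hf /dot /FigueroaVectors.sharp /= rmorph0 !mulr0 !mul0r !addr0.
rewrite /FigueroaVectors.hf /dot /FigueroaVectors.sharp /= !mul0r !addr0 mul1r fmorph_eq0; apply: contra u0 => /eqP c0.
move: uu; rewrite a0 c0 /FigueroaVectors.hf /dot /FigueroaVectors.sharp /= rmorph0 !mul0r add0r addr0 => /eqP.
by rewrite mulf_eq0 fmorph_eq0 orbb => /eqP ->.
Qed.

(** One point off the axis determines the parameter of a transvection. *)
Lemma tv_par_inj u l m w : u != vec0 F -> hfF u u = 0 -> hfF w u != 0 ->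
  par (tv cjF u l w) (tv cjF u m w) -> l = m.
Proof.
move=> u0 uu wu; rewrite /par /tv.
have -> : cross (vadd w (vsc (l * hfF w u) u)) (vadd w (vsc (m * hfF w u) u)) =
    vsc (m * hfF w u - l * hfF w u) (cross w u).
  by move: (hfF w u) => h; vr.
rewrite vsc_eq0 -mulrBl mulf_eq0 (negPf wu) orbF => /orP[|p].
  by rewrite subr_eq0 => /eqP.
by have [k e] := par_ex u0 p; move: wu; rewrite e hfZl uu mulr0 eqxx.
Qed.

Definition phi (x : TF) : T := pt (iv (vF x)).

Lemma phi_inj : injective phi.
Proof.
move=> x y /eqP; rewrite pt_inj ?iv_eq0 // iv_par; exact: vF_inj.
Qed.
Lemma phi_inD x : inD (phi x). Proof. exact: pt_iv_inD. Qed.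
Lemma inD_phi x : inD x -> exists y, x = phi y.
Proof.
move=> /inD_iv[u u0 ->]; have [y py] := vF_surj u0; exists y.
by apply/eqP; rewrite pt_inj ?iv_eq0 // iv_par par_sym.
Qed.
Lemma I_phi x y : I (phi x) (phi y) = (hfF (vF x) (vF y) == 0).
Proof. exact: I_iv2. Qed.

Lemma card_D : #|Dpts| = ((q ^ 2) ^ 2 + q ^ 2 + 1)%N.
Proof.
rewrite -cardF -(card_points y0 vF_neq0 vF_surj vF_inj) -cardsT -(card_imset _ phi_inj).
apply: eq_card => x; rewrite inE; apply/idP/imsetP => [/inD_phi[y ->]|[y _ ->]].
  by exists y.
exact: phi_inD.
Qed.

Definition mulK (g : {'GL_3[F]}) z := mulv (map_mx iota (GLval g)) z.

Lemma mulK_iv g u : mulK g (iv u) = iv (glact g u).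
Proof. by rewrite /mulK /glact /mulv ofv_iv -map_mxM -iv_tov. Qed.
Lemma mulKM (g h : {'GL_3[F]}) z : mulK (g * h)%g z = mulK h (mulK g z).
Proof. by rewrite /mulK GL_MxE map_mxM mulvM. Qed.
Lemma mulK1 z : mulK 1%g z = z.
Proof. by rewrite /mulK GL_1E map_mx1 mulv1. Qed.
Lemma mulKZ g k z : mulK g (vsc k z) = vsc k (mulK g z). Proof. exact: mulvZ. Qed.
Lemma mulK_eq0 g z : (mulK g z == vec0 K) = (z == vec0 K).
Proof. by apply: mulv_eq0; rewrite map_unitmx; apply: (GL_unit g). Qed.
Lemma mulK_par g a b : b != vec0 K -> par a b -> par (mulK g a) (mulK g b).
Proof. by move=> b0 p; have [k ->] := par_ex b0 p; rewrite mulKZ par_vsc. Qed.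
Lemma mulKK g z : mulK g^-1%g (mulK g z) = z.
Proof. by rewrite -mulKM mulgV mulK1. Qed.
Lemma mulK_parE g a b : b != vec0 K -> par (mulK g a) (mulK g b) = par a b.
Proof.
move=> b0; apply/idP/idP => [p|]; last exact: mulK_par.
by rewrite -(mulKK g a) -(mulKK g b) mulK_par ?mulK_eq0.
Qed.
Lemma frv_mulK g z : frv (mulK g z) = mulK g (frv z).
Proof.
have frt r : frv (tov r) = tov (map_mx fr r) by rewrite /tov !mxE.
have fro u : ofv (frv u) = map_mx fr (ofv u) by rewrite -[u]ofvK frt tovK ofvK.
rewrite /mulK /mulv frt map_mxM fro; congr (tov (_ *m _)).
by apply/matrixP => i j; rewrite !mxE fr_iota.
Qed.

(** Wider than [SU3]: the change of frame for type II centres may have another determinant. *)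
Definition isometry g := forall u w, hfF (glact g u) (glact g w) = hfF u w.

Lemma isometryV g : isometry g -> isometry g^-1%g.
Proof. by move=> h u w; rewrite -h !glactKV. Qed.

Lemma S_isometry g : g \in S -> isometry g.
Proof. by move=> gS u w; apply: (glact_hf cjFE). Qed.

Lemma hf_mulK g z w : isometry g -> hf (mulK g z) (mulK g w) = hf z w.
Proof.
move=> /hf_unitary h; apply: unitary_hf.
have e : map_mx iota (A0 F) = A0 K by apply/matrixP => i j; rewrite !mxE rmorph_nat.
rewrite -e -{2}h !map_mxM; congr (_ *m _).
by apply/matrixP => i j; rewrite !mxE cj_iota.
Qed.

Lemma III_mulK g z : isometry g -> III (mulK g z) = III z.
Proof. by move=> h; rewrite !(III_gram cjfr) !frv_mulK !hf_mulK. Qed.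

Lemma Iv_mulK g z w : isometry g -> Iv (mulK g z) (mulK g w) = Iv z w.
Proof.
move=> h; rewrite /FigueroaVectors.Iv !III_mulK //; case: (_ && _); last by rewrite hf_mulK.
by rewrite !hf_star !frv_mulK !hf_mulK.
Qed.

Definition pf_fun g x := pt (mulK g (v x)).

Lemma pf_inj g : injective (pf_fun g).
Proof.
move=> x y /eqP; rewrite pt_inj ?mulK_eq0 // mulK_parE //; exact: v_inj.
Qed.

Definition pf g : {perm T} := perm (@pf_inj g).

Lemma pf_pt g u : u != vec0 K -> pf g (pt u) = pt (mulK g u).
Proof.
move=> u0; rewrite permE; apply/eqP; rewrite pt_inj ?mulK_eq0 // mulK_parE //.
exact: ptP.
Qed.

Lemma pfE g x : pf g x = pt (mulK g (v x)). Proof. by rewrite permE. Qed.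

Lemma pf_iv g u : u != vec0 F -> pf g (pt (iv u)) = pt (iv (glact g u)).
Proof. by move=> u0; rewrite pf_pt ?iv_eq0 // mulK_iv. Qed.

Lemma pfM (g h : {'GL_3[F]}) : pf (g * h)%g = (pf g * pf h)%g.
Proof. by apply/permP => x; rewrite permM [LHS]pfE [pf g x]pfE pf_pt ?mulK_eq0 // mulKM. Qed.

Canonical pf_morphism := @Morphism _ _ 'GL_3[F]%g pf (in2W pfM).

Lemma pf_aut g : isometry g -> I_aut I (pf g).
Proof.
move=> h x y; rewrite !pfE I_pt ?mulK_eq0 // Iv_mulK //.
Qed.

Lemma inD_par x u : u != vec0 K -> par (v x) u -> inD x = par u (frv u).
Proof.
move=> u0 /(par_exn (v_neq0 x) u0)[k k0 e].
by rewrite /ProjectiveCoordinates.inD e frvZ parZl // parZr ?fmorph_eq0.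
Qed.

Lemma inD_pf g x : inD (pf g x) = inD x.
Proof.
have n0 : mulK g (v x) != vec0 K by rewrite mulK_eq0.
rewrite (inD_par n0); last by rewrite pfE; apply: ptP.
by rewrite frv_mulK mulK_parE // frv_eq0.
Qed.

Lemma map_tm c l : map_mx iota (tm cjF c l) = tm cj (iv c) (iota l).
Proof.
have tvi u : iv (tv cjF c l u) = tv cj (iv c) (iota l) (iv u).
  by rewrite /tv iv_vadd iv_vsc rmorphM iv_hf.
have e (a b d : F) : iv (a, b, d) = (iota a, iota b, iota d) by [].
rewrite /tm -[(1, 0, 0)]/(1%R, 0%R, 0%R); apply/row_matrixP => i.
rewrite -map_row !rowK; case: (ord3P i) => -> /=;
  by rewrite -ofv_iv tvi /iv /= rmorph1 !rmorph0.
Qed.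

Lemma mulK_tv g c l z : hfF c c = 0 -> cjF l = - l -> (forall u, glact g u = tv cjF c l u) ->
  mulK g z = tv cj (iv c) (iota l) z.
Proof.
move=> cc sl h; have -> : g = gl (tm cjF c l) by apply: glact_inj => u; rewrite h (glact_tm cardF cjFE).
rewrite /mulK glK; last exact: (unitary_unit (tm_unitary cardF cjFE cc sl)).
by rewrite map_tm tmE.
Qed.

Lemma tv_elation g c l : c != vec0 F -> hfF c c = 0 -> cjF l = - l ->
  (forall u, glact g u = tv cjF c l u) -> pol_elation I (pf g) (pt (iv c)).
Proof.
move=> c0 cc sl h; split; last first.
  move=> x; rewrite I_iv // => /eqP e; rewrite pfE (mulK_tv _ cc sl h) /tv e mulr0 vsc0 vadd0.
  by rewrite pt_v.
apply: pf_aut => u w; rewrite !h; exact: (hf_tv cardF cjFE).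
Qed.

Local Notation abs := (abs_points I).
Local Notation lns := (polar_lines I).

Definition unital_elations := [set s : {perm T} | is_elation lns s && (s @: abs == abs)].

Lemma elation_in s c : I c c -> pol_elation I s c -> s \in unital_elations.
Proof.
move=> cc sE; have [sI sc] := sE; rewrite inE aut_abs // eqxx andbT /is_elation.
rewrite aut_automorphism //=; apply/exists_inP; exists (pol I c); first exact: pol_line.
apply/exists_inP; exists c; first by rewrite in_pol.
apply/andP; split; first by apply/forall_inP => x; rewrite in_pol => /sc ->.
apply/forall_inP => _ /imsetP[y _ ->]; rewrite in_pol; apply/implyP => cy.
by rewrite aut_pol // sc // Isym.
Qed.

Let e1 : vec F := (1, 0, 0).
Let e1n : e1 != vec0 F. Proof. by rewrite !xpair_eqE oner_eq0. Qed.
Let e1e : hfF e1 e1 = 0.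
Proof. by rewrite /FigueroaVectors.hf /dot /FigueroaVectors.sharp /= !rmorph0 !mulr0 mul0r !addr0. Qed.
Let hfe1 z : hf z (iv e1) = z.2.
Proof.
by rewrite /FigueroaVectors.hf /dot /FigueroaVectors.sharp /= !rmorph0 !rmorph1 !mulr0 !add0r mulr1.
Qed.

Lemma pf_X_sub g : g \in X -> pf g \in unital_elations.
Proof.
move=> /transvectionP[c [l [cc sl h]]]; have [c0|c0] := eqVneq c (vec0 F); last first.
  by apply: elation_in (tv_elation c0 cc sl h); rewrite I_iv2 // cc.
have h' u : glact g u = tv cjF e1 0 u.
  rewrite h /tv c0 mul0r vsc0 vadd0; move: (l * _) => k.
  by case: u => [[u1 u2] u3]; rewrite /vadd /vsc /= !mulr0 !addr0.
have s0 : cjF 0 = - 0 by rewrite rmorph0 oppr0.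
by apply: elation_in (tv_elation e1n e1e s0 h'); rewrite I_iv2 // e1e.
Qed.

Let q2_ge4 : (4 <= q ^ 2)%N. Proof. by rewrite -mulnn; exact: (leq_mul q_gt1 q_gt1). Qed.

Let q3_gt1 : (1 < q ^ 3)%N.
Proof. by apply: (leq_trans q_gt1); rewrite -{1}[q]expn1 leq_exp2l. Qed.

Let manyIII : (2 < #|K|.+1 - #|Dpts|)%N.
Proof.
rewrite cardK card_D; move: (q ^ 2)%N q2_ge4 => r r4; nia.
Qed.

(** Conjugation by an element of [N0] moves the centre to (1, 0, 0), where the elation is linear
    with parameter in the subfield. *)
Lemma typeI_in s c : I c c -> pol_elation I s c -> inD c -> exists2 g, g \in X & s = pf g.
Proof.
move=> cc sE Dc; have [u u0 cE] := inD_iv Dc.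
have uu : hfF u u = 0 by apply/eqP; rewrite -I_iv2 // -cE.
have [g gN [k k0 gu]] := N0_trans q_gt1 cardF cjFE u0 e1n uu e1e.
have gS : g \in S by apply: (subsetP (N0_sub cardF cjFE)).
have sE' := pol_elationJ (pf_aut (S_isometry gS)) sE.
have c1 : par (v (pf g c)) (1, 0, 0).
  rewrite cE pf_iv // gu; have nz : iv (vsc k e1) != vec0 K by rewrite iv_eq0 vsc_eq0 negb_or k0.
  apply: (@par_trans _ (iv (vsc k e1))) => //; first exact: ptP.
  rewrite iv_vsc parZl ?fmorph_eq0 // /iv /= rmorph1 rmorph0; exact: paruu.
have [lam [flam clam sl]] := typeI_linear x0 v_neq0 v_surj v_inj fr3 cj2 cjfr sE' c1 manyIII.
have [l lE] := iota_im flam; rewrite {}lE in flam clam sl.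
have cl : cjF l = - l by apply: (fmorph_inj iota); rewrite -cj_iota clam rmorphN.
pose t := gl (tm cjF e1 l).
have tX : t \in X by apply: (transvection_in cardF cjFE).
have te w : glact t w = tv cjF e1 l w by apply: (glact_tm cardF cjFE).
have sE2 : (s ^ pf g)%g = pf t.
  apply/permP => x; rewrite pfE; apply/esym/eqP; rewrite pt_eq ?mulK_eq0 // par_sym.
  rewrite (mulK_tv _ e1e cl te) /tv hfe1; have := sl x; case: (v x) => [[a b] d].
  by rewrite /vadd /vsc /iv /= rmorph1 rmorph0 !mulr0 !addr0 mulr1.
exists (t ^ g^-1)%g; first by apply: (transvectionJ cardF cjFE); rewrite ?groupV.
have -> : pf (t ^ g^-1)%g = (pf t ^ (pf g)^-1)%g.
  by rewrite (morphJ pf_morphism) ?inE //= (morphV pf_morphism) ?inE.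
by rewrite -sE2 conjgK.
Qed.

(** Let [r] be the pole of the subplane line through [c]. It is not isotropic, since otherwise that
    line would be tangent and [c] equal to [r]; so a frame with [r] in the middle brings [c] to the
    form (gam, 0, 1). *)
Lemma typeII_contra s c : I c c -> pol_elation I s c -> s != 1%g ->
  ~~ tIII c -> ~~ inD c -> False.
Proof.
move=> cc sE sn nIc nDc.
have [d [d0 fd dc]] := nonIII_fixed_orth nIc.
have fR : frv (sharp d) = sharp d by rewrite -sharp_frv // fd.
have [r rE] := fixed_iv fR.
have r0 : r != vec0 F by rewrite -iv_eq0 -rE sharp_eq0.
have cr : hf (v c) (iv r) = 0 by rewrite -rE /FigueroaVectors.hf sharpK // dotC.
have rr : hfF r r != 0.
  apply/eqP => rr; have Ir : I (pt (iv r)) (pt (iv r)) by rewrite I_iv2 // rr.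
  have cE : c = pt (iv r).
    by apply: (abs_pol1 Isym Iuniq) => //; rewrite I_iv // cr.
  by move: nDc; rewrite cE pt_iv_inD.
have A0h : (map_mx cjF (A0 F))^T = A0 F.
  by apply/matrixP => i j; rewrite !mxE rmorph_nat addnC.
rewrite hf_mx in rr.
have [B [BE [k k0 Br]]] := frame_ex q_gt1 cardF cjFE A0h (A0_unit F) rr.
pose g := gl B; have gE : GLval g = B by rewrite glK // (unitary_unit BE).
have gI : isometry g by move=> u w; rewrite /glact gE; apply: unitary_hf.
pose h := (g^-1)%g; have hI : isometry h by apply: isometryV.
have hr : glact h r = vsc k^-1 (0, 1, 0).
  have -> : r = vsc k^-1 (glact g (0, 1, 0)).
    rewrite /glact gE mulv_row Br tovZ ofvK /= !vsc0 vsc1; apply/esym.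
    by case: (r) => [[a b] e]; rewrite /vadd /vsc /=; apply: vecE; field.
  by rewrite glactZ glactK.
have sE' := pol_elationJ (pf_aut hI) sE.
set c1 := pf h c in sE'; have n0 : mulK h (v c) != vec0 K by rewrite mulK_eq0.
have pc1 : par (v c1) (mulK h (v c)) by rewrite /c1 pfE; apply: ptP.
have mid : (mulK h (v c)).1.2 = 0.
  have := hf_mulK (v c) (iv r) hI; rewrite cr mulK_iv hr iv_vsc hfZr => /eqP.
  have kn : cj (iota k^-1) != 0 by rewrite fmorph_eq0 fmorph_eq0 invr_eq0.
  rewrite mulf_eq0 (negPf kn) orFb => /eqP.
  by rewrite /FigueroaVectors.hf /dot /FigueroaVectors.sharp /= !rmorph0 !rmorph1 !mulr0 mulr1 add0r addr0.
have ab : hf (mulK h (v c)) (mulK h (v c)) = 0.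
  by rewrite hf_mulK //; move: cc; rewrite /ProjectiveCoordinates.I Iv_ordl // => /eqP.
case E: (mulK h (v c)) => [[a b] e]; rewrite E /= in mid ab n0 pc1; rewrite {}mid in E ab n0 pc1.
have nD1 : ~~ inD c1 by rewrite inD_pf.
have en : e != 0.
  apply: contra nD1 => /eqP e0; rewrite (inD_par n0 pc1) e0 /FigueroaVectors.frv /= rmorph0.
  by rewrite /par /cross /= !(mulr0, mul0r) subrr.
have p2 : par (v c1) (a / e, 0, 1).
  apply: par_trans n0 pc1 _; rewrite /par /cross /=.
  by apply/eqP; apply: vecE; field.
have n2 : (a / e, 0, 1) != vec0 K by rewrite !xpair_eqE oner_eq0 andbF.
have cg : cj (a / e) = - (a / e).
  move: ab; rewrite /FigueroaVectors.hf /dot /FigueroaVectors.sharp /= rmorph0 mulr0 addr0 rmorphM fmorphV => ab.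
  apply/eqP; rewrite -addr_eq0 -(mulrI_eq0 _ (lregP (_ : e * cj e != 0))); last first.
    by rewrite mulf_neq0 ?fmorph_eq0.
  apply/eqP; rewrite -[RHS]ab; move: (cj a) (cj e) (fmorph_eq0 cj e) => a' e' h'.
  by field; rewrite h' en.
have ng : fr (a / e) != a / e.
  apply: contra nD1 => /eqP fe; rewrite (inD_par n2 p2) /FigueroaVectors.frv /= fe rmorph0 rmorph1.
  exact: paruu.
have F3 : exists f g, [/\ fr f = f, fr g = g, f != 0, g != 0 & [&& f != 1, g != 1 & f != g]].
  have : (1 < #|[set: F] :\: [set 0%R; 1%R]|)%N.
    rewrite cardsD setTI cardsT cardF cards2 eq_sym oner_eq0 /=.
    by rewrite ltn_subRL; exact: q2_ge4.
  case/card_gt1P => x [y []]; rewrite !inE !negb_or !andbT => /andP[x0' x1] /andP[y0' y1] xy.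
  exists (iota x), (iota y); rewrite !fr_iota !fmorph_eq0 !fmorph_eq1 x0' x1 y0' y1; split=> //.
  by rewrite (inj_eq (fmorph_inj iota)).
apply: (typeII_false x0 v_neq0 v_surj v_inj fr3 cj2 cjfr K_gt1 sE' p2 cg ng F3).
by apply: contra sn; rewrite -(conjg_eq1 s (pf h)).
Qed.

Lemma D_I_nonIII x y : inD x -> I x y -> ~~ tIII y.
Proof.
move=> /inD_iv[u u0 ->]; rewrite Isym I_iv // => /eqP h.
have := fixed_orth_nonIII (d := sharp (iv u)) _ _ _; apply; rewrite ?sharp_eq0 ?iv_eq0 //.
  by rewrite -sharp_frv // frv_iv.
by rewrite dotC.
Qed.

Lemma typeIII_contra s c : I c c -> pol_elation I s c -> s != 1%g -> tIII c -> False.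
Proof.
move=> cc sE sn Ic; have [q2|q2] := ltnP 2 q.
  apply: (typeIII_false x0 v_neq0 v_surj v_inj fr3 cj2 cjfr (leq_trans _ q2_ge4) frE cardK sE cc Ic sn) => //.
    by rewrite -mulnn; apply: leq_trans (leq_mul q2 q2).
  exact: card_D.
have q2' : q = 2%N by apply/eqP; rewrite eqn_leq q2 q_gt1.
have fr4 x : fr x = x ^+ 4 by rewrite frE q2'.
have cj8 x : cj x = x ^+ 8 by rewrite cjE q2'.
have cK : #|K| = 64%N by rewrite cardK q2'.
have char2 : 1 + 1 = 0 :> K.
  have : 2%N \in [pchar K] by apply: (card_finPcharP (n := 6)); rewrite ?cK.
  by move=> /andP[_ /eqP]; rewrite -[2%:R]/(1 + 1).
have [om om2] := order64_om_ex cK char2.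
have [z z3] := order64_z_ex cK char2.
apply: (typeIII_false_64 x0 v_neq0 v_surj v_inj fr3 cj2 cjfr fr4 cj8 cK char2 om2 z3 sE cc Ic sn).
(* An image in the subplane would make the line to [c] a subplane line. An image of type II would be
   the centre of a nontrivial elation, the conjugate by [s] of a transvection with centre [x]. *)
move=> x Dx xx; apply: contraT => nIy; exfalso.
have [sI sc] := sE; set y := s x in nIy.
have nIc : ~~ I x c by apply: contraTN Ic; apply: D_I_nonIII.
have nyx : y != x.
  apply: contra sn => /eqP e; apply/eqP.
  exact: (elation_fix x0 v_neq0 v_surj v_inj fr3 cj2 cjfr K_gt1 cc sE nIc e).
have yy : I y y by rewrite sI.
have [Dy|nDy] := boolP (inD y).
  have nxc : x != c by apply: contraTneq Ic => <-; apply: inD_nonIII.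
  have jP a b : a != b -> I a (jn I a b) && I b (jn I a b) by apply: (jnP (n := #|K|)).
  have /andP[xk ck] := jP _ _ nxc; set k := jn I x c in xk ck.
  have yk : I y k by rewrite -(sc k) ?sI // Isym.
  suff Dk : inD k by move: (D_I_nonIII Dk (etrans (Isym _ _) ck)); rewrite Ic.
  have [u u0 xE] := inD_iv Dx; have [w w0 yE] := inD_iv Dy.
  have npuw : ~~ par (iv u) (iv w) by move: nyx; rewrite eq_sym xE yE pt_inj ?iv_eq0.
  have k1 : hf (v k) (iv u) = 0 by apply/eqP; rewrite -I_iv // -xE Isym.
  have k2 : hf (v k) (iv w) = 0 by apply/eqP; rewrite -I_iv // -yE Isym.
  have n0 : sharp (cross (iv u) (iv w)) != vec0 K by rewrite sharp_eq0.
  have p : par (v k) (sharp (cross (iv u) (iv w))).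
    have h1 : dot (sharp (v k)) (iv u) = 0 by rewrite dotC -/(FigueroaVectors.hf cj _ _) hfC // k1 rmorph0.
    have h2 : dot (sharp (v k)) (iv w) = 0 by rewrite dotC -/(FigueroaVectors.hf cj _ _) hfC // k2 rmorph0.
    by rewrite -(sharp_par cj) sharpK // par_sym; apply: par_orth.
  rewrite (inD_par n0 p) -sharp_frv // frv_cross !frv_iv; exact: paruu.
have [u u0 xE] := inD_iv Dx.
have uu : hfF u u = 0 by apply/eqP; rewrite -I_iv2 // -xE.
have [e e0 ce] := skew_ex q_gt1 cardF cjFE.
pose t := gl (tm cjF u e); have tE w : glact t w = tv cjF u e w by apply: (glact_tm cardF cjFE).
have tel := tv_elation u0 uu ce tE; rewrite -xE in tel.
have tel' := pol_elationJ sI tel.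
apply: (typeII_contra yy tel') => //; rewrite conjg_eq1; apply/eqP => t1.
have [w [w0 _ wu]] := isotropic_pair u0 uu.
have := congr1 (fun p : {perm T} => p (pt (iv w))) t1; rewrite perm1 pf_iv // tE => /eqP.
have tw0 : tv cjF u e w != vec0 F by rewrite -tE glact_eq0.
rewrite pt_inj ?iv_eq0 // iv_par => p.
have p' : par (tv cjF u e w) (tv cjF u 0 w) by rewrite {2}/tv mul0r vsc0 vadd0.
by move: (tv_par_inj u0 uu wu p') => h; rewrite h eqxx in e0.
Qed.

Let nq : #|K| = ((q ^ 3) ^ 2)%N. Proof. by rewrite cardK -!expnM. Qed.

Lemma card_abs : #|abs| = ((q ^ 3) ^ 3 + 1)%N.
Proof.
by rewrite /abs_points card_abs_herm //; apply: (card_isotropic (s := (q ^ 3)%N)).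
Qed.

Lemma pf_X : [set pf g | g in X] = unital_elations.
Proof.
apply/setP => s; apply/imsetP/idP => [[g gX ->]|]; first exact: pf_X_sub.
rewrite inE => /andP[sE /eqP sa].
have : s = 1%g \/ exists2 c, I c c & pol_elation I s c.
  exact: (unital_elation Isym K_gt1 cardT card_pol Iuniq q3_gt1 nq card_abs sE sa).
case=> [->|[c cc sc]].
  have s0 : cjF 0 = - 0 by rewrite rmorph0 oppr0.
  exists 1%g; last by rewrite (morph1 pf_morphism).
  apply: (@transvection_intro _ _ _ cardF cjFE _ e1 0) => // u.
  by rewrite glact1 /tv mul0r vsc0 vadd0.
have [->|sn] := eqVneq s 1%g.
  have s0 : cjF 0 = - 0 by rewrite rmorph0 oppr0.
  exists 1%g; last by rewrite (morph1 pf_morphism).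
  apply: (@transvection_intro _ _ _ cardF cjFE _ e1 0) => // u.
  by rewrite glact1 /tv mul0r vsc0 vadd0.
have [Ic|nIc] := boolP (tIII c); first by case: (typeIII_contra cc sc sn Ic).
have [Dc|nDc] := boolP (inD c); last by case: (typeII_contra cc sc sn nIc nDc).
have [g gX ->] := typeI_in cc sc Dc; by exists g.
Qed.

Lemma pf_scalar (g : {'GL_3[F]}) a : (GLval g : 'M[F]_3) = a%:M -> pf g = 1%g.
Proof.
move=> gE; apply/permP => x; rewrite perm1 pfE; apply/eqP; rewrite pt_eq ?mulK_eq0 //.
have -> : mulK g (v x) = vsc (iota a) (v x).
  by rewrite /mulK gE map_scalar_mx /mulv mul_mx_scalar tovZ ofvK.
exact: par_vsc.
Qed.

(** Commuting with the elementary matrices 1 + E_ij forces equal diagonal entries and zeros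
    elsewhere. *)
Lemma scalar_center (g : {'GL_3[F]}) : g \in 'Z('GL_3[F])%g -> exists a, (GLval g : 'M[F]_3) = a%:M.
Proof.
case/centerP => _ gc; set A : 'M[F]_3 := GLval g.
have key (i j : 'I_3) : i != j -> forall k, A k i = A j j *+ (k == i).
  move=> nij k; pose D := (1%:M + delta_mx i j : 'M[F]_3).
  have dd : delta_mx i j *m delta_mx i j = 0 :> 'M[F]_3.
    by rewrite mul_delta_mx_cond eq_sym (negPf nij) mulr0n.
  have uD : D \in unitmx.
    suff h : D *m (1%:M - delta_mx i j) = 1%:M by case: (mulmx1_unit h).
    by rewrite mulmxBr mulmx1 mulmxDl mul1mx dd addr0 addrK.
  have := gc (gl D) (in_setT _); move/(congr1 (@GLval 3 F)); rewrite !GL_MxE glK // -/A.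
  rewrite mulmxDr mulmxDl mulmx1 mul1mx => /addrI /matrixP/(_ k j).
  rewrite !mxE (bigD1 i) //= !mxE !eqxx mulr1 big1 ?addr0; last first.
    by move=> l nl; rewrite !mxE (negPf nl) mulr0.
  move=> ->; rewrite (bigD1 j) //= !mxE eqxx andbT big1 ?addr0; last first.
    by move=> l nl; rewrite !mxE (negPf nl) andbF mul0r.
  by case: (k == i); rewrite ?mul1r ?mul0r.
exists (A j0 j0); apply/matrixP => k i; rewrite mxE.
have [j nij] : exists j : 'I_3, i != j.
  by have [e|ni] := eqVneq i j0; [exists j1; rewrite e | exists j0].
rewrite (key i j nij); congr (_ *+ _).
have [->//|nj] := eqVneq j j0.
by have := key j0 j; rewrite eq_sym nj => /(_ isT j0); rewrite eqxx.
Qed.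

(** An element acting trivially fixes all subplane points, so every vector over [F] is an
    eigenvector and the matrix is scalar. *)
Lemma ker_pf : ('ker pf = 'Z('GL_3[F]))%g.
Proof.
apply/setP => g; apply/idP/idP => [/kerP h|gZ]; last first.
  by apply/kerP; rewrite ?inE //; have [a /pf_scalar] := scalar_center gZ.
have {}h := h (in_setT _).
have par_g u : u != vec0 F -> par (glact g u) u.
  move=> u0; have := congr1 (fun s : {perm T} => s (pt (iv u))) h; rewrite perm1 pf_iv //.
  by move/eqP; rewrite pt_inj ?iv_eq0 ?glact_eq0 // iv_par.
have [a ga] : exists a, (GLval g : 'M[F]_3) = a%:M.
  have e2n : (0, 1, 0) != vec0 F by rewrite !xpair_eqE oner_eq0 !andbF.
  have e3n : (0, 0, 1) != vec0 F by rewrite !xpair_eqE oner_eq0 andbF.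
  have [a E1] := par_ex e1n (par_g _ e1n).
  have [b E2] := par_ex e2n (par_g _ e2n).
  have [d E3] := par_ex e3n (par_g _ e3n).
  have n12 : (1, 1, 0) != vec0 F by rewrite !xpair_eqE oner_eq0.
  have n13 : (1, 0, 1) != vec0 F by rewrite !xpair_eqE oner_eq0.
  have gE u : glact g u = (u.1.1 * a, u.1.2 * b, u.2 * d).
    have -> : u = vadd (vadd (vsc u.1.1 e1) (vsc u.1.2 (0, 1, 0))) (vsc u.2 (0, 0, 1)).
      by case: u => [[x y] z]; rewrite /vadd /vsc /=; apply: vecE; ring.
    rewrite !glactD !glactZ E1 E2 E3; case: u => [[x y] z].
    by rewrite /vadd /vsc /=; apply: vecE; ring.
  have ab : a = b.
    have := par_g _ n12; rewrite gE /par /cross /= !mul1r !mulr1 => /eqP[_ _ /eqP].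
    by rewrite subr_eq0 => /eqP.
  have ad : d = a.
    have := par_g _ n13; rewrite gE /par /cross /= !mul1r !mulr1 => /eqP[_ /eqP + _].
    by rewrite subr_eq0 => /eqP.
  exists a; apply: mulv_inj => u; rewrite -[LHS]/(glact g u) gE -ab ad.
  rewrite /mulv mul_mx_scalar tovZ ofvK; case: u => [[x y] z].
  by rewrite /vsc /=; apply: vecE; ring.
apply/centerP; split=> [|h' _]; first by rewrite inE.
have e : (GLval g : 'M[F]_3) *m GLval h' = GLval h' *m GLval g by rewrite ga mul_scalar_mx mul_mx_scalar.
by apply: val_inj; exact: e.
Qed.

Lemma elation_group_image : <<unital_elations>>%g = (pf @* [~: S, S])%g.
Proof.
rewrite -(N0_der1 q_gt1 cardF cjFE) -pf_X morphim_gen ?subsetT //.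
by rewrite morphimEsub ?subsetT.
Qed.

Lemma elation_group_isog (J : 'M[F]_3) (B : 'M[F]_3) :
  B *m J *m (map_mx cjF B)^T = A0 F ->
  <<unital_elations>>%g \isog [~: PSU3 q J, PSU3 q J]%g.
Proof.
move=> BE; have uB : B \in unitmx.
  by have := A0_unit F; rewrite -BE -mulmxA unitmx_mul => /andP[].
pose b := gl B; have bE : GLval b = B by rewrite glK.
(* The change of basis conjugates the two special unitary groups, and conjugation passes to the
   quotient by the centre. *)
have SJ : S = (SU3 q J :^ b^-1)%g.
  apply/setP => g; rewrite mem_conjgV !inE conjgE !GL_MxE !GL_VxE bE.
  rewrite !(map_mx_pow _ cjFE) !det_mulmx det_inv.
  congr (_ && _); last first.
    by rewrite mulrCA mulVf ?mulr1 // -unitfE -unitmxE.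
  rewrite !map_mxM !trmx_mul map_invmx.
  have uBc : (map_mx cjF B)^T \in unitmx by rewrite unitmx_tr map_unitmx.
  have eJ : J = invmx B *m A0 F *m invmx (map_mx cjF B)^T by rewrite -BE mulmxA mulKmx // mulmxK.
  rewrite {1}eJ trmx_inv !mulmxA mulmxK // mulmxKV //.
  move: (GLval g : 'M[F]_3) => A.
  have -> : invmx B *m A *m A0 F *m (map_mx cjF A)^T *m invmx (map_mx cjF B)^T =
      invmx B *m (A *m A0 F *m (map_mx cjF A)^T) *m invmx (map_mx cjF B)^T by rewrite !mulmxA.
  rewrite eJ; apply/eqP/eqP => [->//|/(congr1 (fun Z => B *m Z *m (map_mx cjF B)^T))].
  by rewrite !mulmxA mulmxV // !mul1mx !mulmxKV.
rewrite elation_group_image SJ -conjsRg.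
have nZ : 'GL_3[F]%g \subset 'N('Z('GL_3[F]))%g by apply: gFnorm.
have quo (A : {group {'GL_3[F]}}) (Z : {set {'GL_3[F]}}) : ('ker pf)%g = Z -> (A / Z)%g \isog (pf @* A)%g.
  move=> <-; have [f injf fE] := first_isom pf_morphism.
  by rewrite -(fE A); apply: sub_isog => //; apply: quotientS; apply: subsetT.
have := quo ([~: SU3 q J, SU3 q J] :^ b^-1)%G _ ker_pf.
rewrite /= quotientJ; last by apply: (subsetP nZ); rewrite inE.
rewrite /PSU3 -quotientR ?(subset_trans (subsetT _) nZ) // => i2.
have i1 := conj_isog ([~: SU3 q J, SU3 q J] / 'Z('GL_3[F]))%G (coset 'Z('GL_3[F]) b^-1)%g.
by rewrite isog_sym; apply: isog_trans i1 i2.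
Qed.


Lemma unital_abs : is_unital (q ^ 3) abs (induced_blocks lns abs).
Proof. exact: (polar_unital Isym cardT card_pol Iuniq nq card_abs). Qed.

Local Notation IF := (ProjectiveCoordinates.I vF idfun cjF).
Local Notation absF := (abs_points IF).
Local Notation lnsF := (polar_lines IF).
Local Notation H := (abs :&: Dpts).

Let IFE x y : IF x y = (hfF (vF x) (vF y) == 0).
Proof.
have fE (u : vec F) : FigueroaVectors.frv idfun u = u by case: u => [[a b] c].
have det0 (u : vec F) : det3 u u u = 0 by vr.
by rewrite /ProjectiveCoordinates.I /FigueroaVectors.Iv /FigueroaVectors.III /FigueroaVectors.W !fE det0 eqxx.
Qed.

Let IFsym : symmetric IF. Proof. exact: I_symm. Qed.
Let IFuniq x y a b : x != y -> IF x a -> IF y a -> IF x b -> IF y b -> a = b.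
Proof. by apply: I_unique. Qed.
Let cardTF : #|TF| = (#|F| ^ 2 + #|F| + 1)%N. Proof. exact: (card_points y0). Qed.
Let card_polF y : #|[set x | IF x y]| = #|F|.+1. Proof. by apply: (card_polI y0). Qed.
Let F_gt1 : (1 < #|F|)%N. Proof. exact: finNzRing_gt1. Qed.
Let jnF x y : x != y -> IF x (jn IF x y) && IF y (jn IF x y).
Proof. by apply: (jnP (n := #|F|)). Qed.

Lemma unital_absF : is_unital q absF (induced_blocks lnsF absF).
Proof.
apply: (polar_unital (n := #|F|)) => //.
rewrite -(card_isotropic q_gt1 cardF cjFE y0 vF_neq0 vF_surj vF_inj).
by apply: eq_card => x; rewrite !inE IFE.
Qed.

Let I_phiF x y : I (phi x) (phi y) = IF x y. Proof. by rewrite I_phi IFE. Qed.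

Let H_phi x : x \in H -> exists2 y, y \in absF & x = phi y.
Proof.
rewrite !inE => /andP[xx /inD_phi[y e]]; exists y => //.
by rewrite inE -I_phiF -e.
Qed.

Let phi_H x : x \in absF -> phi x \in H.
Proof. by rewrite !inE I_phiF phi_inD andbT. Qed.

Let phi_pol y : phi @: (pol IF y :&: absF) = pol I (phi y) :&: H.
Proof.
apply/setP => x; apply/imsetP/idP => [[z + ->]|].
  by rewrite in_setI in_pol => /andP[zy /phi_H zH]; rewrite in_setI zH in_pol I_phiF zy.
rewrite in_setI in_pol => /andP[xy /H_phi[z zz e]]; exists z => //.
by rewrite in_setI zz in_pol -I_phiF -e xy.
Qed.

(** [phi] carries polars to polars within the subplane. Conversely a line with two points of [H] is
    the image of the line joining their preimages. *)
Lemma hermitian_isomorphism : isomorphic_structures absF (induced_blocks lnsF absF)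
  H (induced_blocks (induced_blocks lns abs) H).
Proof.
have aH (b : {set T}) : b :&: abs :&: H = b :&: H by rewrite -setIA (setIA abs abs) setIid.
exists phi; split; first by move=> x y _ _; apply: phi_inj.
  apply/setP => x; apply/imsetP/idP => [[y yy ->]|/H_phi[y yy ->]]; first exact: phi_H.
  by exists y.
apply/setP => b; apply/imsetP/imsetP => [[b0 + ->]|[b0]].
  case/imsetP => l; rewrite inE => /andP[/imsetP[y _ ->] c1] ->.
  have c2 : (1 < #|pol I (phi y) :&: H|)%N.
    by rewrite -phi_pol card_imset //; apply: phi_inj.
  exists (pol I (phi y) :&: abs); last by rewrite aH phi_pol.
  rewrite inE aH c2 andbT; apply/imsetP; exists (pol I (phi y)) => //.
  rewrite inE pol_line /=; apply: leq_trans c2 _.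
  by apply: subset_leq_card; rewrite setIA subsetIl.
rewrite inE => /andP[/imsetP[l + ->]]; rewrite inE => /andP[/imsetP[y _ ->] _].
rewrite aH => c1 ->; have /card_gt1P[x1 [x2 []]] := c1.
rewrite !in_setI !in_pol -!in_setI => /andP[i1 /H_phi[z1 zz1 e1']] /andP[i2 /H_phi[z2 zz2 e2]] n12.
have nz : z1 != z2 by apply: contra n12 => /eqP e; rewrite e1' e2 e.
have /andP[j1 j2] := jnF nz; set y' := jn IF z1 z2 in j1 j2.
have yE : y = phi y'.
  by apply: (Iuniq n12) => //; rewrite ?e1' ?e2 I_phiF.
exists (pol IF y' :&: absF); last by rewrite yE phi_pol.
apply/imsetP; exists (pol IF y') => //; rewrite inE pol_line /=.
by rewrite -(card_imset _ phi_inj) phi_pol -yE.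
Qed.

Lemma H_pt x : x \in H -> exists u, [/\ u != vec0 F, hfF u u = 0 & x = pt (iv u)].
Proof.
rewrite !inE => /andP[xx /inD_iv[u u0 e]]; exists u; split=> //.
by apply/eqP; rewrite -I_iv2 // -e.
Qed.

Lemma pt_H u : u != vec0 F -> hfF u u = 0 -> pt (iv u) \in H.
Proof. by move=> u0 uu; rewrite !inE I_iv2 // uu eqxx pt_iv_inD. Qed.

Lemma aut_astabs s : I_aut I s -> s \in ('N(abs | 'P))%g.
Proof. by move=> sI; apply/astabsP => x; rewrite /= apermE !inE sI. Qed.

(** An automorphism of the unital must fix all other points, hence the restriction of the elation to
    the absolute points. *)
Lemma elation_translation s c : I c c -> pol_elation I s c ->
  is_translation abs (induced_blocks lns abs) c (restr_perm abs s).
Proof.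
move=> cc sE; have [sI sc] := sE; have sN := aut_astabs sI.
have im b : restr_perm abs s @: (b :&: abs) = s @: b :&: abs.
  rewrite -[X in _ = _ :&: X](aut_abs Isym sI) -imsetI; last by move=> x y _ _; apply: perm_inj.
  by apply: eq_in_imset => x; rewrite in_setI => /andP[_ xa]; apply: restr_permE.
apply/and3P; split.
- apply/andP; split; first exact: restr_perm_on.
  apply/forall_inP => b /imsetP[l + ->]; rewrite inE => /andP[/imsetP[y _ ->] c1].
  rewrite im aut_pol //; apply/imsetP; exists (pol I (s y)) => //; rewrite inE pol_line /=.
  by rewrite -aut_pol // -im card_imset //; apply: perm_inj.
- have ca : c \in abs by rewrite inE.
  by rewrite (restr_permE sN ca) sc.
apply/forall_inP => b /imsetP[l + ->]; rewrite inE => /andP[/imsetP[y _ ->] c1].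
apply/implyP; rewrite in_setI in_pol => /andP[cy _].
by rewrite im aut_pol // sc // Isym.
Qed.

Lemma translation_group c : c \in H -> exists2 A : {group {perm T}}, #|A| = q &
  forall s, s \in A -> is_translation abs (induced_blocks lns abs) c s.
Proof.
move=> /H_pt[u [u0 uu cE]].
have cc : I c c by rewrite cE I_iv2 // uu.
(* The admissible parameters are the elements of trace zero, and there are q of them. *)
pose sk := [set l | l + cjF l == 0].
have skE l : l \in sk -> cjF l = - l.
  by rewrite inE addrC addr_eq0 => /eqP.
pose t l := gl (tm cjF u l); pose tau l := restr_perm abs (pf (t l)).
have tE l w : l \in sk -> glact (t l) w = tv cjF u l w.
  by move=> /skE sl; apply: (glact_tm cardF cjFE).
have tel l : l \in sk -> pol_elation I (pf (t l)) c.
  by move=> ls; rewrite cE; apply: (tv_elation u0 uu (skE _ ls)) => w; apply: tE.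
have tN l : l \in sk -> pf (t l) \in ('N(abs | 'P))%g.
  by move=> /tel[sI _]; apply: aut_astabs.
have skD l m : l \in sk -> m \in sk -> l + m \in sk.
  by rewrite !inE rmorphD => /eqP e1' /eqP e2; rewrite addrACA e1' e2 addr0.
have tauM l m : l \in sk -> m \in sk -> (tau l * tau m)%g = tau (l + m).
  move=> ls ms; rewrite /tau -(morphM (restr_perm_morphism abs)) ?tN // -pfM; congr (restr_perm _ (pf _)).
  apply: glact_inj => w; rewrite glactM !tE ?skD // /tv hfDl hfZl uu mulr0 addr0.
  move: (hfF w u) => h; case: (w) (u) => [[w1 w2] w3] [[u1 u2] u3].
  by rewrite /vadd /vsc /=; apply: vecE; ring.
have s0 : 0 \in sk by rewrite inE rmorph0 addr0.
have tau0 : tau 0 = 1%g.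
  have := tauM 0 0 s0 s0; rewrite addr0 => /(canRL (mulKg _)).
  by rewrite mulVg.
have gA : group_set [set tau l | l in sk].
  apply/group_setP; split; first by apply/imsetP; exists 0.
  by move=> _ _ /imsetP[l ls ->] /imsetP[m ms ->]; rewrite tauM //; apply: imset_f; apply: skD.
have [w [w0 ww wu]] := isotropic_pair u0 uu.
exists (group gA).
  have c0 : cjF 0 = 0 by rewrite rmorph0.
  rewrite -[RHS](card_trace q_gt1 cardF cjFE c0) /= card_in_imset // => l m ls ms e.
  have := congr1 (fun s : {perm T} => s (pt (iv w))) e.
  have wa : pt (iv w) \in abs by rewrite inE I_iv2 // ww.
  rewrite /tau !restr_permE ?tN // !pf_iv // !tE // => /eqP.
  rewrite pt_inj ?iv_eq0 -?(tE l) -?(tE m) ?glact_eq0 // !tE // iv_par.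
  exact: tv_par_inj.
move=> _ /imsetP[l ls ->]; apply: elation_translation => //; exact: tel.
Qed.

Lemma H_Omega p : prime p -> (p %| q)%N -> H \subset Omega p abs (induced_blocks lns abs).
Proof.
move=> pp pq; apply/subsetP => c cH; have [A cA AT] := translation_group cH.
have pA : (p %| #|A|)%N by rewrite cA.
have [s sA os] := Cauchy pp pA.
rewrite inE; apply/andP; split; first by move: cH; rewrite inE => /andP[].
by apply/existsP; exists s; rewrite AT // os eqxx.
Qed.

Lemma elation_group_2transitive : (2 < q)%N ->
  [transitive^2 <<unital_elations>>, on H | 'P]%g.
Proof.
move=> q2; set G := (<<unital_elations>>)%G.
have GE : G = (pf @* N0)%g :> {set _}.
  by rewrite /= elation_group_image (N0_der1 q_gt1 cardF cjFE).
have pfG g : g \in N0 -> pf g \in G.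
  by move=> gN; rewrite -[_ \in _]/(_ \in (G : {set _})) GE mem_morphim ?inE.
have Gpf s : s \in G -> exists2 g, g \in N0 & s = pf g.
  by rewrite -[_ \in _]/(_ \in (G : {set _})) GE => /morphimP[g _ gN ->]; exists g.
have GH s x : s \in G -> x \in H -> s x \in H.
  move=> /Gpf[g gN ->] /H_pt[u [u0 uu ->]].
  have gS : g \in S by apply: (subsetP (N0_sub cardF cjFE)).
  by rewrite pf_iv // pt_H ?glact_eq0 // (S_isometry gS).
pose e3 : vec F := (0, 0, 1).
have e3n : e3 != vec0 F by rewrite !xpair_eqE oner_eq0 andbF.
have e3e : hfF e3 e3 = 0.
  by rewrite /FigueroaVectors.hf /dot /FigueroaVectors.sharp /= !rmorph0 !mulr0 !mul0r !addr0.
have n13 : ~~ par e1 e3.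
  by apply/eqP => -[_ h _]; move: h; rewrite /= mul0r mul1r sub0r => /eqP; rewrite oppr_eq0 oner_eq0.
set c0 := pt (iv e1); set d0 := pt (iv e3).
have c0H : c0 \in H by exact: (pt_H e1n e1e).
have d0H : d0 \in H :\ c0.
  by rewrite in_setD1 (pt_H e3n e3e) andbT pt_inj ?iv_eq0 ?e1n ?e3n // iv_par par_sym.
apply: (stab_ntransitiveI c0H).
  apply/imsetP; exists c0 => //; apply/setP => y; apply/idP/orbitP => [|[s sG <-]]; last first.
    by rewrite /= apermE GH.
  move=> /H_pt[w [w0 ww ->]]; have [g gN [k k0 e]] := N0_trans q_gt1 cardF cjFE e1n w0 e1e ww.
  exists (pf g); first exact: pfG.
  rewrite /= apermE pf_iv // e; apply/eqP; rewrite pt_inj ?iv_eq0 ?vsc_eq0 ?negb_or ?k0 //.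
  by rewrite iv_par par_vsc.
apply: (stab_ntransitiveI d0H); last exact: ntransitive0.
apply/imsetP; exists d0 => //; apply/setP => y; apply/idP/orbitP => [|[s]]; last first.
  rewrite inE => /andP[sG /astab1P sc <-]; move: sc; rewrite /= !apermE => sc.
  by rewrite in_setD1 GH ?(setDP d0H).1 // -{1}sc (inj_eq perm_inj) andbT; case/setD1P: d0H.
case/setD1P => ny /H_pt[w [w0 ww yE]].
have nw : ~~ par e1 w.
  by apply: contra ny; rewrite yE eq_sym pt_inj ?iv_eq0 // iv_par.
have [g gN [gc gd]] := N0_2trans q_gt1 cardF cjFE q2 e1n e3n w0 e1e e3e ww n13 nw.
exists (pf g).
  rewrite inE pfG //=; apply/astab1P; rewrite /= apermE pf_iv //; apply/eqP.
  by rewrite pt_inj ?iv_eq0 ?glact_eq0 // iv_par.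
rewrite /= apermE pf_iv // yE; apply/eqP.
by rewrite pt_inj ?iv_eq0 ?glact_eq0 // iv_par.
Qed.

Lemma polar_unital_elations p (J B : 'M[F]_3) : prime p -> (p %| q)%N ->
  B *m J *m (map_mx cjF B)^T = A0 F ->
  is_unital (q ^ 3) abs (induced_blocks lns abs) /\
  [/\ is_subunital q abs (induced_blocks lns abs) H /\
        isomorphic_structures absF (induced_blocks lnsF absF)
          H (induced_blocks (induced_blocks lns abs) H),
      forall c, c \in H -> exists2 A : {group {perm T}}, #|A| = q &
        forall s, s \in A -> is_translation abs (induced_blocks lns abs) c s,
      H \subset Omega p abs (induced_blocks lns abs),
      <<[set s : {perm T} | is_elation lns s && (s @: abs == abs)]>>%g
        \isog [~: PSU3 q J, PSU3 q J]%g
    & (2 < q)%N -> [transitive^2 <<[set s : {perm T} | is_elation lns s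
        && (s @: abs == abs)]>>, on H | 'P]%g].
Proof.
move=> pp pq BE; split; first exact: unital_abs.
split; last exact: elation_group_2transitive.
- split; last exact: hermitian_isomorphism.
  split; first exact: subsetIl.
  exact: unital_transfer hermitian_isomorphism unital_absF.
- exact: translation_group.
- exact: H_Omega.
- exact: elation_group_isog BE.
Qed.

End Action.

Lemma normal_form_inv (L : fieldType) (cj : {rmorphism L -> L}) (B N : 'M[L]_3) :
  B *m N *m (map_mx cj B)^T = A0 L ->
  B \in unitmx /\ N = invmx B *m A0 L *m (map_mx cj (invmx B))^T.
Proof.
move=> e; have uB : B \in unitmx.
  by have := A0_unit L; rewrite -e -mulmxA unitmx_mul => /andP[].
have uBc : (map_mx cj B)^T \in unitmx by rewrite unitmx_tr map_unitmx.
by split=> //; rewrite map_invmx trmx_inv -e mulmxA mulKmx // mulmxK.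
Qed.

Unset Implicit Arguments.

Theorem theorem5p2 (p e q : nat) (p_prime : prime p) (e_gt0 : (0 < e)%N)
    (q_def : q = (p ^ e)%N)
    (K : finFieldType) (cardK : #|K| = (q ^ 6)%N)
    (M : 'M[K]_3) (M_hermitian : is_hermitian_form (q ^ 3) M)
    (M_over_subfield : map_mx (fun x : K => (x ^+ (q ^ 2))%R) M = M)
    (F : finFieldType) (cardF : #|F| = (q ^ 2)%N)
    (J : 'M[F]_3) (J_hermitian : is_hermitian_form q J) :
  is_unital (q ^ 3) (U_points q M) (U_blocks q M) /\
  [/\ is_subunital q (U_points q M) (U_blocks q M) (H_points q M)
        /\ isomorphic_structures
             (hermitian_points q J) (hermitian_blocks q J)
             (H_points q M) (H_blocks q M),
      forall c, c \in H_points q M ->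
        exists2 A : {group {perm point K}}, #|A| = q &
          forall s, s \in A -> is_translation (U_points q M) (U_blocks q M) c s,
      H_points q M \subset Omega p (U_points q M) (U_blocks q M),
      U_elation_group q M \isog [~: PSU3 q J, PSU3 q J]%g
    & (2 < q)%N ->
      [transitive^2 U_elation_group q M, on H_points q M | 'P]%g].
Proof.
have q_gt1 : (1 < q)%N by rewrite q_def -(exp1n e) ltn_exp2r ?prime_gt1.
have cardKp : #|K| = (p ^ (e * 6))%N by rewrite cardK q_def expnM.
have cardFp : #|F| = (p ^ (e * 2))%N by rewrite cardF q_def expnM.
have cardKp' : #|K| = (p ^ (e * 2 * 3))%N by rewrite cardKp -mulnA.
have [fr frE'] := pow_rmorphism (e * 2) p_prime cardKp.
have [cj cjE'] := pow_rmorphism (e * 3) p_prime cardKp.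
have [cjF cjFE'] := pow_rmorphism e p_prime cardFp.
have frE x : fr x = x ^+ (q ^ 2)%N by rewrite frE' expnM -q_def.
have cjE x : cj x = x ^+ (q ^ 3)%N by rewrite cjE' expnM -q_def.
have cjFE x : cjF x = x ^+ q by rewrite cjFE' -q_def.
have K6 x : x ^+ (q ^ 6)%N = x :> K by rewrite -cardK expf_card.
have fr3 x : fr (fr (fr x)) = x by rewrite !frE -!exprM -!expnD K6.
have cj2 x : cj (cj x) = x by rewrite !cjE -!exprM -!expnD K6.
have cjfr x : cj (fr x) = fr (cj x) by rewrite !cjE !frE -!exprM mulnC.
have [iota _] := embedding_ex p_prime cardFp cardKp'.
have F2 x : x ^+ (q ^ 2)%N = x :> F by rewrite -cardF expf_card.
have fr_iota a : fr (iota a) = iota a by rewrite frE -rmorphXn F2.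
have cj_iota a : cj (iota a) = iota (cjF a).
  by rewrite cjE -rmorphXn (expnD q 2 1) exprM F2 expn1 cjFE.
have iota_im x : fr x = x -> exists a, x = iota a.
  by rewrite frE' => /(embedding_image cardFp).
have cardK3 : #|K| = ((q ^ 2) ^ 3)%N by rewrite cardK -expnM.
have [Mh Mu] := M_hermitian; have [Jh Ju] := J_hermitian.
rewrite (map_mx_pow _ cjE) in Mh; rewrite (map_mx_pow _ cjFE) in Jh.
rewrite (map_mx_pow _ frE) in M_over_subfield.
(* The entries of [M] are fixed by [fr], hence in the image of [iota]; the default 0 is never
   taken. *)
have [MF ME] : exists MF : 'M[F]_3, M = map_mx iota MF.
  exists (\matrix_(i, j) odflt 0 [pick a | iota a == M i j]); apply/matrixP => i j.
  rewrite !mxE; case: pickP => [a /eqP //|none].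
  have [a ea] : exists a, M i j = iota a by apply: iota_im; rewrite -{2}M_over_subfield mxE.
  by have := none a; rewrite ea eqxx.
have MFh : (map_mx cjF MF)^T = MF.
  apply/matrixP => i j; apply: (fmorph_inj iota).
  by have := congr1 (fun A : 'M[K]_3 => A i j) Mh; rewrite ME !mxE cj_iota.
have MFu : MF \in unitmx by rewrite -(map_unitmx iota) -ME.
(* The normal form is taken over [F] and not over [K], so that the change of coordinates [C]
   commutes with Frobenius and respects the types. *)
have [B BE] := hermitian_normal_form q_gt1 cardF cjFE MFh MFu.
have [uB MFE] := normal_form_inv BE.
have [BJ BJE] := hermitian_normal_form q_gt1 cardF cjFE Jh Ju.
have [uBJ JE] := normal_form_inv BJE.
pose C := map_mx iota (invmx B).
have uC : C \in unitmx by rewrite map_unitmx unitmx_inv.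
have CM : M = C *m A0 K *m (map_mx cj C)^T.
  rewrite ME {1}MFE !map_mxM; congr (_ *m _ *m _).
    by apply/matrixP => i j; rewrite !mxE rmorph_nat.
  by apply/matrixP => i j; rewrite !mxE cj_iota.
have Cfix : map_mx fr C = C by apply/matrixP => i j; rewrite !mxE fr_iota.
have uCJ : invmx BJ \in unitmx by rewrite unitmx_inv.
have cjF2 := conjK cardF cjFE.
have e10 (L : finFieldType) : (1, 0, 0) != vec0 L by rewrite !xpair_eqE oner_eq0.
have [x0 _] := crd_surj uC (e10 K); have [y0 _] := crd_surj uCJ (e10 F).
rewrite /U_blocks /H_blocks /U_blocks /H_points /U_elation_group /hermitian_blocks /U_points.
have -> : fig_absolute_points (q ^ 2) (q ^ 3) M = abs_points (I (crd C) fr cj).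
  by apply: fig_absolute_abs.
have -> : fig_lines K (q ^ 2) = polar_lines (I (crd C) fr cj) by apply: fig_lines_polar.
have -> : hermitian_points q J = abs_points (I (crd (invmx BJ)) idfun cjF).
  by apply: hermitian_points_abs.
have -> : desarguesian_lines F = polar_lines (I (crd (invmx BJ)) idfun cjF).
  by apply: desarguesian_lines_polar.
have -> : subplane_points K (q ^ 2) = Dpts (crd C) fr.
  by apply/setP => x; rewrite !inE; apply: subplane_inD.
have pq : (p %| q)%N by rewrite q_def dvdn_exp.
exact: (@polar_unital_elations F K q cjF fr cj iota q_gt1 cardF cardK3 cjFE cjE frE fr3 cj2
  cjfr fr_iota cj_iota iota_im _ _ x0 (crd_neq0 uC) (@crd_surj _ _ uC) (@crd_inj _ _ uC)
  _ _ y0 (crd_neq0 uCJ) (@crd_surj _ _ uCJ) (@crd_inj _ _ uCJ) p J BJ p_prime pq BJE).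
Qed.
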